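(* Let $n \ge 1$ and let $T : \mathbb{R}_n[z] \to \mathbb{R}[z]$ be a linear operator. Then $T$ preserves majorization if and only if at least one of the following holds: (1) $T$ is nondegenerate and $T(\mathcal{H}_n) \subseteq \mathcal{H}_m$ for some $m$; or (2) $T$ is of the form $T\left(\sum_{k=0}^n a_k z^k\right) = a_n T(z^n) + a_{n-1} T(z^{n-1})$, where $T(z^n) \not\equiv 0$ is hyperbolic, and either $T(z^{n-1}) \equiv 0$, or $T(z^{n-1})$ is a hyperbolic polynomial which is not a constant multiple of $T(z^n)$ and $T(z^{n-1})$ and $T(z^n)$ have interlacing zeros. Moreover, condition (1) is equivalent to the following: $T$ is nondegenerate, at least one of the bivariate polynomials $F_T(z,w)$ and $F_T(z,-w)$ is stable, and $\deg(T(z^n)) > \deg(T(z^k))$ for all $0 \le k < n$.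
   Context: $\mathbb{R}_n[z]$ is the real linear space of real polynomials in $z$ of degree at most $n$. A (nonzero) polynomial in $\mathbb{R}[z]$ is hyperbolic if it has only real zeros; in particular nonzero constants are hyperbolic. $\mathcal{H}_m$ denotes the set of all hyperbolic polynomials of degree exactly $m$ ($m \ge 0$ an integer). The zero polynomial belongs to no $\mathcal{H}_m$, and $\deg 0 = -\infty$. Majorization: for weakly increasing vectors $x=(x_1,\dots,x_m)$ and $y=(y_1,\dots,y_m)$ in $\mathbb{R}^m$, write $x \prec y$ ($y$ majorizes $x$) if $\sum_{i=1}^m x_i = \sum_{i=1}^m y_i$ and $\sum_{i=0}^{k} x_{m-i} \le \sum_{i=0}^{k} y_{m-i}$ for each $0 \le k \le m-2$. For $p \in \mathcal{H}_m$, let $\mathcal{Z}(p) \in \mathbb{R}^m$ be the weakly increasing vector of zeros of $p$, counted with multiplicity. For $p,q \in \mathcal{H}_m$, write $p \prec q$ if $p$ and $q$ have the same leading coefficient and $\mathcal{Z}(p) \prec \mathcal{Z}(q)$. The relation $f \prec g$ between two polynomials in $\mathbb{R}[z]$ means that $f,g \in \mathcal{H}_m$ for some $m$ and $f \prec g$ in this sense. A linear operator $T:\mathbb{R}_n[z] \to \mathbb{R}[z]$ preserves majorization if $T(p) \prec T(q)$ whenever $p,q \in \mathcal{H}_n$ are such that $p \prec q$ (in particular, $T(p)$ and $T(q)$ must be hyperbolic of the same degree). Two hyperbolic polynomials $p,q$ with zeros (counted with multiplicity) $x_1 \le x_2 \le \cdots$ and $y_1 \le y_2 \le \cdots$, respectively,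 have interlacing zeros if $x_1 \le y_1 \le x_2 \le y_2 \le \cdots$ or $y_1 \le x_1 \le y_2 \le x_2 \le \cdots$, where all zeros of both polynomials are used in the alternating chain (so the degrees of $p$ and $q$ differ by at most one). $T$ is degenerate if $\dim(T(\mathbb{R}_n[z])) \le 2$, and nondegenerate otherwise. The symbol of $T$ is $F_T(z,w) = \sum_{k=0}^n \binom{n}{k} T(z^k) w^{n-k}$. A polynomial in $\mathbb{C}[z_1,\dots,z_n]$ is stable if it is nonzero whenever all variables have positive imaginary parts. *)

(* Defs.v *)
From mathcomp Require Import all_boot all_order all_algebra.
From mathcomp Require Import reals.
From mathcomp Require Import polyorder polyrcf complex mpoly.

Set Implicit Arguments.
Unset Strict Implicit.
Unset Printing Implicit Defensive.

Import Order.TTheory GRing.Theory Num.Theory.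

Local Open Scope ring_scope.
Local Open Scope complex_scope.

(* The space of real polynomials of degree at most n is [{poly_n.+1 R}],
   since the index of [{poly__ R}] bounds the size, that is degree + 1. *)

Section Hyperbolic.
Variable R : realType.
Implicit Types p q : {poly R}.

Definition hyperbolic p : Prop :=
  p != 0 /\
  forall z : R[i], root (map_poly (real_complex R) p) z -> complex.Im z = 0.

Definition hyperbolic_deg (m : nat) p : Prop := hyperbolic p /\ size p = m.+1.

(* [rootsR p] lists the distinct real roots of p in increasing order, so
   [zeros p] is weakly increasing; it has length deg p when p is hyperbolic. *)
Definition zeros p : seq R := flatten [seq nseq (\mu_x p) x | x <- rootsR p].

(* Only meant for weakly increasing sequences of the same length. Entries are
   numbered from 0: the (m - i)-th entry of the 1-based convention is
   x`_(m - i.+1). *)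
Definition majorized (x y : seq R) : Prop :=
  [/\ size x = size y,
      \sum_(a <- x) a = \sum_(a <- y) a &
      forall k, (k.+2 <= size x)%N ->
        \sum_(i < k.+1) x`_(size x - i.+1) <= \sum_(i < k.+1) y`_(size y - i.+1)].

Definition poly_majorized p q : Prop :=
  exists m : nat,
    [/\ hyperbolic_deg m p, hyperbolic_deg m q, lead_coef p = lead_coef q &
        majorized (zeros p) (zeros q)].

(* The chain x_1 <= y_1 <= x_2 <= y_2 <= ..., exhausting both sequences. *)
Definition alternating (x y : seq R) : Prop :=
  [/\ (size y <= size x <= (size y).+1)%N,
      forall i, (i < size y)%N -> x`_i <= y`_i &
      forall i, (i.+1 < size x)%N -> y`_i <= x`_i.+1].

Definition interlacing p q : Prop :=
  alternating (zeros p) (zeros q) \/ alternating (zeros q) (zeros p).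

End Hyperbolic.

Definition has_dim (K : fieldType) (V : lmodType K) (S : V -> Prop) (d : nat)
    : Prop :=
  exists e : 'I_d -> V,
    [/\ forall i, S (e i),
        forall c : 'I_d -> K, \sum_(i < d) c i *: e i = 0 -> forall i, c i = 0 &
        forall v, S v -> exists c : 'I_d -> K, v = \sum_(i < d) c i *: e i].

Definition stable (R : realType) (n : nat) (F : {mpoly R[i][n]}) : Prop :=
  forall v : 'I_n -> R[i], (forall i, 0 < complex.Im (v i)) -> F.@[v] != 0.

Section Operators.
Variables (R : realType) (n : nat).
Variable T : {linear {poly_n.+1 R} -> {poly R}}.

(* T(z^k), meaningful for k <= n only: npolyp truncates. *)
Definition Tmon (k : nat) : {poly R} := T (npolyp n.+1 'X^k).

Definition preserves_majorization : Prop :=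
  forall p q : {poly_n.+1 R},
    hyperbolic_deg n p -> hyperbolic_deg n q ->
    poly_majorized p q -> poly_majorized (T p) (T q).

Definition degenerate : Prop :=
  exists2 d : nat, has_dim (fun f => exists p, T p = f) d & (d <= 2)%N.

(* The variables z and w are 'X_0 and 'X_1. *)
Definition symbol : {mpoly R[2]} :=
  \sum_(k < n.+1)
    ((map_poly (@mpolyC 2 R) (Tmon k)).['X_0] * 'X_1 ^+ (n - k)) *+ 'C(n, k).

Definition symbol_neg : {mpoly R[2]} :=
  symbol \mPo [tuple 'X_0; - 'X_1].

Definition real_stable (F : {mpoly R[2]}) : Prop :=
  stable (map_mpoly (real_complex R) F).

End Operators.

(* Main.v *)
(* A real polynomial is hyperbolic iff it has no zeros in the upper half plane
   H. Suppose that T maps hyperbolic polynomials of degree n to hyperbolic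
   polynomials of one fixed degree, and write (z + w)^n = p + i q with w in H.
   If Im (Tp * conj Tq) vanished somewhere in H, then T would kill a real
   combination of p and q; all small real perturbations of that combination
   stay hyperbolic, so every T r would be hyperbolic or zero, and evaluation at
   i would show that the image has dimension at most 2. Hence, for a
   nondegenerate T, |F(z,w)| - |F(z,conj w)| has a constant sign on H x H, and
   F(z,w) or F(z,-w) is stable. Conversely, by the theorems of
   Grace-Walsh-Szego and Hurwitz, a stable symbol makes T preserve
   hyperbolicity.

   For majorization it suffices, by Hardy-Littlewood-Polya, to compare values of
   T at (z - u - t)(z - u + t) r for varying t. Then T changes by a multiple of
   h = T r, and the polynomials f = T((z - u - t)(z - u + t) r),
   g = T((z - u) r) and h interlace successively. So h is a positive combination
   of the quotients g / (z - nu) over the zeros nu of g, and subtracting one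
   such term moves the zeros of f with a single crossing at nu.

   If T preserves majorization and does not vanish on polynomials of degree at
   most n - 2, then deg T r + 2 <= deg T((z - u)^2 r) for a suitable r, whereas
   deg T(z r) <= deg T r + 1; this gives the degree condition and three linearly
   independent values of T. Otherwise T has the form (2), where hyperbolicity of
   the pencil spanned by T(z^n) and T(z^{n-1}) amounts to interlacing. *)
Require Import Defs.
From mathcomp Require Import all_boot all_order all_algebra.
From mathcomp Require Import reals.
From mathcomp Require Import polyorder polyrcf complex mpoly ring lra zify.

Set Implicit Arguments.
Unset Strict Implicit.
Unset Printing Implicit Defensive.

Import Order.TTheory GRing.Theory Num.Theory.

Local Open Scope ring_scope.
Local Open Scope complex_scope.

(** * Polynomials without zeros in the upper half plane *)

Section ComplexPlane.
Variable R : realType.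
Local Notation C := R[i].
Local Notation Im := (@complex.Im R).
Local Notation Re := (@complex.Re R).
Implicit Types (z w u : C) (p q A B : {poly C}).

(** The analysis uses only [sqn], the squared modulus, and [cross]. Along a segment both are
    polynomials in a real parameter, so the connectedness of H reduces to the intermediate value
    theorem for polynomials, and limits are taken in one real parameter. [Nev f g] expresses that Im
    (f / g) is nonnegative without dividing; it is stable under sums in each argument and tolerates
    zeros.

    The obstacle is degree. A limit of real-rooted polynomials may vanish, whence the disjunction
    [rrooted0], and interlacing alone does not tell by how much T lowers degrees. The majorization
    step needs T to lose exactly one degree with each removed factor, unless the image vanishes.
    This comes from the coefficient of T r in degree deg T(z^n) - 1, for monic real-rooted r of
    degree n - 1: it never changes sign although it is affine in every zero of r, so it does not
    depend on r, and it vanishes for r of degree n - 2. *)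

Definition sqn z : R := Re z ^+ 2 + Im z ^+ 2.

(* [cross z w] is the imaginary part of [z] times the conjugate of [w]. *)
Definition cross z w : R := Im z * Re w - Re z * Im w.

Lemma sqn_ge0 z : 0 <= sqn z.
Proof. by rewrite addr_ge0 ?sqr_ge0. Qed.

Lemma sqn_eq0 z : (sqn z == 0) = (z == 0).
Proof.
by case: z => a b; rewrite /sqn /= paddr_eq0 ?sqr_ge0 // !sqrf_eq0 eq_complex.
Qed.

Lemma sqn_gt0 z : (0 < sqn z) = (z != 0).
Proof. by rewrite lt_neqAle sqn_ge0 andbT eq_sym sqn_eq0. Qed.

Lemma sqn0 : sqn 0 = 0.
Proof. by apply/eqP; rewrite sqn_eq0. Qed.

Lemma sqnM z w : sqn (z * w) = sqn z * sqn w.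
Proof. by case: z => a b; case: w => c d; rewrite /sqn; simpc => /=; ring. Qed.

Lemma sqnX z n : sqn (z ^+ n) = sqn z ^+ n.
Proof.
elim: n => [|n IHn]; last by rewrite !exprS sqnM IHn.
by rewrite /sqn /= expr1n expr0n /= addr0.
Qed.

Lemma sqn_real (x : R) : sqn x%:C = x ^+ 2.
Proof. by rewrite /sqn /= expr0n addr0. Qed.

Lemma sqnN z : sqn (- z) = sqn z.
Proof. by case: z => a b; rewrite /sqn /= !sqrrN. Qed.

Lemma sqnJ z : sqn z^* = sqn z.
Proof. by case: z => a b; rewrite /sqn /= !sqrrN. Qed.

Lemma crossDl z w u : cross (z + w) u = cross z u + cross w u.
Proof. by case: z => a b; case: w => c d; case: u => e f; rewrite /cross; simpc => /=; ring. Qed.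

Lemma crossDr z w u : cross u (z + w) = cross u z + cross u w.
Proof. by case: z => a b; case: w => c d; case: u => e f; rewrite /cross; simpc => /=; ring. Qed.

Lemma crossZl (x : R) z w : cross (x%:C * z) w = x * cross z w.
Proof. by case: z => a b; case: w => c d; rewrite /cross; simpc => /=; ring. Qed.

Lemma crossZr (x : R) z w : cross z (x%:C * w) = x * cross z w.
Proof. by case: z => a b; case: w => c d; rewrite /cross; simpc => /=; ring. Qed.

Lemma crossNl z w : cross (- z) w = - cross z w.
Proof. by case: z => a b; case: w => c d; rewrite /cross; simpc => /=; ring. Qed.

Lemma crossNr z w : cross z (- w) = - cross z w.
Proof. by case: z => a b; case: w => c d; rewrite /cross; simpc => /=; ring. Qed.

Lemma crossC z w : cross w z = - cross z w.
Proof. by rewrite /cross; ring. Qed.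

Lemma crosszz z : cross z z = 0.
Proof. by rewrite /cross; ring. Qed.

Lemma cross0l z : cross 0 z = 0.
Proof. by rewrite /cross /=; ring. Qed.

Lemma cross0r z : cross z 0 = 0.
Proof. by rewrite /cross /=; ring. Qed.

Lemma crossM z w u : cross (u * z) (u * w) = sqn u * cross z w.
Proof. by case: z => a b; case: w => c d; case: u => e f; rewrite /cross /sqn; simpc => /=; ring. Qed.

Lemma cross_mull z w : cross (z * w) w = Im z * sqn w.
Proof. by case: z => a b; case: w => c d; rewrite /cross /sqn; simpc => /=; ring. Qed.

Lemma crossVl z w : w != 0 -> cross z w = sqn w * Im (z / w).
Proof. by move=> w0; rewrite mulrC -cross_mull divfK. Qed.

Lemma horner_real A (t : R) :
  A.[t%:C] = (map_poly Re A).[t] +i* (map_poly Im A).[t].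
Proof.
rewrite (@horner_coef_wide _ (size A)) ?size_poly //.
have -> : forall n (F : 'I_n -> C), \sum_(i < n) F i =
    (\sum_(i < n) Re (F i)) +i* (\sum_(i < n) Im (F i)).
  move=> n F; elim/big_rec3: _ => // i x y z _ ->.
  by case: (F i).
congr Complex; rewrite (@horner_coef_wide _ (size A)) ?size_poly //.
  apply: eq_bigr => i _; rewrite coef_map_id0 //.
  by rewrite -rmorphXn /=; case: (A`_i) => a b; rewrite /= mulr0 subr0.
apply: eq_bigr => i _; rewrite coef_map_id0 //.
by rewrite -rmorphXn /=; case: (A`_i) => a b; rewrite /= mulr0 add0r.
Qed.

(* [cross A.[t] B.[t]] is a polynomial in the real variable [t], so the
   intermediate value theorem for polynomials applies. *)
Lemma cross_ivt A B :
  (forall t : R, 0 <= t <= 1 -> cross A.[t%:C] B.[t%:C] != 0) ->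
  0 < cross A.[0] B.[0] -> 0 < cross A.[1] B.[1].
Proof.
move=> nz0 c0; rewrite ltNge; apply/negP => c1.
pose P := map_poly Re A * map_poly Im B - map_poly Im A * map_poly Re B.
have PE t : P.[t] = - cross A.[t%:C] B.[t%:C].
  by rewrite !horner_real /cross /= !hornerE opprB.
have [||t /andP[t0 t1]] := @poly_ivt _ P 0 1.
- exact: ler01.
- by rewrite !PE oppr_le0 oppr_ge0 (ltW c0).
- by rewrite /root PE oppr_eq0 (negPf (nz0 _ _)) // t0 t1.
Qed.

Definition stableC p := forall z, 0 < Im z -> p.[z] != 0.

(** Passage to the limit [e] -> 0+ by one explicit [e]: for negative [a], the chosen value keeps
    [|b| * e + |c| * e ^+ 2] below [- a / 2]. *)
Lemma quadratic_limit (a b c : R) :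
  (forall e, 0 < e -> 0 <= a + b * e + c * e ^+ 2) -> 0 <= a.
Proof.
move=> h; rewrite leNgt; apply/negP => a0.
have s0 : 0 < `|b| + `|c| + 1 by rewrite ltr_wpDl // addr_ge0.
pose e := Num.min 1 (- a / (`|b| + `|c| + 1) / 2).
have e0 : 0 < e by rewrite lt_min ltr01 /= !divr_gt0 // oppr_gt0.
have e1 : e <= 1 by rewrite ge_min lexx.
have := h e e0; apply/negP; rewrite -ltNge.
have : e * (`|b| + `|c| + 1) <= - a / 2.
  rewrite -ler_pdivlMr // mulrAC; by rewrite ge_min lexx orbT.
have bb : b * e <= `|b| * e by rewrite ler_wpM2r ?ler_norm // ltW.
have cc : c * e ^+ 2 <= `|c| * e.
  apply: (@le_trans _ _ (`|c| * e ^+ 2)); first by rewrite ler_wpM2r ?ler_norm ?sqr_ge0.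
  by rewrite ler_wpM2l // expr2 ger_pMl.
have := e0; nra.
Qed.

Lemma Im_root_le0 p z : stableC p -> root p z -> Im z <= 0.
Proof. by move=> nzp /rootP pz; rewrite leNgt; apply/negP => /nzp /eqP. Qed.

Lemma stableC_split p : stableC p -> p = 0 \/ exists s : seq C,
  [/\ p = lead_coef p *: \prod_(x <- s) ('X - x%:P), lead_coef p != 0,
     size p = (size s).+1 & forall x, x \in s -> Im x <= 0].
Proof.
move=> nzp; have [->|p0] := eqVneq p 0; first by left.
right; have [s ps] := closed_field_poly_normal p; exists s; split=> //.
- by rewrite lead_coef_eq0.
- by rewrite ps size_scale ?lead_coef_eq0 // size_prod_XsubC.
- move=> x xs; apply: Im_root_le0 nzp _.
  by rewrite ps rootZ ?lead_coef_eq0 // root_prod_XsubC.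
Qed.

Lemma sqn_prod (s : seq C) z :
  sqn (\prod_(x <- s) ('X - x%:P)).[z] = \prod_(x <- s) sqn (z - x).
Proof.
elim: s => [|x s IH]; first by rewrite !big_nil hornerE /sqn /= expr1n expr0n addr0.
by rewrite !big_cons hornerM sqnM IH hornerXsubC.
Qed.

(* Each factor [sqn (z0 - x)] of a polynomial without zeros in the upper half
   plane dominates a fixed multiple of [sqn (z1 - x)]. *)
Lemma stableC_compare (N : nat) z0 z1 : 0 < Im z0 -> exists2 K : R, 0 < K &
  forall p, (size p <= N.+1)%N -> stableC p -> K * sqn p.[z1] <= sqn p.[z0].
Proof.
(* For [Im x <= 0] the constant comes from |z1 - x|^2 <= 2 |z0 - x|^2 + 2 |z1 - z0|^2 and (Im z0)^2
   <= |z0 - x|^2. Since [K <= 1], the power [K ^+ N] serves all degrees up to [N]. *)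
move=> y0; pose K := (2 + 2 * sqn (z1 - z0) / Im z0 ^+ 2)^-1.
have q0 : 0 <= 2 * sqn (z1 - z0) / Im z0 ^+ 2.
  by rewrite divr_ge0 ?sqr_ge0 // mulr_ge0 ?sqn_ge0.
have K0 : 0 < K by rewrite invr_gt0 ltr_wpDr.
have K1 : K <= 1 by rewrite invf_le1 ?ltr_wpDr //; lra.
exists (K ^+ N); first by rewrite exprn_gt0.
move=> p sp /stableC_split [->|[s [ps _ sps simp]]].
  by rewrite !horner0 !sqn0 mulr0.
rewrite ps !hornerZ !sqnM mulrCA ler_wpM2l ?sqn_ge0 // !sqn_prod.
have sN : (size s <= N)%N by rewrite -ltnS -sps.
apply: (@le_trans _ _ (K ^+ (size s) * \prod_(x <- s) sqn (z1 - x))).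
  rewrite ler_wpM2r ?prodr_ge0 // => [*|]; first exact: sqn_ge0.
  by rewrite ler_wiXn2l // ltW.
elim: s simp {ps sps sN} => [|x s IH] simp; first by rewrite !big_nil expr0 mulr1.
rewrite !big_cons exprS mulrACA; apply: ler_pM.
- by rewrite mulr_ge0 ?sqn_ge0 ?ltW.
- by rewrite mulr_ge0 ?prodr_ge0 ?exprn_ge0 // => [|*]; [exact: ltW|exact: sqn_ge0].
- rewrite mulrC ler_pdivrMr ?ltr_wpDr //.
  have : Im x <= 0 by rewrite simp ?mem_head.
  have : Im z0 ^+ 2 != 0 by rewrite lt0r_neq0 // exprn_gt0.
  have hh : sqn (z1 - x) <= 2 * sqn (z0 - x) + 2 * sqn (z1 - z0).
    case: (z0) (z1) (x) => [a b] [c d] [e f]; rewrite /sqn; simpc => /=.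
    have := sqr_ge0 (a + a - e - c); have := sqr_ge0 (b + b - f - d); nra.
  have h2 : Im z0 ^+ 2 <= sqn (z0 - x).
    have := simp x (mem_head _ _); have := y0.
    case: (z0) (x) => [a b] [c d] /= b0 d0; rewrite /sqn; simpc => /=.
    have := sqr_ge0 (a - c); nra.
  move=> i0 _; apply: (le_trans hh); rewrite [leRHS]mulrDr [sqn (z0 - x) * 2]mulrC lerD2l.
  rewrite mulrA ler_pdivlMr ?exprn_gt0 // mulrC ler_wpM2r //.
  by rewrite mulr_ge0 // sqn_ge0.
- by apply: IH => y ys; apply: simp; rewrite in_cons ys orbT.
Qed.

Lemma poly_eq0_upper p : (forall z, 0 < Im z -> p.[z] = 0) -> p = 0.
Proof.
move=> h; apply/eqP; apply/negPn/negP => p0.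
have := @max_poly_roots _ p [seq 0 +i* (k.+1)%:R | k <- iota 0 (size p)] p0.
rewrite size_map size_iota ltnn => H; apply/negP: isT; rewrite -[~~ true]/(false); apply: H.
  apply/allP => _ /mapP[k _ ->]; apply/rootP/h => /=; by rewrite ltr0n.
rewrite map_inj_uniq ?iota_uniq // => i j [] /eqP; rewrite eqr_nat eqSS; by move/eqP.
Qed.

Lemma sqnD z w : sqn (z + w) = sqn z + 2 * (Re z * Re w + Im z * Im w) + sqn w.
Proof. by case: z => a b; case: w => c d; rewrite /sqn; simpc => /=; ring. Qed.

(** The inequality of [stableC_compare] is quadratic in [e], hence survives at [e = 0]. There a
    single zero of [A] in the upper half plane forces [A] to vanish at every other point of it. *)
Lemma hurwitz_affine A B :
  (forall e : R, 0 < e -> A + e%:C *: B = 0 \/ stableC (A + e%:C *: B)) ->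
  A = 0 \/ stableC A.
Proof.
move=> h; have [->|A0] := eqVneq A 0; first by left.
right => z0 z0H; apply/eqP => Az0; move/eqP: A0; apply.
apply: poly_eq0_upper => z1 z1H.
have [K K0 cmp] := stableC_compare (maxn (size A) (size B)) z1 z0H.
have : 0 <= sqn A.[z0] - K * sqn A.[z1].
  pose D z := Re A.[z] * Re B.[z] + Im A.[z] * Im B.[z].
  apply: (@quadratic_limit _ (2 * D z0 - K * (2 * D z1)) (sqn B.[z0] - K * sqn B.[z1])).
  move=> e e0.
  have E z : sqn (A + e%:C *: B).[z] = sqn A.[z] + 2 * D z * e + sqn B.[z] * e ^+ 2.
    rewrite hornerD hornerZ sqnD sqnM sqn_real /D.
    by case: (A.[z]) (B.[z]) => [a b] [c d]; simpc => /=; ring.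
  have : K * sqn (A + e%:C *: B).[z1] <= sqn (A + e%:C *: B).[z0].
    case: (h e e0) => [->|hn]; first by rewrite !horner0 sqn0 mulr0.
    apply: cmp hn; apply: (leq_trans (size_polyD _ _)).
    by rewrite (leq_trans _ (leqnSn _)) // geq_max leq_max leqnn /= leq_max (size_scale_leq) orbT.
  by rewrite !E; lra.
rewrite Az0 sqn0 sub0r oppr_ge0 pmulr_rle0 // => le0.
by apply/eqP; rewrite -sqn_eq0 eq_le le0 sqn_ge0.
Qed.

End ComplexPlane.

(** * Real-rooted polynomials and Nevanlinna pairs *)

Section RealRooted.
Variable R : realType.
Local Notation C := R[i].
Local Notation Im := (@complex.Im R).
Local Notation Re := (@complex.Re R).
Local Notation toC := (map_poly (real_complex R)).
Implicit Types (z : C) (p q f g : {poly R}) (s : seq R).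

Definition XP (K : nzRingType) (s : seq K) : {poly K} := \prod_(x <- s) ('X - x%:P).

Lemma XP_cons (K : nzRingType) (x : K) (t : seq K) : XP (x :: t) = ('X - x%:P) * XP t.
Proof. by rewrite /XP big_cons. Qed.

Lemma XP_cat (K : nzRingType) (t t' : seq K) : XP (t ++ t') = XP t * XP t'.
Proof. by rewrite /XP big_cat. Qed.

Lemma XP_nil (K : nzRingType) : XP [::] = 1 :> {poly K}.
Proof. by rewrite /XP big_nil. Qed.

Lemma XP_perm s t : perm_eq s t -> XP s = XP t.
Proof. by move=> st; apply: perm_big. Qed.

Lemma size_XP (K : nzRingType) (t : seq K) : size (XP t) = (size t).+1.
Proof. exact: size_prod_XsubC. Qed.

Lemma monic_XP (K : nzRingType) (t : seq K) : XP t \is monic.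
Proof. exact: monic_prod_XsubC. Qed.

Lemma lead_coef_XP (K : nzRingType) (t : seq K) : lead_coef (XP t) = 1.
Proof. exact/monicP/monic_XP. Qed.

Lemma XP_neq0 (K : nzRingType) (t : seq K) : XP t != 0.
Proof. exact/monic_neq0/monic_XP. Qed.

Lemma toC_XP s : toC (XP s) = XP (map (real_complex R) s).
Proof. by rewrite /XP rmorph_prod big_map; apply: eq_bigr => i _; rewrite /= map_polyXsubC. Qed.

Lemma toC_horner p (x : R) : (toC p).[x%:C] = (p.[x])%:C.
Proof. exact: horner_map. Qed.

Lemma toC_conj p z : (toC p).[z^*] = ((toC p).[z])^*.
Proof.
rewrite -horner_map -map_poly_comp; congr _.[_]; apply: eq_map_poly => x /=.
by rewrite oppr0.
Qed.

Definition nz p := stableC (toC p).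

Lemma hyperbolicP p : hyperbolic p <-> nz p.
Proof.
split=> [[p0 h] z z0|h].
  apply/negP => pz; have := h z; rewrite /root pz => /(_ isT) z1.
  by rewrite z1 ltxx in z0.
split.
  apply/eqP => p0; have := h ('i)%C; rewrite p0 rmorph0 horner0 eqxx /= ltr01.
  by move/(_ isT).
move=> z /rootP rz; apply/eqP; rewrite eq_le; apply/andP; split; rewrite leNgt; apply/negP => hz.
  by have := h z hz; rewrite rz eqxx.
have z0 : 0 < Im z^* by case: (z) hz => a b /=; rewrite oppr_gt0.
by have := h _ z0; rewrite toC_conj rz conjc0 eqxx.
Qed.

Lemma rrooted_neq0 p : nz p -> p != 0.
Proof. by move/hyperbolicP => []. Qed.

Lemma mu_XP s x : \mu_x (XP s) = count_mem x s.
Proof.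
elim: s => [|y s IH]; first by rewrite XP_nil -[1]/(1%:P) mu_polyC.
rewrite XP_cons mu_mul ?IH ?mulf_neq0 ?polyXsubC_eq0 ?XP_neq0 //=; congr addn.
have [->|nxy] := eqVneq y x; first exact: mu_XsubC.
by rewrite muNroot // root_XsubC eq_sym.
Qed.

Lemma count_zeros p x : p != 0 -> count_mem x (zeros p) = \mu_x p.
Proof.
move=> p0; rewrite /zeros count_flatten -map_comp.
have rE := roots_on_rootsR p0.
have xE : (x \in rootsR p) = root p x by rewrite -rE in_itv.
transitivity (\sum_(y <- rootsR p) (y == x) * \mu_y p)%N.
  by rewrite sumnE big_map; apply: eq_bigr => y _; rewrite /= count_nseq.
have [rx|rx] := boolP (root p x).
  rewrite (bigD1_seq x) ?xE ?uniq_roots //= eqxx mul1n big1 ?addn0 // => y /negPf ->.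
  by rewrite mul0n.
rewrite muNroot // big1_seq // => y /andP[_ yp].
by have [yx|//] := eqVneq y x; rewrite -xE -yx yp in rx.
Qed.

Lemma sorted_zeros p : sorted <=%R (zeros p).
Proof.
rewrite sorted_pairwise; last exact: le_trans.
rewrite /zeros; have : sorted <%R (rootsR p) by exact: sorted_roots.
rewrite sorted_pairwise; last exact: lt_trans.
elim: (rootsR p) => //= x s IH /andP[xs /IH ps].
rewrite pairwise_cat ps andbT; apply/andP; split.
  apply/allrelP => a b /nseqP[-> _] /flattenP[_ /mapP[y ys ->] /nseqP[-> _]].
  by apply: ltW; exact: (allP xs).
by elim: (\mu_x p) => //= k ->; rewrite andbT; apply/allP => a /nseqP[-> _].
Qed.

Lemma zeros_XP c s : c != 0 -> perm_eq (zeros (c *: XP s)) s.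
Proof.
move=> c0; apply/allP => x _ /=; rewrite count_zeros ?scaler_eq0 ?negb_or ?c0 ?XP_neq0 //.
by rewrite mu_mulC // mu_XP.
Qed.

Lemma rrootedZ_XP c s : c != 0 -> nz (c *: XP s).
Proof.
move=> c0 z z0; rewrite map_polyZ hornerZ mulf_neq0 ?fmorph_eq0 // toC_XP.
rewrite -[_ == 0]/(root _ z) root_prod_XsubC; apply/negP => /mapP[x _ zx].
by rewrite zx ltxx in z0.
Qed.

Lemma rrooted_XP s : nz (XP s).
Proof. by rewrite -[XP s]scale1r; apply: rrootedZ_XP; exact: oner_neq0. Qed.

Lemma rrooted_split p : nz p -> p = lead_coef p *: XP (zeros p).
Proof.
move=> h; have /hyperbolicP [p0 hR] := h.
have [|[s [ps _ _ simp]]] := stableC_split h.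
  by move/eqP; rewrite map_poly_eq0 (negPf p0).
pose t := map Re s.
have st : s = map (real_complex R) t.
  rewrite -map_comp -[LHS]map_id; apply/eq_in_map => x xs /=.
  have := hR x; rewrite ps rootZ ?lead_coef_eq0 ?map_poly_eq0 // root_prod_XsubC xs.
  by case: (x) => a b /= ->.
have pt : p = lead_coef p *: XP t.
  apply: (@map_poly_inj _ _ (real_complex R)).
  by rewrite map_polyZ toC_XP -st -lead_coef_map.
rewrite {1}pt; congr (_ *: _); apply: XP_perm; rewrite perm_sym {1}pt.
by apply: zeros_XP; rewrite lead_coef_eq0.
Qed.

Lemma size_zeros p : nz p -> size p = (size (zeros p)).+1.
Proof.
by move=> h; rewrite {1}(rrooted_split h) size_scale ?size_XP // lead_coef_eq0 rrooted_neq0.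
Qed.

Lemma zeros_sortedE c s : c != 0 -> sorted <=%R s -> zeros (c *: XP s) = s.
Proof.
move=> c0 ss; apply: (sorted_eq le_trans le_anti) => //; first exact: sorted_zeros.
exact: zeros_XP.
Qed.

(* [Nev f g]: the quotient [f / g] maps the upper half plane to its closure. *)
Definition Nev f g := forall z, 0 < Im z -> 0 <= cross (toC f).[z] (toC g).[z].

Lemma NevN f g : Nev f g -> Nev (- g) f.
Proof. by move=> h z /h; rewrite rmorphN hornerN crossNl -crossC. Qed.

Lemma cross_limit (A B : {poly C}) : (forall e : R, 0 < e -> 0 <= cross A.[e%:C] B.[e%:C]) ->
  0 <= cross A.[0] B.[0].
Proof.
move=> h.
pose P := map_poly Im A * map_poly Re B - map_poly Re A * map_poly Im B.
have PE t : P.[t] = cross A.[t%:C] B.[t%:C] by rewrite !horner_real /cross /= !hornerE.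
have := PE 0; rewrite -[(0 : R)%:C]/(0 : C) => <-.
rewrite leNgt; apply/negP => P0.
have P0' : 0 < - P.[0] by rewrite oppr_gt0.
have [d d0 hd] := @poly_cont _ 0 P (- P.[0]) P0'.
have d2 : 0 < d / 2 by rewrite divr_gt0.
have := hd (d / 2); rewrite subr0 gtr0_norm // => /(_ ltac:(lra)) /ltr_normlP[_].
have := h (d / 2) d2; rewrite -PE; lra.
Qed.

(** For [l >= 2] the l-th roots of i sum to 0 and none of them is real, so one lies above and one
    below the real axis; the conjugate of the latter has l-th power -i. *)
Lemma exprn_Im_signs l : (2 <= l)%N -> exists z1 z2,
  [/\ 0 < Im z1, 0 < Im z2, 0 < Im (z1 ^+ l) & Im (z2 ^+ l) < 0].
Proof.
move=> l2; have l0 : (0 < l)%N by apply: leq_trans l2.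
pose p : {poly C} := 'X^l - ('i)%C%:P.
have sp : size p = l.+1 by rewrite size_XnsubC.
have [s ps] := closed_field_poly_normal p.
have lp : lead_coef p = 1 by apply/monicP/monicXnsubC.
rewrite lp scale1r in ps.
have ss : size s = l by move: sp; rewrite ps size_prod_XsubC => -[].
have s_root x : x \in s -> x ^+ l = ('i)%C.
  move=> xs; have : root p x by rewrite ps root_prod_XsubC.
  by rewrite /root /p !hornerE subr_eq0 => /eqP.
have sum0 : \sum_(x <- s) x = 0.
  have := @coefPn_prod_XsubC _ s; rewrite -ps ss => /(_ ltac:(by rewrite -lt0n)).
  rewrite /p coefB coefXn coefC.
  have [-> ->] : (l.-1 == l) = false /\ (l.-1 == 0%N) = false by lia.
  by rewrite subr0 => /eqP; rewrite eq_sym oppr_eq0 => /eqP.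
have Im0 : \sum_(x <- s) Im x = 0.
  transitivity (Im (\sum_(x <- s) x)); last by rewrite sum0.
  elim: (s) => [|[a b] t IH]; first by rewrite !big_nil.
  by rewrite !big_cons IH; case: (\sum_(x <- t) x).
have ImN x : x \in s -> Im x != 0.
  move=> /s_root; case: x => a b /= h; apply/eqP => b0.
  move: h; rewrite b0 -[Complex a 0]/(a%:C) -rmorphXn => -[_ /eqP].
  by rewrite eq_sym oner_eq0.
have s0 : s != [::] by rewrite -size_eq0 ss -lt0n.
have [x xs x0] : exists2 x, x \in s & 0 < Im x.
  apply/hasP; apply/negPn/negP => /hasPn h.
  suff : \sum_(x <- s) Im x < 0 by rewrite Im0 ltxx.
  case: (s) s0 h ImN => // x t _ h ImN; rewrite big_cons.
  have : Im x < 0 by rewrite lt_neqAle ImN ?mem_head // leNgt h ?mem_head.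
  suff : \sum_(y <- t) Im y <= 0 by lra.
  rewrite big_seq; apply: sumr_le0 => y yt.
  by rewrite leNgt h // in_cons yt orbT.
have [y ys y0] : exists2 y, y \in s & Im y < 0.
  apply/hasP; apply/negPn/negP => /hasPn h.
  suff : 0 < \sum_(x <- s) Im x by rewrite Im0 ltxx.
  case: (s) s0 h ImN => // u t _ h ImN; rewrite big_cons ltr_pwDl //.
    by rewrite lt_neqAle eq_sym ImN ?mem_head // leNgt h ?mem_head.
  rewrite big_seq; apply: sumr_ge0 => v vt.
  by rewrite leNgt h // in_cons vt orbT.
exists x, y^*; split=> //.
- by case: (y) y0 => a b /=; rewrite oppr_gt0.
- by rewrite s_root //= ltr01.
- by rewrite -rmorphXn /= s_root //= oppr_lt0 ltr01.
Qed.

(** Along the ray u + e w the quotient f / g behaves like (e w)^l f1(u) / g1(u) with l = j - k. By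
    [exprn_Im_signs], w^l stays on one side of the real axis for all w in the upper half plane only
    if l = 1, and then the sign of f1(u) g1(u) is forced. *)
Lemma Nev_order f g f1 g1 (u : R) (j k : nat) : Nev f g ->
  f = f1 * ('X - u%:P) ^+ j -> g = g1 * ('X - u%:P) ^+ k ->
  f1.[u] != 0 -> g1.[u] != 0 -> (k < j)%N -> j = k.+1 /\ 0 < f1.[u] * g1.[u].
Proof.
move=> h fE gE f1u g1u kj; pose l := (j - k)%N.
have key (w : C) : 0 < Im w -> 0 <= f1.[u] * g1.[u] * Im (w ^+ l).
  move=> w0.
  pose L : {poly C} := w *: 'X + u%:C%:P.
  pose A := (w ^+ l)%:P * (toC f1 \Po L); pose B := toC g1 \Po L.
  have : 0 <= cross A.[0] B.[0].
    apply: cross_limit => e e0.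
    have LE : L.[e%:C] = w * e%:C + u%:C by rewrite !hornerE.
    pose z := w * e%:C + u%:C.
    have z0 : 0 < Im z.
      by rewrite /z; case: (w) w0 => a b b0; simpc => /=; rewrite mulr_gt0.
    have := h z z0; rewrite fE gE !rmorphM !rmorphXn /= !map_polyXsubC !hornerM !horner_exp !hornerXsubC.
    rewrite /z addrK.
    rewrite /A /B !horner_comp LE hornerC -/z.
    have -> : (toC f1).[z] * (w * e%:C) ^+ j =
       (w * e%:C) ^+ k * ((e ^+ l)%:C * (w ^+ l * (toC f1).[z])).
      rewrite -{1}(subnK (ltnW kj)) -/l exprD rmorphXn /= exprMn_comm; last exact: mulrC.
      by ring.
    rewrite [_ * (w * e%:C) ^+ k]mulrC crossM crossZl.
    rewrite pmulr_rge0 ?pmulr_rge0 ?exprn_gt0 //.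
    rewrite sqnX exprn_gt0 // sqn_gt0 mulf_neq0 //.
      by apply/eqP => w0'; rewrite w0' ltxx in w0.
    by apply/eqP => -[e0']; rewrite e0' ltxx in e0.
  rewrite /A /B hornerM !horner_comp hornerC.
  have -> : L.[0] = u%:C by rewrite !hornerE.
  rewrite !toC_horner /cross; case: (w ^+ l) => a b /=; simpc => /=.
  suff -> : b * f1.[u] * g1.[u] = f1.[u] * g1.[u] * b by [].
  by ring.
have p0 : f1.[u] * g1.[u] != 0 by rewrite mulf_neq0.
have l1 : l = 1%N.
  have l0 : (0 < l)%N by rewrite subn_gt0.
  apply/eqP; rewrite eqn_leq l0 andbT leqNgt; apply/negP => /exprn_Im_signs [z1 [z2 [i1 i2 j1 j2]]].
  move: (key z1 i1) (key z2 i2); rewrite (pmulr_lge0 _ j1) (nmulr_lge0 _ j2) => h1 h2.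
  by move/eqP: p0; apply; apply/eqP; rewrite eq_le h1 h2.
split; first by rewrite -(subnK (ltnW kj)) -/l l1.
have := key ('i)%C; rewrite l1 expr1 /= mulr1 ltr01 => /(_ isT).
by rewrite lt_def p0.
Qed.

(** Counting the entries beyond a level turns interlacing into an inequality at every level, in
    which common and multiple zeros need no separate treatment; its parity is the sign of [XP s] at
    that level. *)
Definition count_gt s (v : R) := count (fun x => v < x) s.

Lemma sgr_XP s v : v \notin s -> Num.sg (XP s).[v] = (-1) ^+ count_gt s v.
Proof.
elim: s => [|x s IH]; first by rewrite XP_nil hornerE sgr1.
rewrite in_cons negb_or => /andP[vx vs].
rewrite XP_cons hornerM sgrM IH // hornerXsubC /= exprD; congr (_ * _).
have [h|h|h] := ltgtP v x.
- by rewrite ltr0_sg // subr_lt0.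
- by rewrite gtr0_sg // subr_gt0.
- by rewrite h eqxx in vx.
Qed.

Lemma XP_local s (u : R) : XP s = XP [seq x <- s | x != u] * ('X - u%:P) ^+ count_mem u s.
Proof.
elim: s => [|x s IH]; first by rewrite /= XP_nil mulr1.
rewrite XP_cons IH /=; have [->|xu] := eqVneq x u; last by rewrite XP_cons mulrA.
by rewrite add1n exprS mulrCA.
Qed.

Lemma count_gt_filter s (u : R) : count_gt [seq x <- s | x != u] u = count_gt s u.
Proof.
rewrite /count_gt count_filter; apply: eq_count => x /=.
by rewrite andb_idr // => /gt_eqF ->.
Qed.

Lemma count_gt_next s (u v : R) : v < u -> (forall x, x \in s -> v < x -> u <= x) ->
  count_gt s v = (count_gt s u + count_mem u s)%N.
Proof.
move=> vu h; rewrite /count_gt -count_predUI -[LHS]addn0; congr addn.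
  apply/eq_in_count => x xs /=.
  apply/idP/orP => [vx|[ux|/eqP->//]]; last exact: lt_trans ux.
  by have := h x xs vx; rewrite le_eqVlt eq_sym => /orP[->|->]; [right|left].
apply/esym/eqP; rewrite -leqn0 leqNgt -has_count; apply/negP => /hasP[x _ /= /andP[]].
by move=> /gt_eqF ->.
Qed.

(** Induction on the number of zeros beyond [v], passing to the next zero [u] on the right. Equal
    multiplicities at [u] raise both counts equally. Otherwise [Nev_order] makes the multiplicities
    differ by one, and the sign it provides is the parity of the total count beyond [u]; this parity
    tells which of the two allowed positions holds at [u]. *)
Lemma Nev_interlace (n : nat) a b (x y : seq R) v : 0 < a * b -> Nev (a *: XP x) (b *: XP y) ->
  (count_gt x v + count_gt y v <= n)%N -> (count_gt y v <= count_gt x v <= (count_gt y v).+1)%N.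
Proof.
move=> ab nev; elim: n v => [|n IH] v; first by case: (count_gt x v) (count_gt y v) => [|?] [].
move=> hn; have [|xyv] := posnP (count_gt x v + count_gt y v)%N; first by lia.
have : {u : R | [/\ v < u, u \in x ++ y & forall t, t \in x ++ y -> v < t -> u <= t]}.
  pose t := [seq u <- x ++ y | v < u].
  have : (0 < size t)%N by rewrite size_filter count_cat.
  case tE: t => [|t0 t'] // _.
  exists (foldr Num.min t0 t').
  have mint : foldr Num.min t0 t' \in t.
    rewrite tE; elim: (t') => [|c s] /=; first by rewrite mem_head.
    rewrite minEle !in_cons; case: ifP; first by rewrite eqxx orbT.
    by move=> _ /orP[->|->]; rewrite ?orbT.
  move: (mint); rewrite mem_filter => /andP[-> ->]; split=> // c cxy vc.
  have : c \in t by rewrite mem_filter vc.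
  rewrite tE; elim: (t') => [|d s IHs] /=; first by rewrite inE => /eqP->.
  rewrite !in_cons ge_min => /or3P[ct|/eqP->|cs].
  - by rewrite IHs ?orbT // in_cons ct.
  - by rewrite lexx.
  - by rewrite IHs ?orbT // in_cons cs orbT.
move=> [u [vu uxy umin]].
have xE := @count_gt_next x u v vu (fun t tx => umin t ltac:(by rewrite mem_cat tx)).
have yE := @count_gt_next y u v vu (fun t ty => umin t ltac:(by rewrite mem_cat ty orbT)).
have cpos : (0 < count_mem u x + count_mem u y)%N.
  by move: uxy; rewrite mem_cat -!has_pred1 !has_count; case: (count _ x) (count _ y) => [|?] [].
have {IH} := IH u ltac:(lia).
pose x1 := a *: XP [seq t <- x | t != u]; pose y1 := b *: XP [seq t <- y | t != u].
have xD : a *: XP x = x1 * ('X - u%:P) ^+ count_mem u x by rewrite -scalerAl -XP_local.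
have yD : b *: XP y = y1 * ('X - u%:P) ^+ count_mem u y by rewrite -scalerAl -XP_local.
have ux : u \notin [seq t <- x | t != u] by rewrite mem_filter eqxx.
have uy : u \notin [seq t <- y | t != u] by rewrite mem_filter eqxx.
have sg1 : Num.sg (x1.[u] * y1.[u]) = (-1) ^+ (count_gt x u + count_gt y u).
  rewrite !hornerZ mulrACA sgrM (gtr0_sg ab) mul1r sgrM !sgr_XP // !count_gt_filter.
  by rewrite exprD.
have p0 : x1.[u] * y1.[u] != 0.
  by rewrite -sgr_eq0 sg1 expf_neq0 // oppr_eq0 oner_eq0.
have [x0 y0] : x1.[u] != 0 /\ y1.[u] != 0.
  by move: p0; rewrite mulf_eq0 negb_or => /andP[].
have sgodd : Num.sg (x1.[u] * y1.[u]) = if odd (count_gt x u + count_gt y u) then -1 else 1.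
  by rewrite sg1 -signr_odd; case: (odd _); rewrite ?expr0 ?expr1.
rewrite xE yE; have [lt|lt|->] := ltngtP (count_mem u x) (count_mem u y); last by lia.
(* A zero of larger order in the denominator becomes one in the numerator of the Nevanlinna pair
   obtained by negating and inverting the quotient. *)
- have NyD : - (b *: XP y) = (- y1) * ('X - u%:P) ^+ count_mem u y by rewrite yD mulNr.
  have ny0 : (- y1).[u] != 0 by rewrite hornerN oppr_eq0.
  have [-> pos] := Nev_order (NevN nev) NyD xD ny0 x0 lt.
  have : odd (count_gt x u + count_gt y u).
    apply/negPn/negP => /negPf o; move: sgodd; rewrite o.
    rewrite ltr0_sg => [/eqP|]; last by rewrite -oppr_gt0 mulrC -mulNr -hornerN.
    by rewrite -subr_eq0 -opprD oppr_eq0 (pnatr_eq0 _ 2).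
  by move: lt; clear; lia.
- have [-> pos] := Nev_order nev xD yD x0 y0 lt.
  have : ~~ odd (count_gt x u + count_gt y u).
    apply/negP => o; move: sgodd; rewrite o gtr0_sg // => /eqP.
    by rewrite -subr_eq0 opprK (pnatr_eq0 _ 2).
  by move: lt; clear; lia.
Qed.

Lemma count_gt_nth s (v : R) i : sorted <=%R s -> (i < size s)%N ->
  (v < s`_i) = (size s - i <= count_gt s v)%N.
Proof.
elim: s i => [|c s IH] i //= pcs.
have cs : forall t, t \in s -> c <= t by apply/allP; apply: order_path_min le_trans pcs.
have ngts : v < c -> count_gt s v = size s.
  move=> vc; apply/eqP; rewrite -all_count; apply/allP => t /cs ct.
  exact: lt_le_trans ct.
have := count_size (fun t => v < t) s; rewrite -/(count_gt s v).
rewrite /count_gt /= -/(count_gt s v) => le_s si; have [vc|vc] := boolP (v < c).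
  have := ngts vc; rewrite /= => ->; case: i si => [|i] /= si; first by rewrite vc; lia.
  by rewrite (IH i (path_sorted pcs)) // (ngts vc); lia.
by case: i si => [|i] /= si; rewrite ?(negPf vc) ?(IH i (path_sorted pcs)) //; lia.
Qed.

Lemma count_gt_low (s s' : seq R) : exists v, count_gt s v = size s /\ count_gt s' v = size s'.
Proof.
have lo (t : seq R) : exists v, forall w, w <= v -> count_gt t w = size t.
  elim: t => [|c t [v hv]]; first by exists 0.
  exists (Num.min v (c - 1)) => w; rewrite le_min => /andP[/hv wv wc].
  rewrite /count_gt /= in wv *; rewrite wv (_ : w < c) // (le_lt_trans wc) //.
  by rewrite ltrBlDr ltrDl ltr01.
have [v hv] := lo s; have [v' hv'] := lo s'.
by exists (Num.min v v'); rewrite hv ?hv' // ge_min lexx ?orbT.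
Qed.

(** A level below all entries compares the sizes; taking the entries themselves as levels gives the
    chain of inequalities. *)
Lemma interlace_alternating (x y : seq R) : sorted <=%R x -> sorted <=%R y ->
  (forall v, count_gt y v <= count_gt x v <= (count_gt y v).+1)%N ->
  (size x = (size y).+1 /\ alternating x y) \/ (size x = size y /\ alternating y x).
Proof.
move=> sx sy h; have [v [xv yv]] := count_gt_low x y.
have := h v; rewrite xv yv => sxy.
have [xy|xy] : size x = (size y).+1 \/ size x = size y by lia.
  left; split=> //; split; first by lia.
  - move=> i iy; rewrite leNgt count_gt_nth ?xy; [|by []|by lia].
    by have := h y`_i; have := count_gt_nth y`_i sy iy; rewrite ltxx; lia.
  - move=> i ix; rewrite leNgt count_gt_nth //; last by lia.
    by have := h x`_i.+1; have := count_gt_nth x`_i.+1 sx ix; rewrite ltxx xy; lia.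
right; split=> //; split; first by lia.
- move=> i ix; rewrite leNgt count_gt_nth -?xy //.
  by have := h x`_i; have := count_gt_nth x`_i sx ix; rewrite ltxx; lia.
- move=> i iy; rewrite leNgt count_gt_nth //; last by lia.
  by have := h y`_i.+1; have := count_gt_nth y`_i.+1 sy iy; rewrite ltxx; lia.
Qed.

End RealRooted.

(** * Pencils and interlacing *)

Section Pencils.
Variable R : realType.
Local Notation C := R[i].
Local Notation Im := (@complex.Im R).
Local Notation Re := (@complex.Re R).
Local Notation toC := (map_poly (real_complex R)).
Implicit Types (z : C) (p q f g : {poly R}) (s x y : seq R).

Definition rrooted0 p := p = 0 \/ nz p.

Lemma rrootedZ c p : c != 0 -> nz p -> nz (c *: p).
Proof.
by move=> c0 h z z0; rewrite map_polyZ hornerZ mulf_neq0 ?fmorph_eq0 ?h.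
Qed.

Lemma rrootedN p : nz p -> nz (- p).
Proof. by move=> h; rewrite -scaleN1r; apply: rrootedZ h; rewrite oppr_eq0 oner_eq0. Qed.

Lemma rrooted0Z c p : rrooted0 p -> rrooted0 (c *: p).
Proof.
case=> [->|h]; first by rewrite scaler0; left.
by have [->|c0] := eqVneq c 0; [rewrite scale0r; left|right; apply: rrootedZ].
Qed.

Lemma hurwitz_real f g : (forall e : R, 0 < e -> rrooted0 (f + e *: g)) -> rrooted0 f.
Proof.
move=> h; have [|/eqP|] := @hurwitz_affine R (toC f) (toC g).
- move=> e /h [e0|e0]; [left|right]; rewrite -map_polyZ -rmorphD //=.
  by rewrite e0 rmorph0.
- by rewrite map_poly_eq0 => /eqP ->; left.
- by right.
Qed.

(** The member at infinity, [g], is the limit of [g + e *: f], a multiple of [f + e^-1 *: g]. *)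
Lemma pencil_all f g : (forall t : R, rrooted0 (f + t *: g)) ->
  forall a b : R, rrooted0 (a *: f + b *: g).
Proof.
move=> h a b; have [->|a0] := eqVneq a 0; last first.
  have -> : a *: f + b *: g = a *: (f + (b / a) *: g).
    by rewrite scalerDr scalerA [a * _]mulrC divfK.
  exact: rrooted0Z.
rewrite scale0r add0r; apply: rrooted0Z; apply: (@hurwitz_real g f) => e e0.
have -> : g + e *: f = e *: (f + e^-1 *: g).
  by rewrite scalerDr scalerA divff ?lt0r_neq0 // scale1r addrC.
exact: rrooted0Z.
Qed.

Lemma cross_eq0_dep (z w : C) : cross z w = 0 -> exists a b : R,
  (a != 0) || (b != 0) /\ a%:C * z + b%:C * w = 0.
Proof.
move=> h; have [->|w0] := eqVneq w 0.
  by exists 0, 1; rewrite oner_eq0 orbT; split=> //; rewrite mulr0 addr0 mul0r.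
exists 1, (- Re (z / w)); rewrite oner_eq0; split=> //.
have := crossVl z w0; rewrite h => /esym/eqP.
rewrite mulf_eq0 sqn_eq0 (negPf w0) /= => /eqP i0.
have : z / w = (Re (z / w))%:C by move: i0; case: (z / w) => a b /= ->.
move=> zw; rewrite mul1r rmorphN /= -zw mulNr divfK // subrr //.
Qed.

(** The upper half plane is convex, so [cross_ivt] along a segment carries positivity from any point
    to any other. *)
Lemma cross_const_sign f g : (forall z, 0 < Im z -> cross (toC f).[z] (toC g).[z] != 0) ->
  Nev f g \/ Nev f (- g).
Proof.
move=> h.
have key z1 z2 : 0 < Im z1 -> 0 < Im z2 ->
    0 < cross (toC f).[z1] (toC g).[z1] -> 0 < cross (toC f).[z2] (toC g).[z2].
  move=> h1 h2.
  pose L : {poly C} := (z2 - z1) *: 'X + z1%:P.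
  have L0 : L.[0] = z1 by rewrite !hornerE.
  have L1 : L.[1] = z2 by rewrite !hornerE subrK.
  have := @cross_ivt _ (toC f \Po L) (toC g \Po L).
  rewrite !horner_comp L0 L1; apply => t /andP[t0 t1]; rewrite !horner_comp; apply: h.
  rewrite !hornerE.
  move: h1 h2; case: (z1) (z2) => [a b] [c d] /= b0 d0; simpc => /=.
  by nra.
have [h1|h1] := ltP 0 (cross (toC f).[('i)%C] (toC g).[('i)%C]).
  by left => z z0; apply/ltW/(key ('i)%C) => //=; exact: ltr01.
right => z z0; rewrite rmorphN hornerN crossNr oppr_ge0 leNgt; apply/negP => h2.
have := key z ('i)%C z0; rewrite /= ltr01 => /(_ isT h2).
by rewrite ltNge h1.
Qed.

(** If [cross] vanishes at z, the numbers f(z) and g(z) are linearly dependent over the reals, so a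
    nonzero real-rooted member of the pencil vanishes at z. *)
Lemma pencil_sign f g : (forall a b : R, rrooted0 (a *: f + b *: g)) ->
  (forall a b : R, (a != 0) || (b != 0) -> a *: f + b *: g != 0) ->
  Nev f g \/ Nev f (- g).
Proof.
move=> hyp ind; apply: cross_const_sign => z z0; apply/eqP => /cross_eq0_dep [a [b [ab E]]].
have [/eqP|h] := hyp a b; first by rewrite (negPf (ind a b ab)).
have := h z z0; rewrite rmorphD /= !map_polyZ !hornerD !hornerZ; by rewrite E eqxx.
Qed.

Lemma rrooted_interlace f g : nz f -> nz g -> Nev f g ->
  (0 < lead_coef f * lead_coef g /\
   forall v, (count_gt (zeros g) v <= count_gt (zeros f) v <= (count_gt (zeros g) v).+1)%N) \/
  (lead_coef f * lead_coef g < 0 /\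
   forall v, (count_gt (zeros f) v <= count_gt (zeros g) v <= (count_gt (zeros f) v).+1)%N).
Proof.
move=> hf hg h.
have : lead_coef f * lead_coef g != 0.
  by rewrite mulf_neq0 // lead_coef_eq0 rrooted_neq0.
rewrite neq_lt => /orP[l0|l0]; [right|left]; split=> // v.
  apply: (@Nev_interlace _ _ (- lead_coef g) (lead_coef f)); last exact: leqnn.
    by rewrite mulNr oppr_gt0 mulrC.
  by rewrite scaleNr -!rrooted_split //; exact: NevN.
apply: (@Nev_interlace _ _ (lead_coef f) (lead_coef g)); last exact: leqnn.
  by [].
by rewrite -!rrooted_split.
Qed.

Lemma zerosN p : nz p -> zeros (- p) = zeros p.
Proof.
move=> h; rewrite {1}(rrooted_split h) -scaleNr zeros_sortedE ?sorted_zeros //.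
by rewrite oppr_eq0 lead_coef_eq0 rrooted_neq0.
Qed.

Lemma Nev_interlacing f g : nz f -> nz g -> Nev f g \/ Nev f (- g) -> interlacing f g.
Proof.
move=> hf hg; wlog nev : g hg / Nev f g.
  move=> W [h|h]; first by apply: W => //; left.
  have := W (- g) (rrootedN hg) h (or_introl h); by rewrite /interlacing zerosN.
move=> _; have [[_ h]|[_ h]] := rrooted_interlace hf hg nev.
  have [[_ a]|[_ a]] := interlace_alternating (sorted_zeros f) (sorted_zeros g) h.
    by left.
  by right.
have [[_ a]|[_ a]] := interlace_alternating (sorted_zeros g) (sorted_zeros f) h.
  by right.
by left.
Qed.

Lemma interlacing_size f g : nz f -> nz g -> interlacing f g -> (size f <= (size g).+1)%N.
Proof.
by move=> hf hg [[h _ _]|[h _ _]]; rewrite !size_zeros //; lia.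
Qed.

Lemma pencil_size f g : (forall t : R, rrooted0 (f + t *: g)) -> g != 0 ->
  (size f <= (size g).+1)%N.
Proof.
move=> h g0; have hyp := pencil_all h.
have [->|f0] := eqVneq f 0; first by rewrite size_poly0.
have [[[a b] /= ab]|ind] := boolp.pselect (exists2 ab : R * R,
    (ab.1 != 0) || (ab.2 != 0) & ab.1 *: f + ab.2 *: g = 0).
  move=> E; have a0 : a != 0.
    apply/eqP => a0; move/eqP: E; rewrite a0 scale0r add0r scaler_eq0 (negPf g0) orbF.
    by move: ab; rewrite a0 eqxx /= => /negPf ->.
  have -> : f = - (b / a) *: g.
    apply: (scalerI a0); rewrite scalerA mulrN [a * _]mulrC divfK // scaleNr.
    by apply/eqP; rewrite -addr_eq0 E.
  by apply: leq_trans (size_scale_leq _ _) _.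
have hf : nz f by have := hyp 1 0; rewrite scale1r scale0r addr0 => -[/eqP|//]; rewrite (negPf f0).
have hg : nz g by have := hyp 0 1; rewrite scale1r scale0r add0r => -[/eqP|//]; rewrite (negPf g0).
apply: interlacing_size => //; apply: Nev_interlacing => //; apply: pencil_sign => // a b ab.
by apply/eqP => E; apply: ind; exists (a, b).
Qed.

Lemma XP_rem s v : v \in s -> XP s = ('X - v%:P) * XP (rem v s).
Proof. by move=> vs; rewrite -XP_cons; apply: XP_perm; exact: perm_to_rem. Qed.

Lemma XP_rem_perm s s' v : v \in s -> perm_eq s s' -> XP (rem v s) = XP (rem v s').
Proof.
move=> vs ss'; have vs' : v \in s' by rewrite -(perm_mem ss').
apply: (@mulfI _ ('X - v%:P)); first by rewrite polyXsubC_eq0.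
by rewrite -!XP_rem //; exact: XP_perm.
Qed.

Lemma XP_rem_cons s a v : v \in s -> XP (rem v (a :: s)) = ('X - a%:P) * XP (rem v s).
Proof.
move=> vs; apply: (@mulfI _ ('X - v%:P)); first by rewrite polyXsubC_eq0.
by rewrite -XP_rem ?in_cons ?vs ?orbT // mulrCA -XP_rem // XP_cons.
Qed.

(* Moving one zero at a time to the endpoints of its interval, where a factor
   cancels, exhibits [XP y] as a positive combination. *)
Lemma alternating_cone x y : alternating x y -> size x = (size y).+1 ->
  exists2 ts : seq (R * R), (forall t, t \in ts -> 0 <= t.1 /\ t.2 \in x) &
    XP y = \sum_(t <- ts) t.1 *: XP (rem t.2 x).
Proof.
elim: y x => [|y0 y IH] x [sz le1 le2] sx.
  case: x sx {sz le1 le2} => [|x0 []] // _; exists [:: (1, x0)].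
    by move=> t; rewrite inE => /eqP -> /=; rewrite ler01 mem_head.
  by rewrite big_seq1 /= eqxx scale1r.
case: x sx sz le1 le2 => [|x0 [|x1 x]] // [] sx sz le1 le2.
have xy0 : x0 <= y0 by have := le1 0%N isT.
have yx1 : y0 <= x1 by have := le2 0%N isT.
have [||ts1 pos1 E1] := IH (x1 :: x).
  split=> [|i iy|i ix]; first by move: sz => /=; rewrite !ltnS.
  - exact: (le1 i.+1).
  - exact: (le2 i.+1).
  - by rewrite /= sx.
have [||ts0 pos0 E0] := IH (x0 :: x).
  split=> [|i iy|i ix]; first by move: sz => /=; rewrite !ltnS.
  - case: i iy => [|i] iy; last exact: (le1 i.+2).
    apply: (le_trans xy0); apply: (le_trans yx1); exact: (le1 1%N).
  - exact: (le2 i.+1).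
  - by rewrite /= sx.
(* With y0 = th x0 + (1 - th) x1, the polynomial [XP (y0 :: y)] is the same convex combination of
   [XP (x0 :: y)] and [XP (x1 :: y)]. The first shares the factor of [x0] with [XP] of the full list
   and the second that of [x1]; the two induction hypotheses apply to what remains. *)
have [th /andP[th0 th1] thE] : exists2 th, 0 <= th <= 1 & y0 = th * x0 + (1 - th) * x1.
  have [e|ne] := eqVneq x0 x1.
    exists 0; first by rewrite lexx ler01.
    by rewrite mul0r add0r subr0 mul1r; lra.
  have lt01 : 0 < x1 - x0 by rewrite subr_gt0 lt_neqAle ne (le_trans xy0).
  exists ((x1 - y0) / (x1 - x0)).
    by rewrite divr_ge0 ?ler_pdivrMr ?mul1r ?(ltW lt01) //; lra.
  by field; rewrite lt0r_neq0.
exists ([seq (th * t.1, t.2) | t <- ts1] ++ [seq ((1 - th) * t.1, t.2) | t <- ts0]).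
  move=> t; rewrite mem_cat => /orP[] /mapP[[c v] tin ->] /=.
    by have [/= c0 vx] := pos1 _ tin; rewrite mulr_ge0 // in_cons vx orbT.
  have [/= c0 vx] := pos0 _ tin; rewrite mulr_ge0 ?subr_ge0 // !in_cons.
  by move: vx; rewrite in_cons => /orP[] ->; rewrite ?orbT.
rewrite big_cat !big_map /= XP_cons.
have -> : 'X - y0%:P = th *: ('X - x0%:P) + (1 - th) *: ('X - x1%:P).
  by rewrite thE -!mul_polyC !(polyCD, polyCM, polyCN, polyCB) polyC1; ring.
rewrite mulrDl -!scalerAl {1}E1 E0 !big_distrr !scaler_sumr /=; congr (_ + _).
  rewrite !big_seq; apply: eq_bigr => -[c v] /pos1 [/= _ vx].
  by have /= -> := @XP_rem_cons (x1 :: x) x0 v vx; rewrite -scalerAr scalerA.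
rewrite !big_seq; apply: eq_bigr => -[c v] /pos0 [/= _ vx].
rewrite -scalerAr scalerA; have /= <- := @XP_rem_cons (x0 :: x) x1 v vx; congr (_ *: _).
apply: (@XP_rem_perm (x1 :: x0 :: x) (x0 :: x1 :: x)); first by rewrite in_cons vx orbT.
by rewrite -[x1 :: x0 :: x]/([:: x1] ++ [:: x0] ++ x) perm_catCA.
Qed.

Lemma cross_rem x v z : v \in x ->
  cross (toC (XP x)).[z] (toC (XP (rem v x))).[z] = Im z * sqn (toC (XP (rem v x))).[z].
Proof.
move=> vx; rewrite (XP_rem vx) rmorphM /= map_polyXsubC hornerM hornerXsubC cross_mull.
by case: z => a b /=; rewrite subr0.
Qed.

Lemma toC_sum (I : Type) (r : seq I) (F : I -> {poly R}) z :
  (toC (\sum_(i <- r) F i)).[z] = \sum_(i <- r) (toC (F i)).[z].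
Proof. by rewrite rmorph_sum horner_sum. Qed.

Lemma cross_sumr (I : Type) (r : seq I) (F : I -> C) (u : C) :
  cross u (\sum_(i <- r) F i) = \sum_(i <- r) cross u (F i).
Proof. by elim/big_rec2: _ => [|i a b _ <-]; rewrite ?cross0r ?crossDr. Qed.

Lemma weighted_sum_eq0 (ts : seq (R * R)) (F : R * R -> R) (d : R * R -> R) :
  (forall t, t \in ts -> 0 <= F t) -> (forall t, t \in ts -> 0 < d t) ->
  \sum_(t <- ts) F t * d t = 0 -> forall t, t \in ts -> F t = 0.
Proof.
move=> F0 d0 /eqP; rewrite big_seq psumr_eq0 => [/allP h t tin|t tin].
  have := h t tin; rewrite tin /= mulf_eq0 => /orP[/eqP//|/eqP dt].
  by have := d0 t tin; rewrite dt ltxx.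
by rewrite mulr_ge0 ?F0 // ltW ?d0.
Qed.

(** With one more entry in [x], every term of the cone decomposition contributes a nonnegative
    multiple of a positive number to [cross]. For equal sizes the largest entry yl of [y] is split
    off first: writing X - yl = (X - v) - (yl - v) for each v in [x] turns the decomposition into a
    multiple of [XP x] minus a combination with weights at least 0. If all these weights vanish, the
    two polynomials agree. *)
Lemma alternating_cross x y : sorted <=%R x -> alternating x y ->
  XP x = XP y \/ forall z, 0 < Im z -> cross (toC (XP x)).[z] (toC (XP y)).[z] != 0.
Proof.
move=> srt alt; have [sz le1 le2] := alt.
have npos s z : 0 < Im z -> 0 < Im z * sqn (toC (XP s)).[z].
  by move=> z0; rewrite mulr_gt0 // sqn_gt0; exact: rrooted_XP.
have [sx|sx] : size x = (size y).+1 \/ size x = size y by lia.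
  right => z z0; have [ts pos E] := alternating_cone alt sx.
  apply/eqP => c0; have /eqP[] := XP_neq0 y; rewrite E big_seq big1 // => t tin.
  have -> : t.1 = 0; last by rewrite scale0r.
  apply: (@weighted_sum_eq0 ts fst (fun t => Im z * sqn (toC (XP (rem t.2 x))).[z])) tin.
  - by move=> u /pos[].
  - by move=> u _; exact: npos.
  rewrite -[RHS]c0 E toC_sum cross_sumr big_seq [RHS]big_seq; apply: eq_bigr => u /pos[_ ux].
  by rewrite map_polyZ hornerZ crossZr cross_rem.
case/lastP: y => [|y yl] in sz le1 le2 sx alt *.
  by left; case: x sx {sz le1 le2 alt srt}.
rewrite size_rcons in sx sz le1.
have alt' : alternating x y.
  split; first by lia.
  - by move=> i iy; have := le1 i ltac:(lia); rewrite nth_rcons iy.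
  - by move=> i ix; have := le2 i ix; rewrite nth_rcons (_ : i < size y)%N //; lia.
have xyl v : v \in x -> v <= yl.
  move=> /(nthP 0)[i ix <-]; have := le1 (size y) (leqnn _).
  rewrite nth_rcons ltnn eqxx; apply: le_trans.
  have h := @sorted_leq_nth R <=%R le_trans lexx 0 x srt.
  by apply: (h i (size y)); rewrite ?inE ?sx // -ltnS -sx.
have [ts pos E] := alternating_cone alt' sx.
have EN : XP (rcons y yl) = \sum_(t <- ts) t.1 *: XP x -
    \sum_(t <- ts) (t.1 * (yl - t.2)) *: XP (rem t.2 x).
  rewrite -cats1 XP_cat XP_cons XP_nil mulr1 E big_distrl /= -sumrB !big_seq.
  apply: eq_bigr => t /pos[_ tx].
  rewrite (XP_rem tx) -!mul_polyC !polyCM !polyCD !polyCN; ring.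
have [allz|nall] := boolP (all (fun t => t.1 * (yl - t.2) == 0) ts).
  left; have S0 : \sum_(t <- ts) (t.1 * (yl - t.2)) *: XP (rem t.2 x) = 0.
    by rewrite big_seq big1 // => t tin; rewrite (eqP (allP allz t tin)) scale0r.
  rewrite S0 subr0 -scaler_suml in EN.
  have := congr1 lead_coef EN; rewrite lead_coefZ !lead_coef_XP mulr1 => c1.
  by rewrite EN -c1 scale1r.
right => z z0; apply/eqP => c0; move/negP: nall; apply; apply/allP => t tin; apply/eqP.
apply: (@weighted_sum_eq0 ts (fun t => t.1 * (yl - t.2))
  (fun t => Im z * sqn (toC (XP (rem t.2 x))).[z])) tin.
- by move=> u /pos[u0 ux]; rewrite mulr_ge0 // subr_ge0 xyl.
- by move=> u _; exact: npos.
apply: oppr_inj; rewrite oppr0 -[RHS]c0 EN rmorphB hornerD hornerN !toC_sum crossDr crossNr !cross_sumr.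
rewrite [X in _ = X - _]big1 ?add0r => [|u _]; last by rewrite /= map_polyZ hornerZ crossZr crosszz mulr0.
congr (- _); rewrite big_seq [RHS]big_seq; apply: eq_bigr => u /pos[_ ux].
by rewrite /= map_polyZ hornerZ crossZr cross_rem.
Qed.

(** At a zero of a f + b g in the upper half plane, taking [cross] with g leaves a times [cross] of
    f and g, which is nonzero by [alternating_cross]. *)
Lemma interlacing_pencil f g (a b : R) : nz f -> nz g -> interlacing f g ->
  ~ (exists c : R, g = c *: f) -> a != 0 -> nz (a *: f + b *: g).
Proof.
move=> hf hg il indep a0.
have lf : lead_coef f != 0 by rewrite lead_coef_eq0 rrooted_neq0.
have lg : lead_coef g != 0 by rewrite lead_coef_eq0 rrooted_neq0.
have ne : XP (zeros f) <> XP (zeros g).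
  move=> e; apply: indep; exists (lead_coef g / lead_coef f).
  have gE : g = lead_coef g *: XP (zeros f) by rewrite e -rrooted_split.
  by rewrite {1}gE [X in _ = _ *: X](rrooted_split hf) scalerA divfK.
have h z : 0 < Im z -> cross (toC f).[z] (toC g).[z] != 0.
  move=> z0; rewrite (rrooted_split hf) (rrooted_split hg) !map_polyZ !hornerZ crossZl crossZr.
  rewrite !mulf_neq0 //.
  case: il => alt.
    by have [//|] := alternating_cross (sorted_zeros f) alt; apply.
  have [/esym//|k] := alternating_cross (sorted_zeros g) alt.
  by rewrite crossC oppr_eq0; exact: k.
move=> z z0; apply/eqP; rewrite rmorphD /= !map_polyZ hornerD !hornerZ => E.
have := h z z0; apply/negP/negPn.
have : cross (a%:C * (toC f).[z] + b%:C * (toC g).[z]) (toC g).[z] == 0 by rewrite E cross0l.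
by rewrite crossDl !crossZl crosszz mulr0 addr0 mulf_eq0 (negPf a0).
Qed.

End Pencils.

(** * Majorization along pencils *)

Section Majorization.
Variable R : realType.
Local Notation C := R[i].
Local Notation Im := (@complex.Im R).
Local Notation toC := (map_poly (real_complex R)).
Implicit Types (z : C) (f g h : {poly R}) (X Y V : seq R).

Lemma majorized_refl (s : seq R) : majorized s s.
Proof. by split. Qed.

Lemma majorized_trans (y x s : seq R) : majorized x y -> majorized y s -> majorized x s.
Proof.
move=> [sxy exy xy] [sys eys ys]; split; rewrite ?sxy ?exy //.
move=> k kx; have k' : (k.+2 <= size x)%N by rewrite sxy.
have := xy k k'; rewrite sxy => h; exact: le_trans h (ys k kx).
Qed.

(** Moves a level off finitely many zeros, to the right, without changing any count beyond it. *)
Lemma generic_point (s : seq R) (v : R) : exists2 v', v < v' & forall x, x \in s -> v < x -> v' < x.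
Proof.
elim: s => [|c s [v' vv' h]]; first by exists (v + 1); rewrite ?ltrDl.
have [vc|cv] := ltP v c.
  exists (Num.min v' ((v + c) / 2)); first by rewrite lt_min vv'; lra.
  move=> x; rewrite in_cons gt_min => /orP[/eqP->|xs] vx; last by rewrite h.
  by apply/orP; right; lra.
exists v' => // x; rewrite in_cons => /orP[/eqP->|]; last exact: h.
by rewrite ltNge cv.
Qed.

(** At a generic level the counts of X and Y both lie between that of V and its successor. If they
    differ, [XP X] and [XP Y] have opposite signs there, so the sign of their difference is known.
    It is also that of [XP (rem nu V)] up to a constant, hence that of [XP V] times the sign of v -
    nu. So the side of nu decides which count is larger. *)
Lemma move_crossing (a b d nu : R) X Y V : 0 < a * b -> 0 <= d -> nu \in V ->
  Nev (a *: XP X) (b *: XP V) -> Nev (a *: XP Y) (b *: XP V) ->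
  a *: XP Y = a *: XP X - (d * b) *: XP (rem nu V) ->
  (forall v, v < nu -> (count_gt Y v <= count_gt X v)%N) /\
  (forall v, nu <= v -> (count_gt X v <= count_gt Y v)%N).
Proof.
move=> ab d0 nuV nX nY E.
have key v : exists v', [/\ v < v', v < nu -> v' < nu,
    count_gt X v = count_gt X v', count_gt Y v = count_gt Y v' & v' \notin X ++ Y ++ V].
  have [v' vv' h] := generic_point (X ++ Y ++ V) v.
  have hh (s : seq R) : {subset s <= X ++ Y ++ V} -> count_gt s v = count_gt s v'.
    move=> sub; apply/eq_in_count => t /sub ts; apply/idP/idP; first exact: h.
    exact: lt_trans.
  exists v'; split=> //.
  - by apply: h; rewrite !mem_cat nuV !orbT.
  - by apply: hh => t tX; rewrite mem_cat tX.
  - by apply: hh => t tX; rewrite !mem_cat tX orbT.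
  - by apply/negP => /h /(_ vv'); rewrite ltxx.
have sg v : v \notin X ++ Y ++ V ->
    [/\ Num.sg (XP X).[v] = (-1) ^+ count_gt X v, Num.sg (XP Y).[v] = (-1) ^+ count_gt Y v,
      Num.sg (XP V).[v] = (-1) ^+ count_gt V v & (XP V).[v] = (v - nu) * (XP (rem nu V)).[v]].
  rewrite !mem_cat !negb_or => /and3P[vX vY vV]; rewrite !sgr_XP //; split=> //.
  by rewrite (XP_rem nuV) hornerM hornerXsubC.
have iX v := Nev_interlace ab nX (leqnn (count_gt X v + count_gt V v)).
have iY v := Nev_interlace ab nY (leqnn (count_gt Y v + count_gt V v)).
have E2 v : (a * b) * (d * (XP (rem nu V)).[v]) = a ^+ 2 * ((XP X).[v] - (XP Y).[v]).
  have h : a * (XP Y).[v] = a * (XP X).[v] - d * b * (XP (rem nu V)).[v].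
    by have := congr1 (fun p : {poly R} => p.[v]) E; rewrite !hornerE.
  have h2 : d * b * (XP (rem nu V)).[v] = a * (XP X).[v] - a * (XP Y).[v] by rewrite h; ring.
  move: h2; move: (XP X).[v] (XP Y).[v] (XP (rem nu V)).[v] => p q r h2.
  have -> : a * b * (d * r) = a * (d * b * r) by ring.
  by rewrite h2; ring.
have sq : 0 < a ^+ 2.
  by rewrite lt_def sqr_ge0 andbT sqrf_eq0; apply/eqP => a0; rewrite a0 mul0r ltxx in ab.
have exp_sg n : ((-1) ^+ n = 1 :> R) \/ ((-1) ^+ n = -1 :> R).
  by rewrite -signr_odd; case: (odd n); [right|left].
split=> v vnu; rewrite leqNgt; apply/negP; have [v' [vv' hnu -> ->]] := key v;
    move=> /sg [sX sY sV rV] lt; have := iX v'; have := iY v'; move=> iy ix;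
    have := E2 v'.
  have [eX eY] : count_gt X v' = count_gt V v' /\ count_gt Y v' = (count_gt V v').+1 by lia.
  rewrite eX in sX; rewrite eY exprS mulN1r -sX in sY; rewrite -sX in sV.
  have v'nu := hnu vnu.
  case: (exp_sg (count_gt V v')) sX => -> sX; rewrite sX in sY sV.
    move/eqP: sX; rewrite sgr_cp0 => sX; move/eqP: sY; rewrite sgr_cp0 => sY.
    move/eqP: sV; rewrite sgr_cp0 rV nmulr_rgt0 ?subr_lt0 // => sV.
    have : 0 < a ^+ 2 * ((XP X).[v'] - (XP Y).[v']) by rewrite mulr_gt0 //; lra.
    move=> pos E'; rewrite -E' in pos; move: pos; rewrite pmulr_rgt0 //.
    by rewrite ltNge mulr_ge0_le0 // ltW.
  move/eqP: sX; rewrite sgr_cp0 => sX; move/eqP: sY; rewrite opprK sgr_cp0 => sY.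
  move/eqP: sV; rewrite sgr_cp0 rV nmulr_rlt0 ?subr_lt0 // => sV.
  have : 0 < a ^+ 2 * ((XP Y).[v'] - (XP X).[v']) by rewrite mulr_gt0 //; lra.
  have : 0 <= a * b * (d * (XP (rem nu V)).[v'])
    by apply: mulr_ge0; [exact: ltW|apply: mulr_ge0 => //; exact: ltW].
  nra.
have [eX eY] : count_gt X v' = (count_gt V v').+1 /\ count_gt Y v' = count_gt V v' by lia.
rewrite eY in sY; rewrite eX exprS mulN1r -sY in sX; rewrite -sY in sV.
have v'nu : nu < v' by apply: le_lt_trans vv'.
case: (exp_sg (count_gt V v')) sY => -> sY; rewrite sY in sX sV.
  move/eqP: sX; rewrite sgr_cp0 => sX; move/eqP: sY; rewrite sgr_cp0 => sY.
  move/eqP: sV; rewrite sgr_cp0 rV pmulr_rgt0 ?subr_gt0 // => sV.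
  have : 0 < a ^+ 2 * ((XP Y).[v'] - (XP X).[v']) by rewrite mulr_gt0 //; lra.
  have : 0 <= a * b * (d * (XP (rem nu V)).[v'])
    by apply: mulr_ge0; [exact: ltW|apply: mulr_ge0 => //; exact: ltW].
  nra.
move/eqP: sX; rewrite opprK sgr_cp0 => sX; move/eqP: sY; rewrite sgr_cp0 => sY.
move/eqP: sV; rewrite sgr_cp0 rV pmulr_rlt0 ?subr_gt0 // => sV.
have : 0 < a ^+ 2 * ((XP X).[v'] - (XP Y).[v']) by rewrite mulr_gt0 //; lra.
move=> pos E'; rewrite -E' in pos; move: pos; rewrite pmulr_rgt0 //.
by rewrite ltNge mulr_ge0_le0 // ltW.
Qed.

(** If some D i below the summed range is positive, every term of the range is nonnegative;
    otherwise the complementary sum is nonpositive, and the total is 0. *)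
Lemma single_crossing (D : nat -> R) m : \sum_(i < m) D i = 0 ->
  (forall i j, (i < j < m)%N -> 0 < D i -> 0 <= D j) ->
  forall k, (k <= m)%N -> 0 <= \sum_(i < k) D (m - i.+1)%N.
Proof.
move=> sum0 cross k km.
have -> : \sum_(i < k) D (m - i.+1)%N = \sum_(m - k <= j < m) D j.
  rewrite -{1}[(m - k)%N]add0n big_addn (subKn km).
  rewrite -(big_mkord xpredT (fun i => D (m - i.+1)%N)) big_nat_rev /=.
  by apply: eq_big_nat => i ik; congr D; lia.
have tot : \sum_(0 <= j < m - k) D j + \sum_(m - k <= j < m) D j = 0.
  by rewrite -big_cat_nat ?leq_subr //= big_mkord.
have [/hasP [i ik Di]|none] := boolP (has (fun i => 0 < D i) (iota 0 (m - k))).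
  rewrite mem_iota add0n in ik.
  rewrite big_nat; apply: sumr_ge0 => j jk; apply: cross Di; lia.
have : \sum_(0 <= j < m - k) D j <= 0.
  rewrite big_nat; apply: sumr_le0 => j jk; rewrite leNgt; apply/negP => Dj.
  move/hasP: none; apply; exists j => //; rewrite mem_iota; lia.
lra.
Qed.

(** Counts that cross once at nu make Y_i - X_i nonpositive where X_i < nu and nonnegative where X_i
    > nu, which is the single sign change of [single_crossing]. *)
Lemma crossing_majorized (nu : R) X Y : sorted <=%R X -> sorted <=%R Y ->
  size X = size Y -> \sum_(a <- X) a = \sum_(a <- Y) a ->
  (forall v, v < nu -> (count_gt Y v <= count_gt X v)%N) ->
  (forall v, nu <= v -> (count_gt X v <= count_gt Y v)%N) -> majorized X Y.
Proof.
move=> sX sY sXY eXY lo hi; split=> // k kX.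
rewrite -sXY -subr_ge0 -sumrB.
have nth_le (s : seq R) (i j : nat) : sorted <=%R s -> (i <= j < size s)%N -> s`_i <= s`_j.
  move=> ss ij; have h := @sorted_leq_nth R <=%R le_trans lexx 0 s ss.
  by apply: (h i j); rewrite ?inE; lia.
have below i : (i < size X)%N -> X`_i < nu -> Y`_i <= X`_i.
  move=> iX Xnu; rewrite leNgt count_gt_nth -?sXY //.
  by have := lo _ Xnu; have := count_gt_nth X`_i sX iX; rewrite ltxx; lia.
have above i : (i < size X)%N -> nu < X`_i -> X`_i <= Y`_i.
  move=> iX Xnu; rewrite leNgt; apply/negP => lt.
  pose w := Num.max nu Y`_i.
  have : (count_gt X w <= count_gt Y w)%N by rewrite hi // le_max lexx.
  have := @count_gt_nth _ X w i sX iX; rewrite gt_max Xnu lt.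
  have := @count_gt_nth _ Y w i sY; rewrite -sXY => /(_ iX).
  rewrite gt_max ltxx andbF; lia.
apply: (@single_crossing (fun j => Y`_j - X`_j) (size X)); last by lia.
  have S (s : seq R) : \sum_(i < size s) s`_i = \sum_(a <- s) a.
    by rewrite (big_nth 0) big_mkord.
  by rewrite sumrB S sXY S eXY subrr.
move=> i j /andP[ij jX]; rewrite subr_gt0 subr_ge0 => lt.
have iX : (i < size X)%N by lia.
have nuXi : nu <= X`_i by rewrite leNgt; apply/negP => /(below i iX); rewrite leNgt lt.
have Xij : X`_i <= X`_j by apply: nth_le => //; lia.
have Yij : Y`_i <= Y`_j by apply: nth_le; rewrite // -sXY; lia.
(* In the remaining case X_i = X_j = nu, and Y_j >= Y_i > X_i. *)
have [/(above j jX) //|jnu] := ltP nu X`_j.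
lra.
Qed.

Lemma sum_zeros_eq (a : R) X Y g : a != 0 -> size X = size Y -> (size g < size X)%N ->
  a *: XP Y = a *: XP X + g -> \sum_(c <- X) c = \sum_(c <- Y) c.
Proof.
move=> a0 sXY sg E; apply: oppr_inj.
have X0 : size X != 0%N by lia.
have Y0 : size Y != 0%N by lia.
rewrite -(coefPn_prod_XsubC X0) -(coefPn_prod_XsubC Y0) -sXY.
apply: (mulfI a0); have := congr1 (fun p : {poly R} => p`_(size X).-1) E.
have gX : g`_(size X).-1 = 0 by rewrite nth_default // -ltnS prednK // lt0n.
by rewrite coefD !coefZ gX addr0 => ->.
Qed.

Lemma poly_majorized_intro f g : nz f -> nz g -> size f = size g -> lead_coef f = lead_coef g ->
  majorized (zeros f) (zeros g) -> poly_majorized f g.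
Proof.
move=> hf hg sfg lfg mj; exists (size f).-1; split=> //; split.
- exact/hyperbolicP.
- by rewrite prednK // size_poly_gt0 rrooted_neq0.
- exact/hyperbolicP.
- by rewrite prednK // ?size_poly_gt0 ?rrooted_neq0.
Qed.

Lemma poly_majorized_refl f : nz f -> poly_majorized f f.
Proof. by move=> h; apply: poly_majorized_intro => //; exact: majorized_refl. Qed.

Lemma poly_majorized_trans g f h : poly_majorized f g -> poly_majorized g h -> poly_majorized f h.
Proof.
move=> [m [hf [hg sg] lfg mfg]] [m' [[_ sg'] hh lgh mgh]].
have mm' : m' = m by rewrite sg in sg'; case: sg'.
exists m; split; rewrite ?lfg // -?mm' //; exact: majorized_trans mfg mgh.
Qed.

(** The subtracted term is g / (z - nu) up to a factor [d >= 0], so it only increases [cross] with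
    g, and f1 still forms a Nevanlinna pair with g. Its degree is deg f - 2, so the leading
    coefficient and the sum of the zeros are kept; [move_crossing] gives the rest. *)
Lemma rem_zero_majorized (d nu : R) f g : 0 <= d -> nu \in zeros g -> nz f -> nz g -> Nev f g ->
  0 < lead_coef f * lead_coef g -> size f = (size g).+1 ->
  let f1 := f - (d * lead_coef g) *: XP (rem nu (zeros g)) in
  [/\ Nev f1 g, size f1 = size f, lead_coef f1 = lead_coef f & poly_majorized f f1].
Proof.
move=> d0 nug hf hg nev lfg sfg f1.
have sr : size ((d * lead_coef g) *: XP (rem nu (zeros g))) = if d == 0 then 0%N else (size g).-1.
  have [->|dn0] := eqVneq d 0; first by rewrite mul0r scale0r size_poly0.
  rewrite size_scale ?mulf_neq0 ?lead_coef_eq0 ?rrooted_neq0 // size_XP size_rem //.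
  by rewrite (size_zeros hg) /=; case: (zeros g) nug.
have g0 : (0 < size g)%N by rewrite size_poly_gt0 rrooted_neq0.
have lt : (size (- ((d * lead_coef g) *: XP (rem nu (zeros g))))%R < size f)%N.
  by rewrite size_polyN sr sfg; case: ifP => _; lia.
have sf1 : size f1 = size f by rewrite /f1 size_polyDl.
have lf1 : lead_coef f1 = lead_coef f by rewrite /f1 lead_coefDl.
have crsE z : cross (toC f1).[z] (toC g).[z] = cross (toC f).[z] (toC g).[z] +
    d * lead_coef g ^+ 2 * (Im z * sqn (toC (XP (rem nu (zeros g)))).[z]).
  rewrite /f1 rmorphB /= hornerD hornerN crossDl crossNl map_polyZ hornerZ crossZl.
  have gE : (toC g).[z] = (lead_coef g)%:C * (toC (XP (zeros g))).[z].
    by rewrite {1}(rrooted_split hg) map_polyZ hornerZ.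
  by rewrite [X in cross _ X - _]gE gE [X in _ - X = _](_ : _ = - (d * lead_coef g ^+ 2 * (Im z * sqn (toC (XP (rem nu (zeros g)))).[z])))
    ?opprK // crossZr crossC cross_rem //; ring.
have nev1 : Nev f1 g.
  move=> z z0; rewrite crsE addr_ge0 ?nev // mulr_ge0 //.
    by rewrite mulr_ge0 // sqr_ge0.
  by rewrite mulr_ge0 ?sqn_ge0 // ltW.
have hf1 : nz f1.
  have [d00|dn0] := eqVneq d 0; first by rewrite /f1 d00 mul0r scale0r subr0.
  move=> z z0; apply/eqP => f1z; have := crsE z; rewrite f1z cross0l; apply/eqP.
  rewrite lt_eqF // ltr_pwDr ?nev // mulr_gt0 //.
    by rewrite mulr_gt0 ?lt_def ?dn0 // sqrf_eq0 lead_coef_eq0 rrooted_neq0 // sqr_ge0.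
  by rewrite mulr_gt0 // sqn_gt0; exact: rrooted_XP.
split=> //; apply: poly_majorized_intro => //.
have fE : f = lead_coef f *: XP (zeros f) by exact: rrooted_split.
have gE : g = lead_coef g *: XP (zeros g) by exact: rrooted_split.
have f1E : f1 = lead_coef f *: XP (zeros f1) by rewrite -lf1; exact: rrooted_split.
have [||||||lo hi] := @move_crossing (lead_coef f) (lead_coef g) d nu (zeros f) (zeros f1) (zeros g).
- by [].
- by [].
- by [].
- by rewrite -fE -gE.
- by rewrite -f1E -gE.
- by rewrite -f1E -fE.
have szz : size (zeros f) = size (zeros f1).
  by apply: succn_inj; rewrite -!size_zeros // sf1.
apply: (crossing_majorized (sorted_zeros f) (sorted_zeros f1) szz _ lo hi).
apply: (@sum_zeros_eq (lead_coef f) _ _ (- ((d * lead_coef g) *: XP (rem nu (zeros g))))) => //.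
- by rewrite lead_coef_eq0 rrooted_neq0.
- rewrite size_polyN sr; have := size_zeros hf; rewrite sfg; case: ifP => _; lia.
- by rewrite -f1E -fE.
Qed.

Lemma pencil_majorized (s : R) f g h : 0 <= s -> nz f -> nz g -> nz h ->
  Nev f g -> Nev g h -> 0 < lead_coef f * lead_coef g -> 0 < lead_coef g * lead_coef h ->
  size f = (size g).+1 -> size g = (size h).+1 -> poly_majorized f (f - s *: h).
Proof.
move=> s0 hf hg hh nfg ngh lfg lgh sfg sgh.
have [[_ il]|[lt0 _]] := rrooted_interlace hg hh ngh; last by rewrite ltNge (ltW lgh) in lt0.
have sz : size (zeros g) = (size (zeros h)).+1.
  by apply: succn_inj; rewrite -!size_zeros.
have [[_ alt]|[e _]] := interlace_alternating (sorted_zeros g) (sorted_zeros h) il; last by lia.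
have [ts pos E] := alternating_cone alt sz.
have lg0 : lead_coef g != 0 by rewrite lead_coef_eq0 rrooted_neq0.
(* Passes from the monic cone decomposition of h to the normalization by [lead_coef g]; it is
   nonnegative because both leading coefficients have the same sign. *)
pose c := s * lead_coef h / lead_coef g.
have c0 : 0 <= c.
  have -> : c = s * (lead_coef g * lead_coef h) / (lead_coef g ^+ 2) by rewrite /c; field.
  by rewrite divr_ge0 ?sqr_ge0 // mulr_ge0 // ltW.
have -> : f - s *: h = f - \sum_(t <- ts) ((c * t.1) * lead_coef g) *: XP (rem t.2 (zeros g)).
  congr (_ - _); rewrite {1}(rrooted_split hh) E !scaler_sumr; apply: eq_bigr => t _.
  by rewrite !scalerA; congr (_ *: _); rewrite /c; field.
have {E} pos' t : t \in ts -> 0 <= c * t.1 /\ t.2 \in zeros g.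
  by move=> /pos[t0 tg]; rewrite mulr_ge0.
elim: ts pos' f hf nfg lfg sfg {pos} => [|t ts IH] pos f hf nfg lfg sfg.
  by rewrite big_nil subr0; exact: poly_majorized_refl.
have [t0 tg] := pos t (mem_head _ _).
have [n1 s1 l1 m1] := rem_zero_majorized t0 tg hf hg nfg lfg sfg.
rewrite big_cons opprD addrA; apply: (poly_majorized_trans m1).
apply: IH => //.
- by move=> u uts; apply: pos; rewrite in_cons uts orbT.
- by have [m [_ [/hyperbolicP]]] := m1.
- by rewrite l1.
- by rewrite s1.
Qed.

End Majorization.

(** * Hardy-Littlewood-Polya pinches *)

Section Chain.
Variable R : realType.
Implicit Types (x y c s : seq R).

Lemma perm_insert2 (T : eqType) (a b : T) (s1 s2 s3 : seq T) :
  perm_eq ((s1 ++ a :: s2) ++ b :: s3) (a :: b :: s1 ++ s2 ++ s3).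
Proof. by apply/permP => P; rewrite -[a :: s2]cat1s -[b :: s3]cat1s -[a :: b :: _]/([:: a] ++ [:: b] ++ _) !count_cat; lia. Qed.

Lemma perm_move_cons (T : eqType) (a : T) (s1 s2 : seq T) :
  perm_eq ((a :: s1) ++ s2) (s1 ++ a :: s2).
Proof. by apply/permP => P; rewrite -[a :: s2]cat1s -[a :: s1]cat1s !count_cat; lia. Qed.

Definition lsum s : R := \sum_(a <- s) a.

Lemma lsum_cons a s : lsum (a :: s) = a + lsum s.
Proof. exact: big_cons. Qed.

Lemma lsum_nil : lsum [::] = 0.
Proof. exact: big_nil. Qed.

Lemma lsum_cat s s' : lsum (s ++ s') = lsum s + lsum s'.
Proof. exact: big_cat. Qed.

Lemma top_sum s k : (k <= size s)%N ->
  \sum_(i < k) s`_(size s - i.+1) = lsum s - lsum (take (size s - k) s).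
Proof.
move=> ks; rewrite -{3}(cat_take_drop (size s - k) s) lsum_cat addrAC subrr add0r.
rewrite /lsum (big_nth 0) size_drop subKn // -(big_mkord xpredT (fun i => s`_(size s - i.+1))).
rewrite big_nat_rev; apply: eq_big_nat => i ik; rewrite nth_drop; congr nth; lia.
Qed.

(** As the totals agree, bounds on sums of largest entries become reversed bounds on sums of
    smallest ones, the form suited to removing the smallest entry. *)
Lemma majorized_prefix x y : majorized x y ->
  forall k, (k <= size x)%N -> lsum (take k y) <= lsum (take k x).
Proof.
move=> [sxy exy h] k kx; have [->|k0] := posnP k; first by rewrite !take0.
have [->|kx'] := eqVneq k (size x); first by rewrite {1}sxy !take_size /lsum exy.
have lt : ((size x - k).-1.+2 <= size x)%N by lia.
have := h _ lt; rewrite !top_sum -?sxy ?/lsum ?exy; [|lia|lia].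
have -> : (size x - (size x - k).-1.+1 = k)%N by lia.
by rewrite lerD2l lerN2.
Qed.

Lemma prefix_majorized x y : size x = size y -> lsum x = lsum y ->
  (forall k, (k <= size x)%N -> lsum (take k y) <= lsum (take k x)) -> majorized x y.
Proof.
move=> sxy exy h; split=> // k kx; rewrite !top_sum -?sxy ?exy; [|lia|lia].
by rewrite lerD2l lerN2 h // leq_subr.
Qed.

Lemma lsum_le (a : R) s s' : size s = size s' ->
  all (fun t => t <= a) s -> all (fun t => a <= t) s' -> lsum s <= lsum s'.
Proof.
elim: s s' => [|t s IH] [|t' s'] //= [e] /andP[ta sa] /andP[at' sa'].
by rewrite !lsum_cons lerD ?IH // (le_trans ta).
Qed.

Lemma all_take (P : pred R) k s : all P s -> all P (take k s).
Proof. by move=> h; rewrite -(cat_take_drop k s) all_cat in h; case/andP: h. Qed.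

Lemma pinch_pair (p q x0 : R) : p <= x0 <= q -> exists u t t' : R,
  [/\ 0 <= t' <= t, p = u - t, q = u + t &
      perm_eq [:: p + q - x0; x0] [:: u - t'; u + t']].
Proof.
move=> /andP[px xq]; pose u := (p + q) / 2.
have [ux|xu] := leP u x0.
  exists u, ((q - p) / 2), (x0 - u); rewrite /u in ux *; split; try lra.
  have -> : p + q - x0 = (p + q) / 2 - (x0 - (p + q) / 2) by lra.
  by have {2}-> : x0 = (p + q) / 2 + (x0 - (p + q) / 2) by lra.
exists u, ((q - p) / 2), (u - x0); rewrite /u in xu *; split; try lra.
have -> : p + q - x0 = (p + q) / 2 + ((p + q) / 2 - x0) by lra.
have {2}-> : x0 = (p + q) / 2 - ((p + q) / 2 - x0) by lra.
by rewrite -cat1s perm_catC.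
Qed.

(* The smallest entry of [x] is produced in [y] by one pinch of two adjacent
   entries, and then removed from both sides. *)
Lemma majorized_chain (N : nat) (G : seq R -> {poly R}) :
  (forall s s', perm_eq s s' -> G s = G s') ->
  (forall c (u t t' : R), (size c).+2 = N -> 0 <= t' <= t ->
     poly_majorized (G (u - t' :: u + t' :: c)) (G (u - t :: u + t :: c))) ->
  (forall s, size s = N -> poly_majorized (G s) (G s)) ->
  forall x y c, sorted <=%R x -> sorted <=%R y -> majorized x y ->
    (size x + size c)%N = N -> poly_majorized (G (x ++ c)) (G (y ++ c)).
Proof.
move=> Gperm pinch Grefl x; have [m sm] := ubnP (size x); elim: m x sm => // m IH x.
move=> sm y c srtx srty mj sN; have [sxy exy _] := mj.
case: x => [|x0 x] in sm srtx mj sN sxy exy *.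
  by case: y sxy {srty mj exy} => // _; apply: Grefl.
have pre := majorized_prefix mj.
have xge : all (fun t => x0 <= t) (x0 :: x).
  by rewrite /= lexx; apply: order_path_min srtx; exact: le_trans.
have has_ge : has (fun t => x0 <= t) y.
  apply/negPn/negP => /hasPn h; have : lsum y < lsum (x0 :: x).
    case: y h sxy {srty mj exy pre} => // y0 y h [sxy]; rewrite !lsum_cons.
    rewrite ltr_leD //; first by rewrite ltNge h ?mem_head.
    apply: (@lsum_le x0) => //; last by case/andP: xge.
    by apply/allP => t ty; rewrite ltW // ltNge h // in_cons ty orbT.
  by rewrite /lsum exy ltxx.
(* The first entry of [y] that is at least [x0]; one exists, since otherwise the sum of [y] would be
   smaller than that of [x]. *)
pose i := find (fun t => x0 <= t) y.
have iy : (i < size y)%N by rewrite -has_find.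
have yE : y = take i y ++ y`_i :: drop i.+1 y by rewrite -drop_nth // cat_take_drop.
have qx : x0 <= y`_i by exact: (nth_find 0 has_ge).
have small : all (fun t => t < x0) (take i y).
  apply/(all_nthP 0) => j; rewrite size_takel ?(ltnW iy) // => ji.
  by rewrite nth_take // ltNge (before_find 0 ji).
move: {i iy} (y`_i) (take i y) (drop i.+1 y) qx small yE => q pre0 post qx small yE.
have srtx' := path_sorted srtx.
(* If no entry of [y] lies below [x0], the prefix inequality of length 1 gives [q = x0], and this
   common entry moves to [c]. *)
case/lastP: pre0 => [|pre0 p] in small yE *.
  have q0 : q = x0.
    apply/le_anti; rewrite qx andbT; have := pre 1%N isT.
    by rewrite yE /= !lsum_cons !take0 !lsum_nil !addr0.
  move: yE; rewrite /= q0 => yE; rewrite yE.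
  rewrite (Gperm _ (x ++ x0 :: c)); last exact: perm_move_cons.
  rewrite (Gperm ((x0 :: post) ++ c) (post ++ x0 :: c)); last first.
    exact: perm_move_cons.
  apply: IH => //.
  - by rewrite yE /= in srty; exact: path_sorted srty.
  - apply: prefix_majorized.
    + by move: sxy; rewrite yE => -[].
    + by move: exy; rewrite yE -!/(lsum _) !lsum_cons => /addrI.
    + by move=> k kx; have := pre k.+1 kx; rewrite yE /= !lsum_cons lerD2l.
  - by rewrite /= addnS -sN.
rewrite all_rcons in small; case/andP: small => px small.
have pq : p <= x0 <= q by rewrite ltW.
(* The neighbours p < x0 <= q are pinched to w and x0 with the same sum; w lies between p and q, so
   [y] stays sorted. *)
pose w := p + q - x0.
have [pw wq] : p <= w /\ w <= q by rewrite /w; case/andP: pq => *; split; lra.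
move: yE; rewrite cat_rcons => yE.
have sizes : size x = size (pre0 ++ w :: post).
  by move: sxy; rewrite yE !size_cat /= !addnS => -[].
apply: (@poly_majorized_trans _ (G ((pre0 ++ w :: post) ++ x0 :: c))).
  rewrite (Gperm _ (x ++ x0 :: c)); last exact: perm_move_cons.
  apply: IH => //; last by rewrite /= addnS -sN.
    move: srty; rewrite yE !(sorted_pairwise le_trans) !pairwise_cat /=.
    move=> /and3P[a1 -> /and3P[/andP[pq' ppost] qpost ->]]; rewrite !andbT /=.
    apply/andP; split.
      move: a1; rewrite !allrel_consr => /and3P[ap aq ->]; rewrite andbT.
      by apply/allP => t tp; apply: le_trans (allP ap t tp) pw.
    by apply/allP => t tp; apply: le_trans wq (allP qpost t tp).
  apply: prefix_majorized => //.
    move: exy; rewrite yE -!/(lsum _) !lsum_cat !lsum_cons /w; lra.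
  (* Prefixes inside [pre0] have entries below [x0], hence below those of [x]. Longer ones inherit
     the original inequality for one more entry, as p + q = w + x0. *)
  move=> k kx; have [kp|pk] := leqP k (size pre0).
    apply: (@lsum_le x0).
    - by rewrite !size_takel // -sizes.
    - rewrite takel_cat //; apply: all_take; apply/allP => t tp; apply: ltW.
      exact: (allP small).
    - by apply: all_take; case/andP: xge.
  have := pre k.+1 kx; rewrite yE /= lsum_cons !take_cat.
  have -> : (k.+1 < size pre0)%N = false by move: pk; clear; lia.
  have -> : (k < size pre0)%N = false by move: pk; clear; lia.
  have -> : (k.+1 - size pre0 = (k - size pre0).-1.+2)%N by move: pk; clear; lia.
  have -> : (k - size pre0 = (k - size pre0).-1.+1)%N by move: pk; clear; lia.
  by rewrite /= !lsum_cat !lsum_cons /w; lra.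
have [u [t [t' [tt pE qE per]]]] := pinch_pair pq.
pose d := pre0 ++ post ++ c.
rewrite (Gperm _ (u - t' :: u + t' :: d)); last first.
  apply: (@perm_trans _ ([:: w; x0] ++ d)); last by rewrite -[u - t' :: _]/([:: _; _] ++ d) perm_cat2r.
  exact: perm_insert2.
rewrite (Gperm (y ++ c) (u - t :: u + t :: d)); last first.
  rewrite yE -pE -qE -catA -[(_ :: _) ++ c]/([:: p; q] ++ (post ++ c)).
  by rewrite perm_catCA.
apply: pinch => //.
by rewrite /d -sN /= sizes !size_cat /= addnS !addSn addnA.
Qed.

End Chain.

(** * The Grace-Walsh-Szego theorem *)

Section GraceWalshSzego.
Variable R : realType.
Local Notation C := R[i].
Local Notation Im := (@complex.Im R).
Implicit Types (z w x : C) (f : {poly C}) (s : seq C).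

Lemma ImV z : Im z^-1 = - Im z / sqn z.
Proof. by case: z => a b; rewrite /sqn /= mulNr. Qed.

Lemma sqnV z : sqn z^-1 = (sqn z)^-1.
Proof.
have [->|z0] := eqVneq z 0; first by rewrite invr0 sqn0 invr0.
have n0 : sqn z != 0 by rewrite sqn_eq0.
apply: (mulfI n0); rewrite divff // -sqnM divff //.
by rewrite /sqn /= expr1n expr0n addr0.
Qed.

Lemma deriv_XP s w : w \notin s ->
  (XP s)^`().[w] = (XP s).[w] * \sum_(x <- s) (w - x)^-1.
Proof.
elim: s => [|x s IH]; first by rewrite XP_nil -polyC1 derivC horner0 big_nil mulr0.
rewrite in_cons negb_or => /andP[wx ws].
rewrite XP_cons derivM derivXsubC hornerD !hornerM IH // hornerXsubC big_cons hornerC.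
have : w - x != 0 by rewrite subr_eq0.
by move=> wx0; field.
Qed.

(* For [Im x <= 0 < Im w] the number [(w - x)^-1] lies in the disk
   [Im w * |u|^2 <= - Im u]; the sum of [d] such numbers lies in its [d]-fold
   dilation. *)
Lemma inv_sum_disk s w : 0 < Im w -> (forall x, x \in s -> Im x <= 0) ->
  Im w * sqn (\sum_(x <- s) (w - x)^-1) <=
    - (size s)%:R * Im (\sum_(x <- s) (w - x)^-1).
Proof.
move=> w0; elim: s => [|x s IH] h; first by rewrite big_nil sqn0 /= !mulr0.
have hs : forall y, y \in s -> Im y <= 0 by move=> y ys; rewrite h // in_cons ys orbT.
have hx : Im x <= 0 by rewrite h // mem_head.
rewrite big_cons /=; move: (IH hs); set U := \sum_(_ <- _) _ => IHU.
have ux : Im w * sqn (w - x)^-1 <= - Im (w - x)^-1.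
  rewrite sqnV ImV mulNr opprK ler_wpM2r ?invr_ge0 ?sqn_ge0 //.
  by move: hx; case: (x) (w) => [a b] [c d] /=; lra.
move: IHU ux; set u := (w - x)^-1; rewrite sqnD.
have [s0|] := posnP (size s).
  have -> : U = 0 by rewrite /U; case: (s) s0 => // _; rewrite big_nil.
  by rewrite s0 sqn0 => _; case: (u) => p q; rewrite /sqn; simpc => /=; lra.
rewrite -(ltr0n R) -[(size s).+1%:R]natr1; move: (size s)%:R => d d0.
case: (U) (u) => [a b] [p q]; rewrite /sqn; simpc => /= hU hu.
have h1 : (Im w) * (d * (p ^+ 2 + q ^+ 2) + d^-1 * (a ^+ 2 + b ^+ 2)) <= - d * q - b.
  have e : Im w * (d^-1 * (a ^+ 2 + b ^+ 2)) <= - b.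
    have -> : - b = d^-1 * (- d * b) by field; rewrite lt0r_neq0.
    by rewrite mulrCA mulNr ler_wpM2l // invr_ge0 ltW.
  have : d * (Im w * (p ^+ 2 + q ^+ 2)) <= d * - q by rewrite ler_wpM2l // ltW.
  lra.
(* The cross term of |u + U|^2 is split with weights d and 1/d, the number of summands in U being d;
   these weights make the disk for d summands and the disk for one add up to that for d + 1. *)
have h2 : 2 * (p * a + q * b) <= d * (p ^+ 2 + q ^+ 2) + d^-1 * (a ^+ 2 + b ^+ 2).
  rewrite -subr_ge0.
  have -> : d * (p ^+ 2 + q ^+ 2) + d^-1 * (a ^+ 2 + b ^+ 2) - 2 * (p * a + q * b) =
     d * ((p - a / d) ^+ 2 + (q - b / d) ^+ 2) by field; rewrite lt0r_neq0.
  by rewrite mulr_ge0 ?addr_ge0 ?sqr_ge0 // ltW.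
have h3 : Im w * (2 * (p * a + q * b)) <= - d * q - b.
  by apply: le_trans h1; rewrite ler_wpM2l // ltW.
lra.
Qed.

(** At a zero of this polar derivative the sum of 1 / (w - y) over the zeros y of f equals (n + 1) /
    (w - x). Inserted in the disk inequality of [inv_sum_disk] this contradicts [0 < Im x]; a degree
    below n + 1 only makes the disk smaller. *)
Lemma laguerre (n : nat) f w x : (size f <= n.+2)%N -> stableC f -> 0 < Im w -> 0 < Im x ->
  n.+1%:R * f.[w] + (x - w) * f^`().[w] != 0.
Proof.
move=> sf nzf w0 x0; apply/eqP => E.
have [f0|[s [fE l0 sfE simp]]] := stableC_split nzf.
  by have := nzf w w0; rewrite f0 horner0 eqxx.
have ws : w \notin s by apply/negP => /simp; rewrite leNgt w0.
have fw : f.[w] != 0 := nzf w w0.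
have dfE : f^`().[w] = f.[w] * \sum_(x <- s) (w - x)^-1.
  by rewrite fE -!/(XP s) derivZ !hornerZ deriv_XP // mulrA.
move: (inv_sum_disk w0 simp) E; rewrite dfE; set U := \sum_(_ <- _) _ => disk E.
have {}E : (w - x) * U = n.+1%:R.
  have : f.[w] * (n.+1%:R - (w - x) * U) = 0 by rewrite -E; ring.
  by move/eqP; rewrite mulf_eq0 (negPf fw) subr_eq0 => /eqP.
have wx : w - x != 0.
  by apply/eqP => e; move/eqP: E; rewrite e mul0r eq_sym pnatr_eq0.
have UE : U = n.+1%:R%:C * (w - x)^-1.
  by apply: (mulfI wx); rewrite E rmorph_nat mulrCA divff // mulr1.
have nn : (size s)%:R <= n.+1%:R :> R by rewrite ler_nat; rewrite sfE in sf; lia.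
move: disk; rewrite UE sqnM sqn_real.
have -> : Im (n.+1%:R%:C * (w - x)^-1) = n.+1%:R * Im (w - x)^-1.
  by case: ((w - x)^-1) => a b; simpc.
rewrite sqnV ImV.
have q0 : 0 < sqn (w - x) by rewrite sqn_gt0.
have N0 : 0 < n.+1%:R :> R by rewrite ltr0n.
have -> : Im (w - x) = Im w - Im x by case: (w) (x) => [a b] [c d].
move: nn N0; move: (n.+1%:R : R) ((size s)%:R : R) (ler0n R (size s)) => N d d0 nn N0.
rewrite -subr_ge0.
have -> : - d * (N * (- (Im w - Im x) / sqn (w - x))) - Im w * (N ^+ 2 / sqn (w - x)) =
  (N / sqn (w - x)) * (d * (Im w - Im x) - Im w * N) by field; rewrite lt0r_neq0.
rewrite pmulr_rge0 ?divr_gt0 // => H.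
have [dN|] := eqVneq d N; first by rewrite dN in H; nra.
move=> dN; have : 0 < N - d by rewrite subr_gt0 lt_neqAle dN nn.
by move=> /(mulr_gt0 w0); have := mulr_ge0 d0 (ltW x0); lra.
Qed.

Lemma coef_XDexp (c : C) n k : (('X + c%:P) ^+ n)`_k = c ^+ (n - k) *+ 'C(n, k).
Proof.
rewrite addrC exprDn coef_sum.
have [kn|nk] := leqP k n; last first.
  rewrite bin_small // mulr0n big1 // => i _; rewrite coefMn -rmorphXn coefCM coefXn.
  by rewrite (gtn_eqF (leq_ltn_trans (leq_ord i) nk)) mulr0 mul0rn.
rewrite (bigD1 (Ordinal (kn : k < n.+1)%N)) //= coefMn -rmorphXn coefCM coefXn eqxx mulr1.
rewrite big1 ?addr0 // => i ik; rewrite coefMn -rmorphXn coefCM coefXn.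
by rewrite (_ : (k == i) = false) ?mulr0 ?mul0rn //; apply: contra_neqF ik => /eqP e; apply: val_inj.
Qed.

(** The linear functional with moments [a]. On products of n factors X + x_i it is a symmetric
    multiaffine polynomial in the x_i, with diagonal value at (X + w)^n. *)
Definition pairing (n : nat) (a : nat -> C) (p : {poly C}) : C := \sum_(k < n.+1) p`_k * a k.

(** Fixing one variable x gives the moments [b] in one variable less. With f the full diagonal
    polynomial, the new diagonal value is f(w) + (x - w) f'(w) / (n + 1), a polar derivative,
    nonzero by [laguerre]. *)
Lemma grace_walsh_szego (n : nat) (a : nat -> C) s : size s = n ->
  (forall w, 0 < Im w -> pairing n a (('X + w%:P) ^+ n) != 0) ->
  (forall x, x \in s -> 0 < Im x) ->
  pairing n a (\prod_(x <- s) ('X + x%:P)) != 0.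
Proof.
elim: n a s => [|n IH] a [|x s] //= sn ha hs.
  by rewrite big_nil; have := ha ('i)%C; rewrite expr0 /= ltr01; apply.
case: sn => sn; pose b k := a k.+1 + x * a k.
have pairE (p : {poly C}) : (size p <= n.+1)%N -> pairing n.+1 a (p * ('X + x%:P)) = pairing n b p.
  move=> sp; rewrite /pairing.
  transitivity (\sum_(k < n.+2) (p * 'X)`_k * a k + \sum_(k < n.+2) (p`_k * x) * a k).
    by rewrite -big_split; apply: eq_bigr => k _; rewrite mulrDr coefD coefMC mulrDl.
  rewrite big_ord_recl coefMX /= mul0r add0r [X in _ + X]big_ord_recr /=.
  rewrite (nth_default 0 sp) !mul0r addr0 -big_split; apply: eq_bigr => k _.
  by rewrite coefMX /= /b; ring.
have sX (t : seq C) : (size t <= n)%N -> (size (\prod_(y <- t) ('X + y%:P))%R <= n.+1)%N.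
  move=> tn; have -> : \prod_(y <- t) ('X + y%:P) = XP (map -%R t).
    by rewrite /XP big_map; apply: eq_bigr => y _; rewrite rmorphN opprK.
  by rewrite size_XP size_map.
have sXn (w : C) : (size (('X + w%:P) ^+ n)%R <= n.+1)%N.
  have := sX (nseq n w); rewrite size_nseq leqnn => /(_ isT).
  by rewrite big_nseq iter_mulr_1.
rewrite big_cons mulrC pairE ?sX ?sn //; apply: IH => //; last first.
  by move=> y ys; apply: hs; rewrite in_cons ys orbT.
move=> w w0; rewrite -pairE //.
pose f : {poly C} := \sum_(k < n.+2) (a k *+ 'C(n.+1, k)) *: 'X^(n.+1 - k).
have fE u : f.[u] = pairing n.+1 a (('X + u%:P) ^+ n.+1).
  rewrite horner_sum; apply: eq_bigr => k _; rewrite coef_XDexp hornerZ hornerXn.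
  by rewrite mulrnAl mulrnAl mulrC.
have dfE u : f^`().[u] = n.+1%:R * pairing n.+1 a (('X + u%:P) ^+ n).
  rewrite /f raddf_sum horner_sum /pairing big_distrr; apply: eq_bigr => k _ /=.
  rewrite coef_XDexp derivZ derivXn hornerZ hornerMn hornerXn.
  have [kn|nk] := leqP k n; last first.
    have -> : (n.+1 - k = 0)%N by have := ltn_ord k; lia.
    by rewrite mulr0n (bin_small nk) mulr0n !mulr0 mul0r mulr0.
  have e : ('C(n.+1, k) * (n.+1 - k) = n.+1 * 'C(n, k))%N.
    by rewrite mulnC mul_bin_down.
  have -> : (n.+1 - k).-1 = (n - k)%N by lia.
  have e' : 'C(n.+1, k)%:R * (n.+1 - k)%:R = n.+1%:R * 'C(n, k)%:R :> C by rewrite -!natrM e.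
  rewrite -[a k *+ _]mulr_natr -[u ^+ _ *+ (n.+1 - k)]mulr_natr -[u ^+ _ *+ 'C(n, k)]mulr_natr.
  transitivity (a k * u ^+ (n - k) * ('C(n.+1, k)%:R * (n.+1 - k)%:R)); first by ring.
  by rewrite e'; ring.
have : n.+1%:R * f.[w] + (x - w) * f^`().[w] != 0.
  apply: laguerre => //; last by rewrite hs // mem_head.
    apply: (leq_trans (size_sum _ _ _)); apply/bigmax_leqP => k _.
    by apply: (leq_trans (size_scale_leq _ _)); rewrite size_polyXn; lia.
  by move=> u u0; rewrite fE ha.
rewrite fE dfE.
have -> : pairing n.+1 a (('X + w%:P) ^+ n.+1) =
   pairing n.+1 a (('X + w%:P) ^+ n * 'X) + w * pairing n.+1 a (('X + w%:P) ^+ n).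
  rewrite exprSr mulrDr /pairing big_distrr -big_split; apply: eq_bigr => k _ /=.
  by rewrite coefD coefMC; ring.
have -> : pairing n.+1 a (('X + w%:P) ^+ n * ('X + x%:P)) =
   pairing n.+1 a (('X + w%:P) ^+ n * 'X) + x * pairing n.+1 a (('X + w%:P) ^+ n).
  rewrite mulrDr /pairing big_distrr -big_split; apply: eq_bigr => k _ /=.
  by rewrite coefD coefMC; ring.
move=> h; apply: contraNneq h => e; apply/eqP.
set A := pairing _ _ (_ * 'X) in e *; set B := pairing _ _ _ in e *.
have : n.+1%:R * (A + x * B) = 0 by rewrite e mulr0.
move=> <-; ring.
Qed.

End GraceWalshSzego.

(** * The Hermite-Biehler theorem *)

Section HermiteBiehler.
Variable R : realType.
Local Notation C := R[i].
Local Notation Im := (@complex.Im R).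
Local Notation Re := (@complex.Re R).
Local Notation toC := (map_poly (real_complex R)).
Implicit Types (z w : C) (f g : {poly C}).

Lemma ReIm_poly f : f = toC (map_poly Re f) + 'i%:P * toC (map_poly Im f).
Proof.
apply/polyP => k; rewrite coefD coefCM !coef_map_id0 //.
by case: (f`_k) => a b; simpc.
Qed.

Lemma conj_poly f : map_poly conjc f = toC (map_poly Re f) - 'i%:P * toC (map_poly Im f).
Proof.
apply/polyP => k; rewrite coefB coefCM !coef_map_id0 ?conjc0 //.
by case: (f`_k) => a b; simpc.
Qed.

Lemma conj_horner f z : (map_poly conjc f).[z] = (f.[z^*])^*.
Proof. by rewrite -{1}(conjcK z) horner_map. Qed.

Lemma prod_lt (s : seq C) z : (0 < size s)%N -> 0 < Im z -> (forall x, x \in s -> Im x < 0) ->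
  \prod_(x <- s) sqn (z^* - x) < \prod_(x <- s) sqn (z - x).
Proof.
move=> s0 z0; have fac x : Im x < 0 -> sqn (z^* - x) < sqn (z - x).
  by case: (z) (x) z0 => [a b] [c d] /= b0 d0; rewrite /sqn; simpc => /=; nra.
elim: s s0 => // x [|y s] IH _ h.
  by rewrite !big_seq1; apply: fac; rewrite h // mem_head.
rewrite big_cons [X in _ < X]big_cons; apply: ltr_pM.
- exact: sqn_ge0.
- by apply: prodr_ge0 => *; exact: sqn_ge0.
- by apply: fac; rewrite h // mem_head.
- by apply: IH => // t ts; apply: h; rewrite in_cons ts orbT.
Qed.

(** At a zero z of the imaginary part, f(z) is the conjugate of f at the conjugate point, so both
    values have equal modulus. But all zeros of f lie strictly below the real axis, so the value at
    z is strictly larger. *)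
Lemma hermite_biehler f : (1 < size f)%N -> (forall z, 0 <= Im z -> f.[z] != 0) ->
  nz (map_poly Im f).
Proof.
move=> sf h z z0.
have [s fE] := closed_field_poly_normal f.
have f0 : f != 0 by rewrite -size_poly_gt0; exact: leq_trans sf.
have simp x : x \in s -> Im x < 0.
  move=> xs; rewrite ltNge; apply/negP => /h; rewrite fE hornerZ mulf_eq0 negb_or.
  by rewrite -/(XP s) -[(XP s).[x] == 0]/(root _ x) root_prod_XsubC xs andbF.
have s0 : (0 < size s)%N by move: sf; rewrite fE size_scale ?lead_coef_eq0 // size_prod_XsubC.
have lt : sqn f.[z^*] < sqn f.[z].
  rewrite fE !hornerZ !sqnM ltr_pM2l ?sqn_gt0 ?lead_coef_eq0 // !sqn_prod.
  exact: prod_lt.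
apply/eqP => e; have := congr1 (fun p => p.[z]) (ReIm_poly f).
have := congr1 (fun p => p.[z]) (conj_poly f).
rewrite conj_horner hornerD hornerN [in X in _ -> X]hornerD !hornerM e !mulr0 subr0 addr0.
by move=> e1 e2; rewrite e2 -e1 sqnJ ltxx in lt.
Qed.

(** On the closed upper half plane z + w keeps distance at least Im w from 0, so (z + w)^n dominates
    all polynomials of degree at most n there. *)
Lemma poly_growth f w (n : nat) : 0 < Im w -> (size f <= n.+1)%N ->
  exists2 K : R, 0 <= K & forall z, 0 <= Im z -> sqn f.[z] <= K * sqn (z + w) ^+ n.
Proof.
move=> w0; pose D := 2 + 2 * sqn w / Im w ^+ 2.
have w2 : 0 < Im w ^+ 2 by rewrite exprn_gt0.
have D0 : 0 <= D by rewrite addr_ge0 // divr_ge0 ?mulr_ge0 ?sqn_ge0 ?ltW.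
have low z : 0 <= Im z -> Im w ^+ 2 <= sqn (z + w).
  case: (z) (w) w0 => [a b] [c d] /= d0 b0; rewrite /sqn; simpc => /=.
  by have := sqr_ge0 (a + c); have := mulr_ge0 b0 (ltW d0); nra.
have zD z : 0 <= Im z -> sqn z <= D * sqn (z + w).
  move=> z0; have h1 : sqn z <= 2 * sqn (z + w) + 2 * sqn w.
    case: (z) (w) => [a b] [c d]; rewrite /sqn; simpc => /=.
    by have := sqr_ge0 (a + c + c); have := sqr_ge0 (b + d + d); nra.
  apply: (le_trans h1); rewrite /D [leRHS]mulrDl lerD2l.
  by rewrite mulrAC ler_pdivlMr // ler_wpM2l ?mulr_ge0 ?sqn_ge0 // low.
elim/poly_ind: f n => [|f c IH] n sf.
  by exists 0 => // z _; rewrite horner0 sqn0 mul0r.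
have [f0|f0] := eqVneq f 0.
  exists (sqn c / (Im w ^+ 2) ^+ n); first by rewrite divr_ge0 ?sqn_ge0 ?exprn_ge0 ?ltW.
  move=> z z0; rewrite f0 mul0r add0r hornerC mulrAC ler_pdivlMr ?exprn_gt0 //.
  by rewrite ler_wpM2l ?sqn_ge0 // lerXn2r ?nnegrE ?(ltW w2) ?sqn_ge0 // low.
case: n sf => [|n]; first by rewrite size_MXaddC (negPf f0) /= ltnS leqn0 size_poly_eq0 (negPf f0).
rewrite size_MXaddC (negPf f0) /= => sf; have [K K0 hK] := IH n sf.
exists (2 * (K * D) + 2 * (sqn c / (Im w ^+ 2) ^+ n.+1)).
  apply: addr_ge0; apply: mulr_ge0 => //; first exact: mulr_ge0.
  by apply: divr_ge0; [exact: sqn_ge0|apply: exprn_ge0; exact: ltW].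
move=> z z0; rewrite hornerMXaddC.
have h1 (a b : C) : sqn (a + b) <= 2 * sqn a + 2 * sqn b.
  case: (a) (b) => [a1 a2] [b1 b2]; rewrite /sqn; simpc => /=.
  by have := sqr_ge0 (a1 - b1); have := sqr_ge0 (a2 - b2); nra.
apply: (le_trans (h1 _ _)); rewrite sqnM [leRHS]mulrDl; apply: lerD.
  rewrite -mulrA ler_wpM2l // exprS.
  have -> : K * D * (sqn (z + w) * sqn (z + w) ^+ n) = (K * sqn (z + w) ^+ n) * (D * sqn (z + w)) by ring.
  by apply: ler_pM; rewrite ?sqn_ge0 ?hK ?zD.
rewrite -mulrA ler_wpM2l // mulrAC ler_pdivlMr ?exprn_gt0 //.
by rewrite ler_wpM2l ?sqn_ge0 // lerXn2r ?nnegrE ?(ltW w2) ?sqn_ge0 // low.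
Qed.

Lemma size_XDexp (c : C) n : size (('X + c%:P) ^+ n) = n.+1.
Proof. by rewrite -[c]opprK rmorphN size_exp_XsubC. Qed.

(* An open condition: small real perturbations of the imaginary part of
   [c * (z + w)^n] stay real-rooted. *)
Lemma hb_perturbation (n : nat) w (c : C) (r : {poly R}) : (0 < n)%N -> 0 < Im w -> c != 0 ->
  (size r <= n.+1)%N ->
  exists2 e : R, 0 < e & nz (map_poly Im (c *: ('X + w%:P) ^+ n) + e *: r).
Proof.
move=> n0 w0 c0 sr.
have sr' : (size (toC r) <= n.+1)%N by rewrite size_map_poly.
have [K K0 hK] := poly_growth w0 sr'.
(* Chosen so that e^2 (K + r_n^2) < |c|^2: the part with K keeps [f] below from vanishing on the
   closed half plane, the part with r_n keeps its degree equal to n. *)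
pose e := Num.min 1 (sqn c / (2 * (K + r`_n ^+ 2 + 1))).
have K1 : 0 < 2 * (K + r`_n ^+ 2 + 1) by rewrite mulr_gt0 // ltr_wpDl // addr_ge0 ?sqr_ge0.
have e0 : 0 < e by rewrite lt_min ltr01 divr_gt0 ?sqn_gt0.
exists e => //.
pose f := c *: ('X + w%:P) ^+ n + (Complex 0 e) *: toC r.
have -> : map_poly Im (c *: ('X + w%:P) ^+ n) + e *: r = map_poly Im f.
  apply/polyP => k; rewrite coefD coefZ !coef_map_id0 // coefD !coefZ !coef_map_id0 //.
  by case: (c * _) => a b; simpc.
have eK : e ^+ 2 * K + e ^+ 2 * r`_n ^+ 2 < sqn c.
  have e1 : e <= 1 by rewrite ge_min lexx.
  have e2 : e * (2 * (K + r`_n ^+ 2 + 1)) <= sqn c by rewrite -ler_pdivlMr // ge_min lexx orbT.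
  have := e0; have : 0 < sqn c by rewrite sqn_gt0.
  have : 0 <= (1 - e) * (e * (K + r`_n ^+ 2)).
    by rewrite !mulr_ge0 ?subr_ge0 ?addr_ge0 ?sqr_ge0 // ltW.
  have : 0 <= e * K by rewrite mulr_ge0 // ltW.
  have : 0 <= e * r`_n ^+ 2 by rewrite mulr_ge0 ?sqr_ge0 // ltW.
  by lra.
have hf z : 0 <= Im z -> f.[z] != 0.
  move=> z0; apply/eqP; rewrite hornerD !hornerZ => /eqP; rewrite addr_eq0 => /eqP E.
  have := congr1 (@sqn R) E; rewrite sqnN !sqnM horner_exp !hornerE sqnX => E2.
  have zw : 0 < sqn (z + w) ^+ n.
    rewrite exprn_gt0 // sqn_gt0; apply/eqP => h.
    have : Im (z + w) = 0 by rewrite h.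
    by move: z0 w0; case: (z) (w) => [a b] [p d] /=; lra.
  have : sqn c * sqn (z + w) ^+ n <= e ^+ 2 * K * sqn (z + w) ^+ n.
    rewrite E2 -mulrA; have -> : sqn (Complex 0 e) = e ^+ 2 by rewrite /sqn /= expr0n add0r.
    by rewrite ler_wpM2l ?sqr_ge0 // hK.
  rewrite ler_pM2r // leNgt; move/negP; apply; apply: le_lt_trans eK.
  by rewrite lerDl mulr_ge0 ?sqr_ge0.
apply: hermite_biehler => //.
apply: (@leq_trans n.+1) => //; rewrite ltnNge; apply/negP => sfn.
have : f`_n = 0 by rewrite nth_default.
rewrite coefD !coefZ coef_map coef_XDexp subnn binn mulr1 => /eqP; rewrite addr_eq0 => /eqP E.
have : sqn c = e ^+ 2 * r`_n ^+ 2.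
  by rewrite E sqnN sqnM sqn_real /sqn /= expr0n add0r.
move=> ec; rewrite ec in eK; have := lt_le_trans eK (lexx _).
by rewrite -subr_gt0 opprD addrCA subrr addr0 oppr_gt0 ltNge mulr_ge0 ?sqr_ge0.
Qed.

End HermiteBiehler.

(** * Stability of the symbol *)

Section CoefficientOperators.
Variable R : realType.
Local Notation C := R[i].
Local Notation Im := (@complex.Im R).
Local Notation Re := (@complex.Re R).
Local Notation toC := (map_poly (real_complex R)).
Variables (n : nat) (tau : nat -> {poly R}).
Implicit Types (z w : C) (p q r : {poly R}) (f g : {poly C}) (s : seq R).

(** Coefficients of index above n are ignored, so linear factors can be multiplied without carrying
    degree bounds in the types. *)
Definition opR p : {poly R} := \sum_(k < n.+1) p`_k *: tau k.

Definition opC f : {poly C} := \sum_(k < n.+1) f`_k *: toC (tau k).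

Lemma opRD p q : opR (p + q) = opR p + opR q.
Proof. by rewrite -big_split; apply: eq_bigr => k _; rewrite coefD scalerDl. Qed.

Lemma opRZ c p : opR (c *: p) = c *: opR p.
Proof. by rewrite scaler_sumr; apply: eq_bigr => k _; rewrite coefZ scalerA. Qed.

Lemma opRN p : opR (- p) = - opR p.
Proof. by rewrite -scaleN1r opRZ scaleN1r. Qed.

Lemma opRB p q : opR (p - q) = opR p - opR q.
Proof. by rewrite opRD opRN. Qed.

Lemma opR_XsubC c p : opR (('X - c%:P) * p) = opR ('X * p) - c *: opR p.
Proof. by rewrite mulrBl opRB mul_polyC opRZ. Qed.

Lemma opR_Xn k : (k <= n)%N -> opR 'X^k = tau k.
Proof.
move=> kn; rewrite /opR (bigD1 (Ordinal (kn : k < n.+1)%N)) //= coefXn eqxx scale1r big1 ?addr0 //.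
move=> i ik; rewrite coefXn (_ : (i == k :> nat) = false) ?scale0r //.
by apply: contra_neqF ik => /eqP e; apply: val_inj.
Qed.

Lemma opCD f g : opC (f + g) = opC f + opC g.
Proof. by rewrite -big_split; apply: eq_bigr => k _; rewrite coefD scalerDl. Qed.

Lemma opCZ c f : opC (c *: f) = c *: opC f.
Proof. by rewrite scaler_sumr; apply: eq_bigr => k _; rewrite coefZ scalerA. Qed.

Lemma opC_toC p : opC (toC p) = toC (opR p).
Proof.
by rewrite rmorph_sum; apply: eq_bigr => k _; rewrite /= map_polyZ coef_map.
Qed.

Lemma opC_pairing f z : (opC f).[z] = pairing n (fun k => (toC (tau k)).[z]) f.
Proof. by rewrite horner_sum; apply: eq_bigr => k _; rewrite hornerZ. Qed.

Lemma XP_nseq0 k : XP (nseq k 0) = 'X^k :> {poly R}.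
Proof. by rewrite /XP big_nseq iter_mulr_1 subr0. Qed.

(** Moving one zero c is affine with slope - l p, so if l vanishes for two values of c, it vanishes
    on p itself. *)
Lemma XP_span_zero (V : lmodType R) (l : {poly R} -> V) (d k : nat) :
  (forall c p, l (('X - c%:P) * p) = l ('X * p) - c *: l p) ->
  (forall s, size s = (k + d)%N -> l (XP s) = 0) -> forall s, size s = d -> l (XP s) = 0.
Proof.
move=> lX; elim: k => [|k IH] l0 s sd; first exact: l0.
apply: IH sd => t td.
have h c : l ('X * XP t) - c *: l (XP t) = 0 by rewrite -lX -XP_cons l0 //= td.
have := h 0; rewrite scale0r subr0 => h0; have := h (-1).
by rewrite h0 scaleN1r sub0r opprK.
Qed.

(** The extra zero escapes to minus infinity: [e *: XP (- e^-1 :: t)] tends to [XP t], and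
    [hurwitz_real] passes to the limit. *)
Lemma rrooted0_lower d k : (forall s, size s = (k + d)%N -> rrooted0 (opR (XP s))) ->
  forall s, size s = d -> rrooted0 (opR (XP s)).
Proof.
elim: k => [|k IH] h0 s sd; first exact: h0.
apply: IH sd => t td; apply: (@hurwitz_real _ _ (opR ('X * XP t))) => e e0.
have -> : opR (XP t) + e *: opR ('X * XP t) = e *: opR (XP (- e^-1 :: t)).
  rewrite XP_cons opR_XsubC scaleNr opprK scalerDr scalerA divff ?lt0r_neq0 //.
  by rewrite scale1r addrC.
by apply/rrooted0Z/h0; rewrite /= td.
Qed.

Section HyperbolicityPreserver.
Hypothesis hypT : forall s, size s = n -> rrooted0 (opR (XP s)).

Lemma preserver_rrooted0 p : (size p <= n.+1)%N -> nz p -> rrooted0 (opR p).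
Proof.
move=> sp hp; rewrite (rrooted_split hp) opRZ; apply: rrooted0Z.
have sz : (size (zeros p) <= n)%N by rewrite -ltnS -size_zeros.
apply: (@rrooted0_lower (size (zeros p)) (n - size (zeros p))) => // s.
by rewrite subnK //; exact: hypT.
Qed.

Lemma opC_split f : opC f = toC (opR (map_poly Re f)) + 'i *: toC (opR (map_poly Im f)).
Proof. by rewrite {1}(ReIm_poly f) mul_polyC opCD opCZ !opC_toC. Qed.

Lemma opC_conj f : opC (map_poly conjc f) = toC (opR (map_poly Re f)) - 'i *: toC (opR (map_poly Im f)).
Proof. by rewrite conj_poly mul_polyC -scaleNr opCD opCZ !opC_toC scaleNr. Qed.

Hypothesis n0 : (0 < n)%N.
Hypothesis not_all_hyp0 : ~ (forall p, (size p <= n.+1)%N -> rrooted0 (opR p)).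

(** The symbol F_T(z, w): expanding T((z + w)^n) in powers of w yields its binomial sum. *)
Definition symb z w := (opC (('X + w%:P) ^+ n)).[z].

Lemma symb_cross z w : 0 < Im z -> 0 < Im w ->
  cross (toC (opR (map_poly Re (('X + w%:P) ^+ n)))).[z]
      (toC (opR (map_poly Im (('X + w%:P) ^+ n)))).[z] != 0.
Proof.
move=> z0 w0; set P := ('X + w%:P) ^+ n; apply/eqP => /cross_eq0_dep [a [b [ab E]]].
(* Multiplying by this constant makes the vanishing combination the imaginary part of c (z + w)^n,
   the form covered by [hb_perturbation]. *)
pose c : C := b +i* a.
have c0 : c != 0 by rewrite eq_complex /= negb_and orbC.
have imE : map_poly Im (c *: P) = a *: map_poly Re P + b *: map_poly Im P.
  apply/polyP => k; rewrite coefD !coefZ !coef_map_id0 // coefZ.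
  by case: (P`_k) => x y; simpc => /=; rewrite addrC.
have sP : (size (map_poly Im (c *: P)) <= n.+1)%N.
  apply: (leq_trans (size_poly _ _)); apply: (leq_trans (size_scale_leq _ _)).
  by rewrite size_XDexp.
have Tq : opR (map_poly Im (c *: P)) = 0.
  have [//|h] : rrooted0 (opR (map_poly Im (c *: P))).
    have s0 : (size (0%R : {poly R}) <= n.+1)%N by rewrite size_poly0.
    have [e e0] := hb_perturbation n0 w0 c0 s0; rewrite scaler0 addr0 => hq.
    exact: preserver_rrooted0.
  have := h z z0; rewrite imE opRD !opRZ rmorphD /= !map_polyZ hornerD !hornerZ.
  by rewrite E eqxx.
apply: not_all_hyp0 => r sr; have [e e0 hr] := hb_perturbation n0 w0 c0 sr.
have : rrooted0 (opR (map_poly Im (c *: P) + e *: r)).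
  apply: preserver_rrooted0 => //; apply: (leq_trans (size_polyD _ _)).
  by rewrite geq_max sP (leq_trans (size_scale_leq _ _)).
rewrite opRD opRZ Tq add0r => /(rrooted0Z e^-1).
by rewrite scalerA mulVf ?scale1r // lt0r_neq0.
Qed.

Lemma conj_XDexp w : map_poly conjc (('X + w%:P) ^+ n) = ('X + (w^*)%:P) ^+ n.
Proof. by rewrite rmorphXn rmorphD /= map_polyX map_polyC. Qed.

(** Brings a difference of squared moduli into the form to which [cross_ivt] applies. *)
Lemma sqn_cross (u v : C) : cross (u + v) (- 'i * (u - v)) = sqn u - sqn v.
Proof. by case: u v => [a b] [c d]; rewrite /cross /sqn; simpc => /=; ring. Qed.

Lemma symb_sqn z w : 0 < Im z -> 0 < Im w -> sqn (symb z w) - sqn (symb z w^*) != 0.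
Proof.
move=> z0 w0; rewrite /symb -conj_XDexp opC_split opC_conj !(hornerD, hornerN, hornerZ).
have := symb_cross z0 w0; set A := (toC _).[z]; set B := (toC _).[z].
have -> : sqn (A + 'i * B) - sqn (A - 'i * B) = 4 * cross A B.
  by case: A B => [a b] [c d]; rewrite /cross /sqn; simpc => /=; ring.
by move=> h; rewrite mulf_neq0 // pnatr_eq0.
Qed.

Lemma symb_line z1 z2 w1 w2 : exists A : {poly C}, forall t : R,
  A.[t%:C] = symb ((z2 - z1) * t%:C + z1) ((w2 - w1) * t%:C + w1).
Proof.
pose Lz := (z2 - z1) *: 'X + z1%:P; pose Lw := (w2 - w1) *: 'X + w1%:P.
exists (\sum_(k < n.+1) (Lw ^+ (n - k) *+ 'C(n, k)) * (toC (tau k) \Po Lz)) => t.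
rewrite horner_sum /symb opC_pairing; apply: eq_bigr => k _.
rewrite coef_XDexp hornerM hornerMn horner_exp horner_comp /Lw /Lz.
by rewrite !(hornerD, hornerZ, hornerC, hornerX).
Qed.

Lemma symb_sign : (forall z w, 0 < Im z -> 0 < Im w -> sqn (symb z w^*) < sqn (symb z w)) \/
  (forall z w, 0 < Im z -> 0 < Im w -> sqn (symb z w) < sqn (symb z w^*)).
Proof.
have key z1 w1 z2 w2 : 0 < Im z1 -> 0 < Im w1 -> 0 < Im z2 -> 0 < Im w2 ->
    sqn (symb z1 w1^*) < sqn (symb z1 w1) -> sqn (symb z2 w2^*) < sqn (symb z2 w2).
  move=> z10 w10 z20 w20;
  rewrite -(subr_gt0 (sqn (symb z1 w1^*))) -(subr_gt0 (sqn (symb z2 w2^*))) -!sqn_cross.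
  have [A AE] := symb_line z1 z2 w1 w2.
  have [B BE] := symb_line z1 z2 w1^* w2^*.
  have := @cross_ivt _ (A + B) (- 'i%:P * (A - B)).
  have := AE 0; have := AE 1; have := BE 0; have := BE 1.
  rewrite -[(1 : R)%:C]/(1 : C) -[(0 : R)%:C]/(0 : C) !mulr1 !mulr0 !subrK !add0r => b1 b0 a1 a0.
  rewrite !(hornerM, hornerD, hornerN, hornerC) a0 a1 b0 b1; apply => t /andP[t0 t1].
  rewrite !(hornerM, hornerD, hornerN, hornerC) sqn_cross AE BE.
  have -> : (w2^* - w1^*) * t%:C + w1^* = ((w2 - w1) * t%:C + w1)^*.
    by rewrite rmorphD rmorphM rmorphB /= oppr0.
  apply: symb_sqn.
    by move: z10 z20; case: (z1) (z2) => [a b] [c d] /=; simpc => /=; nra.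
  by move: w10 w20; case: (w1) (w2) => [a b] [c d] /=; simpc => /=; nra.
have i0 : 0 < Im ('i : C)%C by rewrite /= ltr01.
have [h|h] := ltP (sqn (symb 'i%C ('i%C)^*)) (sqn (symb 'i%C 'i%C)).
  by left => z w z0 w0; exact: (key _ _ _ _ i0 i0 z0 w0 h).
right => z w z0 w0; rewrite lt_neqAle; apply/andP; split.
  by rewrite -subr_eq0 symb_sqn.
rewrite leNgt; apply/negP => h'; have := key _ _ _ _ z0 w0 i0 i0 h'.
by rewrite ltNge h.
Qed.

End HyperbolicityPreserver.

(* [symb_stable 1] and [symb_stable (-1)] are the stability of the symbol in the variables
   [(z, w)] and [(z, -w)] respectively. *)
Definition symb_stable (e : R) := forall z w, 0 < Im z -> 0 < Im w -> symb z (e%:C * w) != 0.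

Lemma preserver_stab : (forall s, size s = n -> rrooted0 (opR (XP s))) -> (0 < n)%N ->
  ~ (forall p, (size p <= n.+1)%N -> rrooted0 (opR p)) -> symb_stable 1 \/ symb_stable (-1).
Proof.
move=> h1 h2 h3; have [h|h] := symb_sign h1 h2 h3; [left|right] => z w z0 w0.
  by rewrite mul1r -sqn_gt0; apply: le_lt_trans (h z w z0 w0); exact: sqn_ge0.
(* The point - conj w is again in the upper half plane and its conjugate is - w, which is why the
   second sign yields stability of F(z, -w). *)
have w0' : 0 < Im (- w^*) by case: (w) w0 => a b /=; rewrite opprK.
have := h z (- w^*) z0 w0'; have -> : (- w^*)^* = (-1)%:C * w.
  by case: (w) => a b; simpc.
by rewrite -sqn_gt0; apply: le_lt_trans; exact: sqn_ge0.
Qed.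

End CoefficientOperators.

(** * Operators with a stable symbol *)

Section StableSymbol.
Variable R : realType.
Local Notation C := R[i].
Local Notation Im := (@complex.Im R).
Local Notation toC := (map_poly (real_complex R)).
Variables (n : nat) (tau : nat -> {poly R}) (e : R).
Local Notation opR := (opR n tau).
Local Notation opC := (opC n tau).
Implicit Types (z w : C) (p q r : {poly R}) (f g : {poly C}) (s : seq R).

Definition XD (t : seq C) : {poly C} := \prod_(x <- t) ('X + x%:P).

Lemma XD_cons x t : XD (x :: t) = ('X + x%:P) * XD t.
Proof. exact: big_cons. Qed.

Lemma XD_XP (t : seq C) : XD t = XP (map -%R t).
Proof. by rewrite /XD /XP big_map; apply: eq_bigr => x _; rewrite rmorphN opprK. Qed.

Lemma size_XD (t : seq C) : size (XD t) = (size t).+1.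
Proof. by rewrite XD_XP size_XP size_map. Qed.

Lemma toC_XP_XD s : toC (XP s) = XD (map (fun x => (- x)%:C) s).
Proof.
rewrite toC_XP XD_XP -map_comp; congr XP; apply: eq_map => x /=.
by rewrite rmorphN /= opprK.
Qed.

Lemma coef_XD_scale (c : C) (t : seq C) k :
  (XD (map ( *%R c) t))`_k = c ^+ (size t - k) * (XD t)`_k.
Proof.
elim: t k => [|x t IH] k.
  by rewrite /XD big_nil sub0n expr0 mul1r.
rewrite [map _ _]/= !XD_cons !mulrDl !coefD !coefXM !coefCM.
case: k => [|k] /=; first by rewrite !add0r IH subn0 exprS; ring.
rewrite !IH subSS; have [kt|tk] := ltnP k (size t).
  by rewrite (_ : size t - k = (size t - k.+1).+1)%N ?exprS; [ring|lia].
by rewrite [(XD t)`_k.+1]nth_default ?size_XD // !mulr0 !addr0.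
Qed.

Hypothesis ee : e * e = 1.
Hypothesis est : symb_stable n tau e.

(** By homogeneity the factor [e] moves from the variables into the moments, so the theorem for the
    upper half plane covers both signs. *)
Lemma symb_stable_open (t : seq C) : size t = n -> (forall x, x \in t -> 0 < Im (e%:C * x)) ->
  stableC (opC (XD t)).
Proof.
move=> tn ht z z0; rewrite opC_pairing.
pose b k := e%:C ^+ (n - k) * (toC (tau k)).[z].
have tE (t' : seq C) : size t' = n ->
    pairing n (fun k => (toC (tau k)).[z]) (XD (map ( *%R e%:C) t')) = pairing n b (XD t').
  by move=> t'n; apply: eq_bigr => k _; rewrite coef_XD_scale t'n /b; ring.
have eK x : e%:C * (e%:C * x) = x by rewrite mulrA -rmorphM ee mul1r.
have -> : t = map ( *%R e%:C) (map ( *%R e%:C) t).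
  by rewrite -map_comp -[LHS]map_id; apply: eq_map => x /=; rewrite eK.
rewrite tE ?size_map //; apply: grace_walsh_szego.
- by rewrite size_map.
- move=> w w0; have := est z0 w0; rewrite /symb opC_pairing.
  have -> : ('X + w%:P) ^+ n = XD (nseq n w) by rewrite /XD big_nseq iter_mulr_1.
  have -> : ('X + (e%:C * w)%:P) ^+ n = XD (map ( *%R e%:C) (nseq n w)).
    by rewrite map_nseq /XD big_nseq iter_mulr_1.
  by rewrite tE ?size_nseq.
- by move=> _ /mapP[x xt ->]; exact: ht.
Qed.

Hypothesis n0 : (0 < n)%N.
Hypothesis dc : forall k, (k < n)%N -> (size (tau k) < size (tau n))%N.

Lemma tau_n_neq0 : tau n != 0.
Proof. by rewrite -size_poly_gt0; apply: leq_trans (dc n0). Qed.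

Lemma opC_monic_neq0 f : f`_n = 1 -> opC f != 0.
Proof.
move=> fn; apply/eqP => h; have /eqP[] := tau_n_neq0; apply/eqP.
rewrite -lead_coef_eq0 -(fmorph_eq0 (real_complex R)) -coef_map -[(toC _)`__]mul1r -fn.
have := congr1 (fun g : {poly C} => g`_(size (tau n)).-1) h; rewrite coef0 coef_sum.
rewrite big_ord_recr /= coefZ big1 ?add0r => [->//|k _].
have tk : (tau k)`_(size (tau n)).-1 = 0.
  by rewrite nth_default // -ltnS prednK ?size_poly_gt0 ?tau_n_neq0 ?dc.
by rewrite coefZ coef_map tk; exact: mulr0.
Qed.

(** A boundary point y is pushed inside by i d e, since e * (i d e) = i d, and d tends to 0. The
    limit is not 0, because T(z^n) has the strictly largest degree. *)
Lemma symb_stable_closed (t1 t2 : seq C) : (size t1 + size t2)%N = n ->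
  (forall x, x \in t1 -> 0 < Im (e%:C * x)) -> (forall x, x \in t2 -> 0 <= Im (e%:C * x)) ->
  stableC (opC (XD (t1 ++ t2))).
Proof.
elim: t2 t1 => [|y t2 IH] t1 sn h1 h2.
  by rewrite cats0; apply: symb_stable_open; rewrite ?addn0 // in sn *.
have XDcat (x : C) : XD (t1 ++ x :: t2) = ('X + x%:P) * XD (t1 ++ t2).
  by rewrite -cat1s /XD !big_cat big_seq1 /= mulrCA.
have [|//] : opC (XD (t1 ++ y :: t2)) = 0 \/ stableC (opC (XD (t1 ++ y :: t2))).
  apply: (@hurwitz_affine R _ ((Complex 0 e) *: opC (XD (t1 ++ t2)))) => d d0; right.
  pose x := y + (Complex 0 (d * e)).
  have -> : opC (XD (t1 ++ y :: t2)) + d%:C *: (Complex 0 e *: opC (XD (t1 ++ t2))) =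
      opC (XD ((x :: t1) ++ t2)).
    rewrite cat_cons XD_cons XDcat scalerA -opCZ -opCD; congr (opC _).
    rewrite -mul_polyC -mulrDl; congr (_ * _); rewrite /x rmorphD addrA; congr (_ + _).
    by congr _%:P; simpc.
  apply: IH.
  - by rewrite /= addSn -addnS.
  - move=> u; rewrite in_cons => /orP[/eqP->|]; last exact: h1.
    have := h2 y (mem_head _ _); rewrite /x.
    case: (y) => a b; simpc => /= h; have := mulr_gt0 d0 ltr01; rewrite -[X in _ * X]ee; lra.
  - by move=> u ut; apply: h2; rewrite in_cons ut orbT.
move/eqP => h; exfalso; move: h; apply/negP/opC_monic_neq0.
have := monic_XP (map -%R (t1 ++ y :: t2)); rewrite -XD_XP monicE lead_coefE size_XD.
by rewrite size_cat sn => /eqP.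
Qed.

Lemma symb_stable_real s : size s = n -> nz (opR (XP s)).
Proof.
move=> sn; rewrite /nz -opC_toC toC_XP_XD; apply: (@symb_stable_closed [::]) => //.
  by rewrite size_map.
by move=> _ /mapP[x _ ->]; simpc.
Qed.

Lemma opR_low p : (size p <= n)%N -> (size (opR p) < size (tau n))%N.
Proof.
move=> sp; rewrite /opR big_ord_recr /= nth_default // scale0r addr0.
rewrite -[X in (_ < X)%N]prednK ?size_poly_gt0 ?tau_n_neq0 // ltnS.
apply: (leq_trans (size_sum _ _ _)); apply/bigmax_leqP => k _.
apply: (leq_trans (size_scale_leq _ _)); rewrite -ltnS prednK ?size_poly_gt0 ?tau_n_neq0 //.
exact: dc.
Qed.

Lemma opR_high p : p`_n != 0 -> (size p <= n.+1)%N ->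
  size (opR p) = size (tau n) /\ lead_coef (opR p) = p`_n * lead_coef (tau n).
Proof.
move=> pn sp; pose p1 := p - p`_n *: 'X^n.
have sp1 : (size p1 <= n)%N.
  apply/leq_sizeP => j nj; rewrite coefB coefZ coefXn.
  have [->|jn] := eqVneq j n; first by rewrite mulr1 subrr.
  by rewrite mulr0 subr0 nth_default // (leq_trans sp) // ltn_neqAle eq_sym jn nj.
have -> : opR p = p`_n *: tau n + opR p1.
  by rewrite opRB opRZ opR_Xn // addrC subrK.
have lt := opR_low sp1; have sz : size (p`_n *: tau n) = size (tau n) by rewrite size_scale.
by rewrite size_polyDl ?lead_coefDl ?sz // lead_coefZ.
Qed.

Lemma XP_coefn s : size s = n -> (XP s)`_n = 1.
Proof. by move=> sn; rewrite -(lead_coef_XP s) lead_coefE size_XP sn. Qed.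

Lemma opR_XP_lead s : size s = n ->
  size (opR (XP s)) = size (tau n) /\ lead_coef (opR (XP s)) = lead_coef (tau n).
Proof.
move=> sn; have := @opR_high (XP s); rewrite XP_coefn // mul1r; apply.
  exact: oner_neq0.
by rewrite size_XP sn.
Qed.

(** For w in the upper half plane F + e w N is the value of T at (z + e w) r, hence nonzero. If
    [cross F (e N)] were negative, w = - e F / N would lie in the upper half plane and annihilate
    it. *)
Lemma Nev_mulX s : (size s).+1 = n -> Nev (opR ('X * XP s)) (e *: opR (XP s)).
Proof.
move=> sn z z0; rewrite map_polyZ hornerZ crossZr leNgt; apply/negP => neg.
set F := (toC (opR ('X * XP s))).[z] in neg *; set N := (toC (opR (XP s))).[z] in neg *.
have key w : 0 < Im w -> F + e%:C * w * N != 0.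
  move=> w0; have : stableC (opC (XD ([:: e%:C * w] ++ map (fun x => (- x)%:C) s))).
    apply: symb_stable_closed.
    - by rewrite size_map add1n.
    - move=> x; rewrite inE => /eqP ->.
      by rewrite mulrA -rmorphM ee mul1r.
    - by move=> _ /mapP[x _ ->]; simpc.
  rewrite cat_cons XD_cons -toC_XP_XD mulrDl mul_polyC opCD opCZ => /(_ z z0).
  have -> : 'X * toC (XP s) = toC ('X * XP s) by rewrite rmorphM /= map_polyX.
  by rewrite !opC_toC hornerD hornerZ.
have N0 : N != 0 by apply/eqP => N0; rewrite N0 cross0r mulr0 ltxx in neg.
have := key (- (e%:C * F) / N).
have -> : F + e%:C * (- (e%:C * F) / N) * N = 0.
  rewrite -mulrA divfK // mulrN mulrA -rmorphM ee mul1r subrr //.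
rewrite eqxx => h; have : ~ 0 < Im (- (e%:C * F) / N) by move=> /h.
apply; have := crossVl (- (e%:C * F)) N0; rewrite crossNl crossZl => E.
have : 0 < sqn N * Im (- (e%:C * F) / N) by rewrite -E oppr_gt0.
by rewrite pmulr_rgt0 // sqn_gt0.
Qed.

(** [Nev_mulX] is applied with one more zero 1/d; after multiplication by d^2 the limit d -> 0
    leaves the claim. *)
Lemma Nev_mulX_low r : (exists2 s, (size s).+2 = n & r = XP s) -> Nev (opR ('X * r)) (e *: opR r).
Proof.
move=> [s sn ->] {r} z z0; rewrite map_polyZ hornerZ crossZr.
pose A := (toC (opR ('X * ('X * XP s)))).[z]; pose B := (toC (opR ('X * XP s))).[z].
pose D := (toC (opR (XP s))).[z].
apply: (@quadratic_limit _ _ (- (e * cross A D)) (e * cross A B)) => d d0.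
have sn' : (size (d^-1 :: s)).+1 = n by [].
have := Nev_mulX sn' z0; rewrite XP_cons map_polyZ hornerZ crossZr.
rewrite mulrCA !opR_XsubC !rmorphB /= !map_polyZ !hornerD !hornerN !hornerZ -/A -/B -/D.
rewrite !(crossDl, crossDr, crossNl, crossNr, crossZl, crossZr, crosszz) => h.
have : 0 <= d ^+ 2 * (e * (cross A B - d^-1 * cross A D - (d^-1 * 0 - d^-1 * (d^-1 * cross B D)))).
  by rewrite mulr_ge0 ?sqr_ge0 //; move: h; congr (0 <= _); ring.
congr (0 <= _); field; exact: lt0r_neq0.
Qed.

Lemma rrooted0_opR k s : (k + size s)%N = n -> rrooted0 (opR (XP s)).
Proof.
move=> ks; apply: (@rrooted0_lower _ n tau (size s) k) => // t tk.
by right; apply: symb_stable_real; rewrite tk.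
Qed.

Lemma Nev_size (f1 g1 : {poly R}) : nz f1 -> nz g1 -> Nev f1 (e *: g1) -> (size g1 < size f1)%N ->
  size f1 = (size g1).+1 /\ 0 < lead_coef f1 * (e * lead_coef g1).
Proof.
move=> hf hg nev lt.
have e0 : e != 0 by apply/eqP => e0; move/eqP: ee; rewrite e0 mul0r eq_sym oner_eq0.
have hg' : nz (e *: g1) by exact: rrootedZ.
have [v [v1 v2]] := count_gt_low (zeros f1) (zeros (e *: g1)).
have sf := size_zeros hf; have sg := size_zeros hg'; rewrite size_scale // in sg.
have [[pos h]|[neg h]] := rrooted_interlace hf hg' nev; have := h v; rewrite v1 v2 => h'.
  rewrite lead_coefZ in pos; split=> //; move: h' lt; rewrite sf sg.
  by move: (size _) (size _) => a b; lia.
exfalso; move: h' lt; rewrite sf sg.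
by move: (size _) (size _) => a b; lia.
Qed.

Lemma degree_drop_cases s : (size s).+1 = n -> opR (XP s) = 0 \/
  [/\ nz (opR (XP s)), size (tau n) = (size (opR (XP s))).+1 &
      0 < lead_coef (tau n) * (e * lead_coef (opR (XP s)))].
Proof.
move=> sn; have [|hN] := @rrooted0_opR 1 s sn; [by left|right].
have s0n : size (0 :: s) = n by [].
have [sf lf] := opR_XP_lead s0n.
have E : XP (0 :: s) = 'X * XP s by rewrite XP_cons subr0.
rewrite E in sf lf; have hf := symb_stable_real s0n; rewrite E in hf.
have lt : (size (opR (XP s)) < size (opR ('X * XP s)))%N.
  by rewrite sf opR_low // size_XP sn.
have [] := Nev_size hf hN (Nev_mulX sn) lt.
by rewrite sf lf.
Qed.

(** The coefficient of T p in degree deg T(z^n) - 1, the highest degree that T p can reach for deg p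
    < n. *)
Definition subcoef p : R := (opR p)`_(size (tau n)).-2.

Lemma subcoef_sign s : (size s).+1 = n -> 0 <= lead_coef (tau n) * (e * subcoef (XP s)).
Proof.
move=> sn; rewrite /subcoef; have [->|[_ sz pos]] := degree_drop_cases sn.
  by rewrite coef0 !mulr0.
by rewrite sz /= -lead_coefE ltW // -sz.
Qed.

Lemma subcoef_X c p : subcoef (('X - c%:P) * p) = subcoef ('X * p) - c * subcoef p.
Proof. by rewrite /subcoef opR_XsubC coefB coefZ. Qed.

(** The coefficient for (X - c) XP s is affine in c with slope [- subcoef (XP s)]; having a constant
    sign by [subcoef_sign], it must have slope 0. *)
Lemma subcoef0 s : (size s).+2 = n -> subcoef (XP s) = 0.
Proof.
move=> sn; have h c : 0 <= lead_coef (tau n) * (e * (subcoef ('X * XP s) - c * subcoef (XP s))).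
  by rewrite -subcoef_X -XP_cons subcoef_sign.
apply/eqP/negPn/negP => b0.
pose a := subcoef ('X * XP s); pose b := subcoef (XP s); rewrite -/b in b0.
have L0 : lead_coef (tau n) * e != 0.
  rewrite mulf_neq0 ?lead_coef_eq0 ?tau_n_neq0 //.
  by apply/eqP => e0; move/eqP: ee; rewrite e0 mul0r eq_sym oner_eq0.
(* This zero makes the expression that should be nonnegative equal to -1. *)
have := h ((a + (lead_coef (tau n) * e)^-1) / b).
rewrite -/a -/b divfK // opprD addrA subrr add0r mulrA mulrN divff //.
by rewrite oppr_ge0 ler10.
Qed.

Lemma subcoef_const t1 t2 : (size t1 + size t2).+1 = n ->
  subcoef (XP (t1 ++ t2)) = subcoef (XP (nseq (size t1) 0 ++ t2)).
Proof.
elim: t1 t2 => [|x t1 IH] t2 //= sn.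
rewrite XP_cons subcoef_X subcoef0 ?size_cat // mulr0 subr0.
have -> : 'X * XP (t1 ++ t2) = XP (t1 ++ 0 :: t2).
  by rewrite -cat1s !XP_cat XP_cons XP_nil subr0 mulr1 mulrCA.
rewrite IH /= ?addnS //; congr subcoef; apply: XP_perm.
by rewrite -cat1s -[0 :: _]cat1s perm_catCA.
Qed.

Hypothesis nd : exists2 k, (k < n)%N & tau k != 0.

(** [subcoef] is the same for all lists of this length. If it is 0 for one of them, then no image
    can have degree deg T(z^n) - 1, so all images vanish, and with them T on every degree below
    n. *)
Lemma opR_XP_neq0 s : (size s).+1 = n -> opR (XP s) != 0.
Proof.
move=> sn; apply/eqP => T0; have [k kn /eqP[]] := nd.
have all0 t : (size t).+1 = n -> opR (XP t) = 0.
  move=> tn; have [//|[_ sz]] := degree_drop_cases tn.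
  have : subcoef (XP t) = 0.
    have := @subcoef_const t [::]; have := @subcoef_const s [::].
    rewrite !cats0 !addn0 => /(_ sn) sE /(_ tn) ->.
    have -> : size t = size s by apply: succn_inj; rewrite tn sn.
    rewrite -sE; by rewrite -/(subcoef _) /subcoef T0 coef0.
  by rewrite /subcoef sz /= -lead_coefE => ->; rewrite !mulr0 ltxx.
have := @XP_span_zero R _ opR (size (nseq k (0 : R))) (n.-1 - k).
rewrite size_nseq => /(_ _ _ (nseq k 0)); rewrite XP_nseq0 opR_Xn ?(ltnW kn) //.
apply; [exact: opR_XsubC| |by rewrite size_nseq].
by move=> t tk; apply: all0; rewrite tk subnK ?prednK // -ltnS prednK.
Qed.

Lemma degree_drop s : (size s).+1 = n ->
  [/\ nz (opR (XP s)), size (tau n) = (size (opR (XP s))).+1 &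
      0 < lead_coef (tau n) * (e * lead_coef (opR (XP s)))].
Proof. by move=> sn; have [/eqP|//] := degree_drop_cases sn; rewrite (negPf (opR_XP_neq0 sn)). Qed.

Lemma Nev_cons s u : (size s).+2 = n -> Nev (opR (XP (u :: s))) (e *: opR (XP s)).
Proof.
move=> sn z z0; rewrite XP_cons opR_XsubC rmorphB /= hornerD hornerN !map_polyZ !hornerZ.
rewrite crossDl crossNl crossZl !crossZr crosszz !mulr0 subr0.
by have := Nev_mulX_low (ex_intro2 _ _ s sn erefl) z0; rewrite map_polyZ hornerZ crossZr.
Qed.

(** The image of [XP (u :: s)] has degree deg T(z^n) - 1, and [subcoef0] keeps the image of [XP s]
    from reaching it; [Nev_size] then gives a drop of exactly one. *)
Lemma degree_drop_low s u : (size s).+2 = n -> opR (XP s) = 0 \/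
  [/\ nz (opR (XP s)), size (opR (XP (u :: s))) = (size (opR (XP s))).+1 &
      0 < lead_coef (opR (XP (u :: s))) * (e * lead_coef (opR (XP s)))].
Proof.
move=> sn; have [|hN] := @rrooted0_opR 2 s sn; [by left|right].
have [hM sM _] := @degree_drop (u :: s) sn.
have lt : (size (opR (XP s)) < size (opR (XP (u :: s))))%N.
  have h1 : (size (opR (XP s)) < size (tau n))%N by rewrite opR_low // size_XP -sn.
  have := subcoef0 sn; rewrite /subcoef sM /= => c0; rewrite sM ltnS in h1.
  rewrite ltn_neqAle h1 andbT; apply/eqP => e1.
  by move: c0; rewrite -e1 -lead_coefE => /eqP; rewrite lead_coef_eq0 (negPf (rrooted_neq0 hN)).
by have [] := Nev_size hM hN (@Nev_cons s u sn) lt.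
Qed.

Lemma pinch_majorized s (u t t' : R) : (size s).+2 = n -> 0 <= t' <= t ->
  poly_majorized (opR (XP (u - t' :: u + t' :: s))) (opR (XP (u - t :: u + t :: s))).
Proof.
move=> sn /andP[t'0 tt'].
pose h := opR (XP s); pose g := opR (XP (u :: s)).
have fE v : opR (XP (u - v :: u + v :: s)) = opR ('X * XP (u :: s)) - u *: g - v ^+ 2 *: h.
  have -> : XP (u - v :: u + v :: s) = 'X * XP (u :: s) - u *: XP (u :: s) - v ^+ 2 *: XP s.
    by rewrite !XP_cons -!mul_polyC expr2 !(polyCB, polyCD, polyCM); ring.
  by rewrite !opRB !opRZ.
have hf : nz (opR (XP (u - t' :: u + t' :: s))) by apply: symb_stable_real.
have -> : opR (XP (u - t :: u + t :: s)) =
    opR (XP (u - t' :: u + t' :: s)) - (t ^+ 2 - t' ^+ 2) *: h.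
  by rewrite !fE scalerBl opprB addrA subrK.
have d0 : 0 <= t ^+ 2 - t' ^+ 2.
  by rewrite subr_ge0 lerXn2r ?nnegrE // (le_trans t'0).
have [h0|[hh sh lh]] := degree_drop_low u sn.
  by rewrite /h h0 scaler0 subr0; exact: poly_majorized_refl.
have [hg sg lg] := @degree_drop (u :: s) sn.
have e0 : e != 0 by apply/eqP => e0; move/eqP: ee; rewrite e0 mul0r eq_sym oner_eq0.
have [sf lf] := @opR_XP_lead (u - t' :: u + t' :: s) sn.
(* The factor [e] sits on the middle polynomial alone, which corrects the signs of both adjacent
   Nevanlinna pairs and of both products of leading coefficients. *)
apply: (@pencil_majorized _ _ _ (e *: g)) => //.
- exact: rrootedZ.
(* The term in g drops out of [cross]; what is left is the nonnegative value of [Nev_mulX] plus t'^2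
   times that of [Nev_cons]. *)
- move=> z z0; rewrite fE !rmorphB /= !map_polyZ !hornerD !hornerN !hornerZ.
  rewrite !(crossDl, crossNl, crossZl, crossZr, crosszz) !mulr0 subr0.
  have := @Nev_mulX (u :: s) sn z z0; rewrite map_polyZ hornerZ crossZr.
  have := @Nev_cons s u sn z z0; rewrite map_polyZ hornerZ crossZr -/g -/h crossC.
  move=> /(mulr_ge0 (sqr_ge0 t')) /=.
  by move: (cross _ _) (cross _ _) => a b; lra.
- move=> z z0; have := @Nev_cons s u sn z z0.
  by rewrite !map_polyZ !hornerZ !crossZr crossZl.
- by rewrite lf lead_coefZ.
- by rewrite lead_coefZ -mulrA mulrCA.
- by rewrite size_scale // sf.
- by rewrite size_scale.
Qed.

Lemma symb_stable_majorized x y : sorted <=%R x -> sorted <=%R y -> size x = n ->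
  majorized x y -> poly_majorized (opR (XP x)) (opR (XP y)).
Proof.
move=> sx sy xn mj; rewrite -(cats0 x) -(cats0 y).
apply: (@majorized_chain _ n (fun s => opR (XP s))) => //.
- by move=> s s' /XP_perm ->.
- by move=> c u t t' cn tt; exact: pinch_majorized.
- by move=> s sn; apply/poly_majorized_refl/symb_stable_real.
- by rewrite addn0.
Qed.

End StableSymbol.

(** * Degree conditions *)

Section Degrees.
Variable R : realType.
Variables (n : nat) (tau : nat -> {poly R}).
Local Notation opR := (opR n tau).
Implicit Types (p q r : {poly R}) (s c : seq R).

Lemma opR_coef_X i (b : R) p : ((opR (('X - b%:P) * p))`_i : R^o) = (opR ('X * p))`_i - b *: ((opR p)`_i : R^o).
Proof. by rewrite opR_XsubC coefB coefZ. Qed.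

Lemma tau_coef0 d i : (d <= n)%N -> (forall s, size s = d -> (opR (XP s))`_i = 0) ->
  forall k, (k <= d)%N -> (tau k)`_i = 0.
Proof.
move=> dn h k kd; rewrite -(@opR_Xn _ n) ?(leq_trans kd) // -XP_nseq0.
apply: (@XP_span_zero R _ (fun p => (opR p)`_i : R^o) k (d - k)); last by rewrite size_nseq.
  by move=> b p; exact: opR_coef_X.
by move=> s sk; apply: h; rewrite sk subnK.
Qed.

Lemma degree_condition m : (0 < n)%N -> (forall s, size s = n -> size (opR (XP s)) = m.+1) ->
  forall k, (k < n)%N -> (size (tau k) < size (tau n))%N.
Proof.
move=> n0 h k kn.
have -> : size (tau n) = m.+1 by rewrite -(@opR_Xn _ n) // -XP_nseq0 h // size_nseq.
rewrite ltnS; apply/leq_sizeP => i mi.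
have kn1 : (k <= n.-1)%N by rewrite -ltnS prednK.
apply: (tau_coef0 (leq_pred n)) kn1 => s sn.
have sn1 (b : R) : size (b :: s) = n by rewrite /= sn prednK.
apply/eqP/negPn/negP => t0.
move: mi; rewrite leq_eqVlt => /orP[/eqP im|mi].
  (* The zero for which the coefficient of degree m, here the leading one, cancels. *)
  pose b := (opR ('X * XP s))`_i / (opR (XP s))`_i.
  have : (opR (XP (b :: s)))`_i = 0 by rewrite XP_cons opR_XsubC coefB coefZ divfK // subrr.
  have hs := h _ (sn1 b); rewrite -im -[m]/(m.+1.-1) -hs -lead_coefE.
  by move/eqP; rewrite lead_coef_eq0 -size_poly_eq0 hs.
have z (b : R) : (opR ('X * XP s))`_i - b * (opR (XP s))`_i = 0.
  by rewrite -coefZ -coefB -opR_XsubC -XP_cons nth_default // h.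
have := z 0; rewrite mul0r subr0 => z0; have := z 1.
by rewrite z0 mul1r sub0r => /eqP; rewrite oppr_eq0 (negPf t0).
Qed.

(** Equal leading coefficients and equal sums of zeros fix the two highest coefficients, so the
    difference lies at least two degrees lower. *)
Lemma majorized_size_gap f (s : R) q : s != 0 -> poly_majorized f (f - s *: q) ->
  q = 0 \/ ((size q).+2 <= size f)%N.
Proof.
move=> s0 [m [[/hyperbolicP hf sf] [/hyperbolicP hg sg] lfg [_ sums _]]].
set g := f - s *: q in hg sg lfg sums.
have qE : q = s^-1 *: (f - g) by rewrite /g opprB addrCA subrr addr0 scalerA mulVf // scale1r.
have qm i : (m <= i)%N -> q`_i = 0.
  move=> mi; rewrite qE coefZ coefB; move: mi; rewrite leq_eqVlt => /orP[/eqP <-|mi].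
    move: lfg; rewrite !lead_coefE sf sg /= => ->; by rewrite subrr mulr0.
  by rewrite !nth_default ?sf ?sg // subrr mulr0.
have [m0|m0] := posnP m.
  by left; apply/polyP => i; rewrite coef0 qm // m0.
right; rewrite sf ltnS -(ltn_predK m0) ltnS; apply/leq_sizeP => i.
rewrite leq_eqVlt => /orP[/eqP <-|mi]; last by apply: qm; rewrite -(ltn_predK m0).
have zf : size (zeros f) = m by apply: succn_inj; rewrite -size_zeros.
have zg : size (zeros g) = m by apply: succn_inj; rewrite -size_zeros.
rewrite qE coefZ coefB (rrooted_split hf) (rrooted_split hg) !coefZ lfg /XP -{1}zf -zg.
rewrite !coefPn_prod_XsubC ?zf ?zg -?lt0n // sums.
by rewrite subrr mulr0.
Qed.

Lemma pinch_sorted (u t : R) c : 0 <= t ->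
  majorized (sort <=%R (u :: u :: c)) (sort <=%R (u - t :: u + t :: c)).
Proof.
move=> t0; have srt s : sorted <=%R (sort <=%R s) by apply: sort_sorted; exact: le_total.
have ngtS s v : count_gt (sort <=%R s) v = count_gt s v by apply/permP/permEl/perm_sort.
have sumS s : \sum_(a <- sort <=%R s) a = \sum_(a <- s) a by apply/perm_big/permEl/perm_sort.
apply: (@crossing_majorized _ u) => //.
- by rewrite !size_sort.
- by rewrite !sumS !big_cons; ring.
- move=> v vu; rewrite !ngtS /count_gt /= vu.
  by case: (v < u - t) => //=; case: (v < u + t) => //=; rewrite ?add0n ?add1n // ltnW.
- by move=> v vu; rewrite !ngtS /count_gt /= ltNge vu /= !add0n addnA leq_addl.
Qed.

Lemma XP_sort s : XP (sort <=%R s) = XP s.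
Proof. by apply/XP_perm/permEl/perm_sort. Qed.

Hypothesis hyp : forall x y, sorted <=%R x -> sorted <=%R y -> size x = n ->
  majorized x y -> poly_majorized (opR (XP x)) (opR (XP y)).

Lemma majorization_hyperbolic s : size s = n -> nz (opR (XP s)).
Proof.
move=> sn; have srt : sorted <=%R (sort <=%R s) by apply: sort_sorted; exact: le_total.
have := hyp srt srt; rewrite size_sort XP_sort => /(_ sn (majorized_refl _)).
by move=> [m [[/hyperbolicP]]].
Qed.

(** Pinching the zeros u - 1, u + 1 to u, u changes the polynomial by exactly [XP c]. *)
Lemma majorization_gap (u : R) c : (size c).+2 = n ->
  opR (XP c) = 0 \/ ((size (opR (XP c))).+2 <= size (opR (XP (u :: u :: c))))%N.
Proof.
move=> cn; apply: (@majorized_size_gap _ 1); first exact: oner_neq0.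
have := @pinch_sorted u 1 c ler01 => /hyp; rewrite !size_sort !XP_sort.
have srt s : sorted <=%R (sort <=%R s) by apply: sort_sorted; exact: le_total.
move=> /(_ (srt _) (srt _) cn); rewrite -opRZ -opRB.
suff -> : XP (u :: u :: c) - 1 *: XP c = XP (u - 1 :: u + 1 :: c) by [].
by rewrite !XP_cons scale1r !(polyCB, polyCD) polyC1; ring.
Qed.

Lemma opR_size_bound p : (size (opR p) <= \max_(k < n.+1) size (tau k))%N.
Proof.
apply: (leq_trans (size_sum _ _ _)); apply/bigmax_leqP => k _.
by apply: (leq_trans (size_scale_leq _ _)); exact: (leq_bigmax k).
Qed.

(** The sizes of images are bounded, so some product of degree n - 2 attains the maximum. By
    [tau_coef0] a bound for these products extends to all polynomials of degree at most n - 2. *)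
Lemma majorization_maximal : (exists2 k, (k.+2 <= n)%N & tau k != 0) -> exists c,
  [/\ (size c).+2 = n, opR (XP c) != 0 &
    forall p, (size p < n)%N -> (size (opR p) <= size (opR (XP c)))%N].
Proof.
move=> [k kn tk].
pose P i := boolp.asbool (exists c, (size c).+2 = n /\ size (opR (XP c)) = i).
have exP : exists i, P i.
  exists (size (opR (XP (nseq n.-2 0)))); apply/boolp.asboolP.
  by exists (nseq n.-2 0); rewrite size_nseq; split=> //; lia.
have bP i : P i -> (i <= \max_(k < n.+1) size (tau k))%N.
  by move=> /boolp.asboolP[c [_ <-]]; exact: opR_size_bound.
case: (ex_maxnP exP bP) => d /boolp.asboolP[c [cn cd]] max; exists c.
have low j : (j.+2 <= n)%N -> (size (tau j) <= d)%N.
  move=> jn; apply/leq_sizeP => i di; apply: (@tau_coef0 n.-2) => //; [by lia| |by lia].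
  move=> s sn; rewrite nth_default // (leq_trans _ di) // max //.
  by apply/boolp.asboolP; exists s; split=> //; lia.
split=> //.
  rewrite -size_poly_gt0 cd lt0n; apply: contraNneq tk => d0.
  by rewrite -size_poly_leq0 -d0 low.
move=> p pn; rewrite cd; apply: (leq_trans (size_sum _ _ _)); apply/bigmax_leqP => j _.
have [jn|nj] := ltnP j.+1 n.
  by apply: (leq_trans (size_scale_leq _ _)); exact: low.
have pj : p`_j = 0 by apply: nth_default; rewrite -ltnS (leq_trans pn nj).
by rewrite pj scale0r size_poly0.
Qed.

Lemma majorization_degrees : (exists2 k, (k.+2 <= n)%N & tau k != 0) ->
  (forall k, (k < n)%N -> (size (tau k) < size (tau n))%N) /\
  exists p1 p2 p3, forall a b d : R, a *: opR p1 + b *: opR p2 + d *: opR p3 = 0 ->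
    [/\ a = 0, b = 0 & d = 0].
Proof.
move=> /majorization_maximal [c [cn Q0 max]].
pose Q := opR (XP c); pose M := opR ('X * XP c).
have hyp0T s : size s = n -> rrooted0 (opR (XP s)) by move=> sn; right; exact: majorization_hyperbolic.
have size_low s : (size (XP s - 'X^(size s))%R <= size s)%N.
  apply/leq_sizeP => i; rewrite leq_eqVlt => /orP[/eqP <-|si].
    have := lead_coef_XP s; rewrite lead_coefE size_XP /= => l1.
    by rewrite coefB l1 coefXn eqxx subrr.
  by rewrite coefB coefXn nth_default ?size_XP // gtn_eqF // subr0.
have sizeM : (size M <= (size Q).+1)%N.
  apply: pencil_size => // t.
  have -> : M + t *: Q = opR (XP (- t :: c)) by rewrite XP_cons opR_XsubC scaleNr opprK.
  by apply: (@rrooted0_lower _ n tau (size (- t :: c)) 1) => // s; rewrite /= add1n cn; exact: hyp0T.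
have sizen : ((size Q).+2 <= size (tau n))%N.
  (* The double zero makes the sum of all zeros 0, so [XP (u :: u :: c)] differs from z^n only in
     degree at most n - 2, where images are no larger than [Q]. *)
  pose u := - (\sum_(a <- c) a) / 2.
  have [/eqP|gap] := @majorization_gap u c cn; first by rewrite (negPf Q0).
  pose L := XP (u :: u :: c) - 'X^n.
  have sL : (size L < n)%N.
    rewrite -cn ltnS; apply/leq_sizeP => i; rewrite leq_eqVlt => /orP[/eqP <-|si].
      rewrite /L coefB coefXn -cn -[(size c).+1]/((size (u :: u :: c)).-1) /XP.
      rewrite coefPn_prod_XsubC // ltn_eqF //= subr0 !big_cons; rewrite /u; lra.
    apply: nth_default; apply: leq_trans si; rewrite /L -cn.
    exact: (size_low (u :: u :: c)).
  have tE : tau n = opR (XP (u :: u :: c)) - opR L.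
    by rewrite /L opRB opprB addrCA subrr addr0 opR_Xn.
  have lt : (size (- opR L)%R < size (opR (XP (u :: u :: c))))%N.
    by rewrite size_polyN; apply: leq_ltn_trans (max _ sL) _; apply: leq_trans gap.
  by rewrite tE size_polyDl.
have n2 : (2 <= n)%N by rewrite -cn.
have dc k : (k < n)%N -> (size (tau k) < size (tau n))%N.
  move=> kn; apply: leq_trans sizen; rewrite ltnS.
  have [kn2|nk] := ltnP k.+1 n.
    rewrite -(@opR_Xn _ n) ?(ltnW kn) //; apply: (leq_trans (max _ _)) => //.
    by rewrite size_polyXn.
  have kE : k = (size c).+1 by apply/eqP; rewrite -eqSS cn eqn_leq nk kn.
  (* Likewise z^(n-1) differs from z XP c only in degree at most n - 2. *)
  pose L := 'X * XP c - 'X^k.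
  have sL : (size L < n)%N.
    rewrite /L kE exprS -mulrBr -cn ltnS.
    have [->|x0] := eqVneq (XP c - 'X^(size c)) 0; first by rewrite mulr0 size_poly0.
    by rewrite mulrC size_mulX // ltnS size_low.
  have -> : tau k = M - opR L by rewrite /L opRB opprB addrCA subrr addr0 opR_Xn // ltnW.
  apply: (leq_trans (size_polyD _ _)); rewrite geq_max sizeM size_polyN.
  by apply: leqW; exact: max.
split=> //; exists 'X^n, ('X * XP c), (XP c) => a b d; rewrite opR_Xn // -/M -/Q => E.
have a0 : a = 0.
  apply/eqP/negPn/negP => a0.
  have : size (a *: tau n) = size (tau n) by rewrite size_scale.
  have -> : a *: tau n = - (b *: M + d *: Q).
    by apply/eqP; rewrite -addr_eq0 addrA E.
  rewrite size_polyN => sz; have : (size (b *: M + d *: Q)%R < size (tau n))%N.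
    apply: leq_ltn_trans sizen; apply: (leq_trans (size_polyD _ _)); rewrite geq_max.
    by rewrite !(leq_trans (size_scale_leq _ _)) // (leq_trans sizeM).
  by rewrite sz ltnn.
move: E; rewrite a0 scale0r add0r => E.
have b0 : b = 0.
  apply/eqP/negPn/negP => b0; pose mu := - d / b.
  have ME : M = mu *: Q.
    apply: (scalerI b0); rewrite scalerA /mu mulrC divfK //.
    by rewrite scaleNr; apply/eqP; rewrite -addr_eq0 E.
  pose P := opR ('X * ('X * XP c)).
  have : (size P <= (size Q).+1)%N.
    apply: pencil_size => // t.
    (* If M = mu Q, then T((z - x)(z - y) XP c) = P + (x y - (x + y) mu) Q, and this choice makes
       the bracket equal to t. So the whole pencil P + t Q is real-rooted and deg P <= deg Q + 1,
       whereas P has the degree of T(z^n). *)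
    pose x := mu + 1; pose y := t + mu ^+ 2 + mu.
    have -> : P + t *: Q = opR (XP (x :: y :: c)).
      rewrite !XP_cons opR_XsubC mulrCA !opR_XsubC -/P -/M -/Q.
      rewrite ME !scalerBr !scalerA opprB addrA -!scaleNr -!addrA -!scalerDl.
      by congr (_ + _ *: _); rewrite /x /y; ring.
    by apply: hyp0T; rewrite /= cn.
  have EP : 'X * ('X * XP c) = XP (0 :: 0 :: c) by rewrite !XP_cons subr0.
  have [||sP _] := @opR_high R n tau (ltnW n2) dc (XP (0 :: 0 :: c)).
  - by rewrite XP_coefn ?oner_neq0.
  - by rewrite size_XP /= cn.
  rewrite /P EP sP => /(leq_trans sizen); by rewrite ltnn.
move: E; rewrite b0 scale0r add0r => /eqP; rewrite scaler_eq0 (negPf Q0) orbF => /eqP d0.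
by split.
Qed.

End Degrees.

(** * The image and the symbol of an operator *)

Section Operator.
Variables (R : realType) (n : nat) (T : {linear {poly_n.+1 R} -> {poly R}}).
Local Notation C := R[i].
Local Notation toC := (map_poly (real_complex R)).
Local Notation opR := (opR n (Tmon T)).
Implicit Types (p q : {poly_n.+1 R}) (f g : {poly R}) (s : seq R).

Lemma operatorE p : T p = opR p.
Proof.
have pE : p = \sum_(k < n.+1) p`_k *: npolyp n.+1 'X^k.
  apply/npolyP => i; rewrite coefn_sum (eq_bigr (fun k : 'I_n.+1 => p`_k *+ (i == k))).
    have [ni|ni] := leqP n.+1 i.
      rewrite big_coef_npoly // big1 // => k _; rewrite gtn_eqF ?mulr0n //.
      exact: leq_trans ni.
    rewrite (bigD1 (Ordinal ni)) //= eqxx mulr1n big1 ?addr0 // => k ki.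
    by rewrite (_ : i == k = false) //; apply: contra_neqF ki => /eqP ik; apply/val_inj.
  move=> k _; rewrite /= coefZ coef_npolyp coefXn.
  by have [->|] := eqVneq i k; rewrite ?ltn_ord ?mulr1 // if_same mulr0.
by rewrite {1}pE linear_sum; apply: eq_bigr => k _; rewrite linearZ.
Qed.

Lemma operator_npolyp f : T (npolyp n.+1 f) = opR f.
Proof. by rewrite operatorE; apply: eq_bigr => k _; rewrite coef_npolyp ltn_ord. Qed.

(** An arbitrary morphism to the complex numbers covers the evaluations of both [symbol] and
    [symbol_neg]. *)
Lemma rmorph_symbol (G : {rmorphism {mpoly R[2]} -> C}) : (forall c : R, G c%:MP = c%:C) ->
  G (symbol T) = symb n (Tmon T) (G 'X_0) (G 'X_1).
Proof.
move=> GC; rewrite /symbol rmorph_sum /symb opC_pairing; apply: eq_bigr => k _.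
rewrite rmorphMn rmorphM rmorphXn /= coef_XDexp -horner_map /= -map_poly_comp.
rewrite (eq_map_poly (g := real_complex R)) => [|c]; last exact: GC.
by rewrite mulrC mulrnAl.
Qed.

Lemma symbol_meval (v : 'I_2 -> C) :
  (map_mpoly (real_complex R) (symbol T)).@[v] = symb n (Tmon T) (v 0) (v 1).
Proof.
have -> : (map_mpoly (real_complex R) (symbol T)).@[v] =
  (meval v \o map_mpoly (real_complex R)) (symbol T) by [].
rewrite rmorph_symbol => [|c] /=; first by rewrite !map_mpolyX !mevalXU.
by rewrite map_mpolyC mevalC.
Qed.

Lemma symbol_neg_meval (v : 'I_2 -> C) :
  (map_mpoly (real_complex R) (symbol_neg T)).@[v] = symb n (Tmon T) (v 0) (- v 1).
Proof.
have -> : (map_mpoly (real_complex R) (symbol_neg T)).@[v] =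
  (meval v \o map_mpoly (real_complex R) \o comp_mpoly [tuple 'X_0; - 'X_1]) (symbol T) by [].
rewrite rmorph_symbol => [|c] /=; last by rewrite comp_mpolyC map_mpolyC mevalC.
by rewrite !comp_mpolyXU /= rmorphN /= !map_mpolyX mevalN !mevalXU.
Qed.

Lemma real_stable_symbol : real_stable (symbol T) <-> symb_stable n (Tmon T) 1.
Proof.
split=> [h z w z0 w0|h v v0]; last first.
  by rewrite symbol_meval -[v 1]mul1r; apply: h.
have := h (fun i => if i == 0 then z else w).
by rewrite symbol_meval /= mul1r; apply => i; case: ifP.
Qed.

Lemma real_stable_symbol_neg : real_stable (symbol_neg T) <-> symb_stable n (Tmon T) (-1).
Proof.
split=> [h z w z0 w0|h v v0]; last first.
  by rewrite symbol_neg_meval -mulN1r -(rmorphN1 (real_complex R)); apply: h.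
have := h (fun i => if i == 0 then z else w).
by rewrite symbol_neg_meval /= rmorphN1 mulN1r; apply => i; case: ifP.
Qed.

Lemma degenerate_line f : (exists p, T p = f) ->
  (forall p, exists c : R, T p = c *: f) -> degenerate T.
Proof.
move=> imf span; have [f0|f0] := eqVneq f 0.
  exists 0%N => //; exists (fun _ => 0); split=> [[]|c _ []|_ [p <-]] //.
  by have [c ->] := span p; exists (fun _ => 0); rewrite big_ord0 f0 scaler0.
exists 1%N => //; exists (fun _ => f); split=> [//|c|_ [p <-]].
  by rewrite big_ord1 => /eqP; rewrite scaler_eq0 (negPf f0) orbF => /eqP c0 i; rewrite ord1.
by have [c ->] := span p; exists (fun _ => c); rewrite big_ord1.
Qed.

Lemma degenerate_plane f g : (exists p, T p = f) -> (exists p, T p = g) ->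
  (forall p, exists a b : R, T p = a *: f + b *: g) -> degenerate T.
Proof.
move=> imf img span.
have [[c fg]|nfg] := boolp.EM (exists c : R, f = c *: g).
  apply: (degenerate_line img) => p; have [a [b ->]] := span p.
  by exists (a * c + b); rewrite fg scalerA scalerDl.
have [[c gf]|ngf] := boolp.EM (exists c : R, g = c *: f).
  apply: (degenerate_line imf) => p; have [a [b ->]] := span p.
  by exists (a + b * c); rewrite gf scalerA scalerDl.
exists 2%N => //; exists (fun i => if i == 0 then f else g); split.
- by move=> i; case: ifP.
- move=> c; rewrite !big_ord_recl big_ord0 addr0 /= => E.
  have c0 : c 0 = 0.
    apply/eqP/negPn/negP => c0; apply: nfg; exists (- (c 0)^-1 * c (lift ord0 ord0)).
    apply: (scalerI c0); rewrite scalerA mulrA mulrN divff // mulN1r scaleNr.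
    by apply/eqP; rewrite -addr_eq0 E.
  have c1 : c (lift ord0 ord0) = 0.
    move: E; rewrite c0 scale0r add0r => /eqP; rewrite scaler_eq0 => /orP[/eqP //|/eqP g0].
    by case: ngf; exists 0; rewrite g0 scale0r.
  move=> i; case: (unliftP ord0 i) => [j ->|->//].
  by rewrite (ord1 j).
- move=> _ [p <-]; have [a [b ->]] := span p; exists (fun i => if i == 0 then a else b).
  by rewrite !big_ord_recl big_ord0 addr0.
Qed.

Lemma degenerate_top : (forall k, (k < n)%N -> Tmon T k = 0) -> degenerate T.
Proof.
move=> z; apply: (@degenerate_line (Tmon T n)) => [|p]; first by exists (npolyp n.+1 'X^n).
exists p`_n; rewrite operatorE /opR big_ord_recr /= big1 ?add0r // => k _.
by rewrite z ?scaler0.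
Qed.

(* A nonzero hyperbolic polynomial does not vanish at i, so evaluation at i
   embeds the image of T in the real plane of complex numbers. *)
Lemma degenerate_rrooted0 : (forall f, (size f <= n.+1)%N -> rrooted0 (opR f)) -> degenerate T.
Proof.
move=> h; have hT p : rrooted0 (T p) by rewrite operatorE; apply: h; exact: size_npoly.
pose ev f := (toC f).['i].
have ev0 p : ev (T p) = 0 -> T p = 0.
  move=> e0; case: (hT p) => // hp; have := hp 'i; rewrite /= ltr01 => /(_ isT).
  by rewrite -/(ev _) e0 eqxx.
have evZD (a b : R) f g : ev (a *: f + b *: g) = a%:C * ev f + b%:C * ev g.
  by rewrite /ev rmorphD /= !map_polyZ hornerD !hornerZ.
have [[p1 [p2 c12]]|all0] := boolp.EM (exists p1 p2, cross (ev (T p1)) (ev (T p2)) != 0).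
  apply: (@degenerate_plane (T p1) (T p2)); [by exists p1|by exists p2|move=> p].
  (* Cramer's rule in the real plane of complex numbers. *)
  pose D := cross (ev (T p1)) (ev (T p2)).
  pose a := cross (ev (T p)) (ev (T p2)) / D; pose b := cross (ev (T p1)) (ev (T p)) / D.
  exists a, b; apply/eqP; rewrite -subr_eq0; apply/eqP.
  have E : T p - (a *: T p1 + b *: T p2) = T (p - (a *: p1 + b *: p2)).
    by rewrite [RHS]linearB; congr (_ - _); rewrite linearD !linearZ.
  rewrite E; apply: ev0; rewrite -E -[T p]scale1r -scaleN1r evZD evZD.
  move: c12; rewrite /a /b /D /cross; case: (ev (T p)) (ev (T p1)) (ev (T p2)) => [x y] [x1 y1] [x2 y2] /= D0.
  by apply/eqP; rewrite eq_complex /=; apply/andP; split; apply/eqP; field.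
have [[p1 n1]|none] := boolp.EM (exists p1, T p1 != 0).
  apply: (@degenerate_line (T p1)) => [|p]; first by exists p1.
  have /cross_eq0_dep [a [b [ab E]]] : cross (ev (T p1)) (ev (T p)) = 0.
    by apply/eqP/negPn/negP => c0; apply: all0; exists p1, p.
  move: E; rewrite -evZD -!linearZ -linearD => /ev0; rewrite linearD !linearZ /= => E.
  have b0 : b != 0.
    apply: contraTneq ab => b0; rewrite b0 eqxx orbF negbK; move: E.
    by rewrite b0 scale0r addr0 => /eqP; rewrite scaler_eq0 (negPf n1) orbF.
  exists (- a / b); apply: (scalerI b0); rewrite scalerA mulrC divfK // scaleNr.
  by apply/eqP; rewrite -addr_eq0 addrC E.
apply: (@degenerate_line 0) => [|p]; first by exists 0; rewrite linear0.
exists 0; rewrite scale0r; apply/eqP/negPn/negP => p0; apply: none; by exists p.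
Qed.

Lemma nondegenerate_free p1 p2 p3 :
  (forall a b d : R, a *: T p1 + b *: T p2 + d *: T p3 = 0 -> [/\ a = 0, b = 0 & d = 0]) ->
  ~ degenerate T.
Proof.
move=> free [d [e [_ _ span]] d2].
have [c1 E1] := span _ (ex_intro _ p1 erefl).
have [c2 E2] := span _ (ex_intro _ p2 erefl).
have [c3 E3] := span _ (ex_intro _ p3 erefl).
(* Three rows of coordinates in at most two columns have a nontrivial linear relation. *)
pose A := \matrix_(j < 3, i < d) (if j == 0 then c1 i else if j == 1 then c2 i else c3 i).
have : kermx A != 0.
  rewrite -mxrank_eq0 mxrank_ker subn_eq0 -ltnNge.
  by apply: leq_ltn_trans (rank_leq_col A) _.
move=> /rowV0Pn [u /sub_kermxP uA /negP]; apply.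
have rel i : u 0 0 * c1 i + u 0 (lift 0 0) * c2 i + u 0 (lift 0 (lift 0 0)) * c3 i = 0.
  have := congr1 (fun M : 'M[R]_(1, d) => M 0 i) uA.
  by rewrite !mxE !big_ord_recl big_ord0 !mxE /= addr0 addrA; apply.
have [|u0 u1 u2] := free (u 0 0) (u 0 (lift 0 0)) (u 0 (lift 0 (lift 0 0))).
  rewrite E1 E2 E3 !scaler_sumr -!big_split big1 // => i _ /=.
  by rewrite !scalerA -!scalerDl rel scale0r.
apply/eqP/rowP => j; rewrite mxE.
case: (unliftP 0 j) => [k ->|->//]; case: (unliftP 0 k) => [l ->|->//].
by rewrite (ord1 l).
Qed.

End Operator.

(** * The equivalences *)

Section Equivalences.
Variables (R : realType) (n : nat) (T : {linear {poly_n.+1 R} -> {poly R}}).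
Local Notation tau := (Tmon T).
Local Notation opR := (opR n (Tmon T)).
Implicit Types (p q : {poly_n.+1 R}) (f g : {poly R}) (s : seq R).
Hypothesis n0 : (0 < n)%N.

Lemma hyperbolic_deg_XP s : size s = n -> hyperbolic_deg n (npolyp n.+1 (XP s) : {poly R}).
Proof.
move=> sn; rewrite npolypK ?size_XP ?sn //; split; last by rewrite size_XP sn.
exact/hyperbolicP/rrooted_XP.
Qed.

Lemma poly_majorizedZ (c : R) f g : c != 0 -> poly_majorized f g ->
  poly_majorized (c *: f) (c *: g).
Proof.
move=> c0 [m [[/hyperbolicP hf sf] [/hyperbolicP hg sg] lfg mj]].
have zZ h : nz h -> zeros (c *: h) = zeros h.
  move=> hh; rewrite {1}(rrooted_split hh) scalerA zeros_sortedE ?sorted_zeros //.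
  by rewrite mulf_neq0 // lead_coef_eq0 rrooted_neq0.
exists m; split; rewrite ?lead_coefZ ?lfg ?zZ //; split; rewrite ?size_scale //.
  by apply/hyperbolicP/rrootedZ.
by apply/hyperbolicP/rrootedZ.
Qed.

Lemma hyperbolic_deg_split p : hyperbolic_deg n p ->
  [/\ lead_coef p != 0, (p : {poly R}) = lead_coef p *: XP (zeros p) & size (zeros p) = n].
Proof.
move=> [/hyperbolicP hp sp]; split; last 1 first.
- by apply: succn_inj; rewrite -size_zeros.
- by rewrite lead_coef_eq0 rrooted_neq0.
- exact: rrooted_split.
Qed.

Lemma operator_hyperbolic p : hyperbolic_deg n p -> T p = lead_coef p *: opR (XP (zeros p)).
Proof. by move=> /hyperbolic_deg_split[_ pE _]; rewrite operatorE {1}pE opRZ. Qed.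

Section Preserver.
Variable m : nat.
Hypothesis hm : forall p, hyperbolic_deg n p -> hyperbolic_deg m (T p).
Hypothesis nondeg : ~ degenerate T.

Lemma preserver_XP s : size s = n -> nz (opR (XP s)) /\ size (opR (XP s)) = m.+1.
Proof.
move=> sn; rewrite -operator_npolyp; have [/hyperbolicP] := hm (hyperbolic_deg_XP sn).
by split.
Qed.

Lemma preserver_degrees k : (k < n)%N -> (size (tau k) < size (tau n))%N.
Proof. by apply: (@degree_condition R n tau m n0) => s /preserver_XP[]. Qed.

Lemma preserver_stable : symb_stable n tau 1 \/ symb_stable n tau (-1).
Proof.
apply: preserver_stab => //; first by move=> s /preserver_XP[hs _]; right.
by move=> h; apply: nondeg; exact: degenerate_rrooted0.
Qed.

Lemma preserver_majorization : preserves_majorization T.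
Proof.
move=> p q hp hq [k [_ _ lpq mj]].
have [lp pE sp] := hyperbolic_deg_split hp; have [lq qE sq] := hyperbolic_deg_split hq.
have nd : exists2 k, (k < n)%N & tau k != 0.
  apply: boolp.contrapT => none; apply: nondeg; apply: degenerate_top => j jn.
  by apply/eqP/negPn/negP => tj; apply: none; exists j.
rewrite (operator_hyperbolic hp) (operator_hyperbolic hq) -lpq.
apply: poly_majorizedZ => //.
have [st|st] := preserver_stable.
  exact: (symb_stable_majorized (mulr1 1) st n0 preserver_degrees nd (sorted_zeros p) (sorted_zeros q)).
have ee : (-1) * (-1) = 1 :> R by rewrite mulrNN mulr1.
exact: (symb_stable_majorized ee st n0 preserver_degrees nd (sorted_zeros p) (sorted_zeros q)).
Qed.

End Preserver.

Lemma stable_preserver : symb_stable n tau 1 \/ symb_stable n tau (-1) ->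
  (forall k, (k < n)%N -> (size (tau k) < size (tau n))%N) ->
  exists m, forall p, hyperbolic_deg n p -> hyperbolic_deg m (T p).
Proof.
move=> st dc; exists (size (tau n)).-1 => p hp.
have [lp pE sp] := hyperbolic_deg_split hp.
have tn : (0 < size (tau n))%N by apply: leq_ltn_trans (dc 0%N n0).
have nzT : nz (opR (XP (zeros p))).
  case: st => st; first exact: (symb_stable_real (mulr1 1) st).
  by apply: (symb_stable_real _ st) => //; rewrite mulrNN mulr1.
rewrite operator_hyperbolic //; split; first exact/hyperbolicP/rrootedZ.
by rewrite size_scale // (opR_XP_lead n0 dc sp).1 prednK.
Qed.

(** Majorization fixes the leading coefficient and the sum of the zeros, hence the two coefficients
    on which T depends; so T q = T p, and only its real-rootedness is left. *)
Lemma two_term_preserves :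
  (forall p, T p = p`_n *: tau n + p`_n.-1 *: tau n.-1) -> hyperbolic (tau n) ->
  tau n.-1 = 0 \/ [/\ hyperbolic (tau n.-1), ~ (exists c : R, tau n.-1 = c *: tau n) &
                      interlacing (tau n.-1) (tau n)] ->
  preserves_majorization T.
Proof.
move=> TE /hyperbolicP hn il p q hp hq [k [_ _ lpq [_ sums _]]].
have [lp pE sp] := hyperbolic_deg_split hp; have [lq qE sq] := hyperbolic_deg_split hq.
have pn : p`_n = lead_coef p by rewrite pE coefZ XP_coefn // mulr1 -pE.
have qn : q`_n = lead_coef q by rewrite qE coefZ XP_coefn // mulr1 -qE.
have pq : p`_n.-1 = q`_n.-1.
  have XPn s : size s = n -> (XP s)`_n.-1 = - \sum_(a <- s) a.
    by move=> sn; rewrite -sn /XP coefPn_prod_XsubC // sn -lt0n.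
  by rewrite pE qE !coefZ lpq !XPn // sums.
have -> : T q = T p by rewrite (TE q) (TE p) qn -lpq -pn -pq.
apply: poly_majorized_refl.
rewrite (TE p) pn; case: il => [->|[/hyperbolicP hn1 indep il]].
  by rewrite scaler0 addr0; exact: rrootedZ.
by apply: interlacing_pencil => //; case: il => il; [right|left].
Qed.

Hypothesis maj : preserves_majorization T.

Lemma preserves_XP x y : sorted <=%R x -> sorted <=%R y -> size x = n ->
  majorized x y -> poly_majorized (opR (XP x)) (opR (XP y)).
Proof.
move=> sx sy xn mj; have yn : size y = n by case: mj => <-.
have hx := hyperbolic_deg_XP xn; have hy := hyperbolic_deg_XP yn.
rewrite -!operator_npolyp; apply: maj => //; exists n; split=> //.
  by rewrite !npolypK ?size_XP ?xn ?yn // !lead_coef_XP.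
rewrite !npolypK ?size_XP ?xn ?yn // -[XP x]scale1r -[XP y]scale1r.
by rewrite !zeros_sortedE ?oner_neq0.
Qed.

Lemma preserves_nondegenerate : (exists2 k, (k.+2 <= n)%N & tau k != 0) ->
  ~ degenerate T /\ exists m, forall p, hyperbolic_deg n p -> hyperbolic_deg m (T p).
Proof.
move=> tk; have [dc [f1 [f2 [f3 free]]]] := majorization_degrees preserves_XP tk.
split; first by apply: (@nondegenerate_free _ _ T (npolyp n.+1 f1) (npolyp n.+1 f2)
  (npolyp n.+1 f3)) => a b d; rewrite !operator_npolyp; exact: free.
exists (size (tau n)).-1 => p hp; have [lp pE sp] := hyperbolic_deg_split hp.
have tn : (0 < size (tau n))%N by apply: leq_ltn_trans (dc 0%N n0).
rewrite operator_hyperbolic //; split.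
  apply/hyperbolicP/rrootedZ => //; exact: (majorization_hyperbolic preserves_XP).
by rewrite size_scale // (opR_XP_lead n0 dc sp).1 prednK.
Qed.

Lemma preserves_two_term : (forall k, (k.+2 <= n)%N -> tau k = 0) ->
  [/\ forall p, T p = p`_n *: tau n + p`_n.-1 *: tau n.-1, tau n != 0, hyperbolic (tau n) &
      tau n.-1 = 0 \/ [/\ hyperbolic (tau n.-1), ~ (exists c : R, tau n.-1 = c *: tau n) &
                          interlacing (tau n.-1) (tau n)]].
Proof.
move=> low; have TTE f : opR f = f`_n *: tau n + f`_n.-1 *: tau n.-1.
  rewrite /opR big_ord_recr /= addrC; congr (_ + _).
  have n1 : (n.-1 < n)%N by rewrite prednK.
  rewrite (bigD1 (Ordinal n1)) //= big1 ?addr0 // => k kn.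
  rewrite low ?scaler0 //; have := ltn_ord k; rewrite -{2}(prednK n0) ltnS leq_eqVlt.
  case/orP => [/eqP kE|]; last by rewrite ltn_predRL.
  by move: kn; rewrite (_ : k = Ordinal n1) ?eqxx //; apply/val_inj.
(* T applied to (z + t) z^(n-1). *)
have pen (t : R) : nz (tau n + t *: tau n.-1).
  have := @majorization_hyperbolic R n tau preserves_XP (- t :: nseq n.-1 0).
  rewrite /= size_nseq prednK // => /(_ erefl); rewrite XP_cons XP_nseq0 opR_XsubC -exprS prednK //.
  by rewrite scaleNr opprK !opR_Xn ?leq_pred.
have hn : nz (tau n) by have := pen 0; rewrite scale0r addr0.
split; [by move=> p; rewrite operatorE TTE|exact: rrooted_neq0|exact/hyperbolicP|].
have [->|t1] := eqVneq (tau n.-1) 0; [by left|right].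
have all := @pencil_all R (tau n) (tau n.-1) (fun t => or_intror (pen t)).
have h1 : nz (tau n.-1).
  by have := all 0 1; rewrite scale0r add0r scale1r => -[/eqP|//]; rewrite (negPf t1).
(* Otherwise the member of the pencil at t = -1/c would be 0. *)
have indep (c : R) : tau n.-1 <> c *: tau n.
  move=> E; have c0 : c != 0 by apply: contra_neq t1 => c0; rewrite E c0 scale0r.
  have := rrooted_neq0 (pen (- c^-1)).
  by rewrite E scalerA mulNr mulVf // scaleN1r subrr eqxx.
split; [exact/hyperbolicP|by case=> c /indep|].
suff : interlacing (tau n) (tau n.-1) by case; [right|left].
apply: Nev_interlacing => //; apply: pencil_sign => // a b ab; apply/negP => /eqP E.
have [b0|b0] := eqVneq b 0.
  move: ab E; rewrite b0 eqxx orbF scale0r addr0 => a0 /eqP.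
  by rewrite scaler_eq0 (negPf a0) (negPf (rrooted_neq0 hn)).
apply: (indep (- a / b)); apply: (scalerI b0); rewrite scalerA mulrC divfK // scaleNr.
by apply/eqP; rewrite -addr_eq0 addrC E.
Qed.

End Equivalences.

(* Sizes stand for degrees: size = degree + 1, and size 0 = 0 encodes
   deg 0 = -oo. *)
Theorem theorem1 (R : realType) (n : nat)
    (T : {linear {poly_n.+1 R} -> {poly R}}) (hn : (1 <= n)%N) :
  (preserves_majorization T <->
     (~ degenerate T /\
        exists m : nat, forall p : {poly_n.+1 R},
          hyperbolic_deg n p -> hyperbolic_deg m (T p)) \/
     [/\ forall p : {poly_n.+1 R},
           T p = p`_n *: Tmon T n + p`_n.-1 *: Tmon T n.-1,
         Tmon T n != 0,
         hyperbolic (Tmon T n) &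
         Tmon T n.-1 = 0 \/
         [/\ hyperbolic (Tmon T n.-1),
             ~ (exists c : R, Tmon T n.-1 = c *: Tmon T n) &
             interlacing (Tmon T n.-1) (Tmon T n)]]) /\
  ((~ degenerate T /\
      exists m : nat, forall p : {poly_n.+1 R},
        hyperbolic_deg n p -> hyperbolic_deg m (T p)) <->
   [/\ ~ degenerate T,
       real_stable (symbol T) \/ real_stable (symbol_neg T) &
       forall k : nat, (k < n)%N -> (size (Tmon T k) < size (Tmon T n))%N]).
Proof.
have n0 : (0 < n)%N by [].
split; split.
- move=> maj; have [tk|none] := boolp.EM (exists2 k, (k.+2 <= n)%N & Tmon T k != 0).
    by left; exact: preserves_nondegenerate.
  right; apply: preserves_two_term => // k kn.
  by apply/eqP/negPn/negP => tk; apply: none; exists k.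
- by case=> [[nondeg [m hm]]|[TE _ h il]];
    [exact: (preserver_majorization n0 hm)|exact: two_term_preserves].
- move=> [nondeg [m hm]]; split=> //; last exact: (preserver_degrees n0 hm).
  by case: (preserver_stable n0 hm nondeg) => st; [left; exact/real_stable_symbol|
    right; exact/real_stable_symbol_neg].
- move=> [nondeg st dc]; split=> //; apply: stable_preserver => //.
  by case: st => st; [left; exact/real_stable_symbol|right; exact/real_stable_symbol_neg].
Qed.
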